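(* Let $t\in\mathbb{C}$ with $|t|<1/2$. Then \[ j\left(\frac{s^{-1}_i(C_i(t))+1}{2}\right)=64\,\frac{(16t^2-3)^3}{4t^2-1}. \]
   Context: $j(\tau)=q^{-1}+744+196884q+\cdots$ ($q=e^{2\pi i\tau}$) is Klein's modular $j$-function on the upper half plane $\mathbb{H}$. For $a,b\in\mathbb{R}$, $c\in\mathbb{R}$ not a non-positive integer, and $|z|<1$, the Gauss hypergeometric function is ${}_2F_1(a,b;c;z)=\sum_{n\ge0}\frac{(a)_n(b)_n}{(c)_n n!}z^n$, where $(s)_n=s(s+1)\cdots(s+n-1)$. Define \[ C_i(t):=t\cdot\frac{{}_2F_1\left(\tfrac34,\tfrac34;\tfrac32;4t^2\right)}{{}_2F_1\left(\tfrac14,\tfrac14;\tfrac12;4t^2\right)}. \] Let $\Omega_i:=\frac{1}{\sqrt{8\pi}}\frac{\Gamma(1/4)}{\Gamma(3/4)}$. For $w$ in the unit disc, $S_i^{-1}(w):=\frac{i-\overline{i}\,w}{1-w}=\frac{i+iw}{1-w}$ (the inverse of the map $S_i(\tau)=\frac{\tau-i}{\tau-\overline{i}}$ from $\mathbb{H}$ to the unit disc), and the renormalized map is $s_i^{-1}(w):=S_i^{-1}\!\left(\frac{w}{2\pi\Omega_i^2}\right)$. *)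

(* Defs.v *)
From Stdlib Require Import Reals List Arith.
From Coquelicot Require Import Coquelicot.
Open Scope R_scope.

(* Coquelicot's [Series] is real-valued only; a complex series converges iff its
   real and imaginary parts do (see [is_series_CSeries] below). *)
Definition CSeries (a : nat -> C) : C :=
  (Series (fun n => Re (a n)), Series (fun n => Im (a n))).

Lemma Re_sum_n (a : nat -> C) (n : nat) :
  Re (sum_n a n) = sum_n (fun k => Re (a k)) n.
Proof.
induction n as [|n IH]; [now rewrite !sum_O | now rewrite !sum_Sn, <- IH].
Qed.

Lemma Im_sum_n (a : nat -> C) (n : nat) :
  Im (sum_n a n) = sum_n (fun k => Im (a k)) n.
Proof.
induction n as [|n IH]; [now rewrite !sum_O | now rewrite !sum_Sn, <- IH].
Qed.

Lemma is_series_CSeries (a : nat -> C) (l : C) :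
  is_series (V := C_R_NormedModule) a l -> CSeries a = l.
Proof.
intros H.
assert (Hre : is_series (fun n => Re (a n)) (Re l)).
{ unfold is_series.
  apply (filterlim_ext (fun n => Re (sum_n a n))); [intro; apply Re_sum_n|].
  eapply filterlim_comp; [exact H|].
  apply (continuous_fst (U := R_UniformSpace) (V := R_UniformSpace)). }
assert (Him : is_series (fun n => Im (a n)) (Im l)).
{ unfold is_series.
  apply (filterlim_ext (fun n => Im (sum_n a n))); [intro; apply Im_sum_n|].
  eapply filterlim_comp; [exact H|].
  apply (continuous_snd (U := R_UniformSpace) (V := R_UniformSpace)). }
unfold CSeries.
rewrite (is_series_unique _ _ Hre), (is_series_unique _ _ Him).
now destruct l.
Qed.

Definition Cexp (z : C) : C := (exp (Re z) * cos (Im z), exp (Re z) * sin (Im z)).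

Definition Gamma (s : R) : R :=
  RInt_gen (fun x => Rpower x (s - 1) * exp (- x))
           (at_right 0) (Rbar_locally p_infty).

Fixpoint pochhammer (s : R) (n : nat) : R :=
  match n with
  | O => 1
  | S m => pochhammer s m * (s + INR m)
  end.

Definition hyp2F1 (a b c : R) (z : C) : C :=
  CSeries (fun n =>
    RtoC (pochhammer a n * pochhammer b n / (pochhammer c n * INR (fact n))) * z ^ n)%C.

(* Sum of the k-th powers of the positive divisors of n; it is 0 for n = 0. *)
Definition sigma (k n : nat) : nat :=
  list_sum (map (fun d => Nat.pow d k)
                (filter (fun d => Nat.eqb (Nat.modulo n d) 0) (seq 1 n))).

Definition nome (tau : C) : C := Cexp (2 * PI * Ci * tau)%C.

(* The n = 0 terms of the following two sums vanish because sigma k 0 = 0. *)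
Definition E4 (tau : C) : C :=
  (1 + 240 * CSeries (fun n => INR (sigma 3 n) * nome tau ^ n))%C.

Definition E6 (tau : C) : C :=
  (1 - 504 * CSeries (fun n => INR (sigma 5 n) * nome tau ^ n))%C.

(* Normalized so that j = 1/q + 744 + 196884 q + ...; meaningful for 0 < Im tau. *)
Definition klein_j (tau : C) : C :=
  (1728 * E4 tau ^ 3 / (E4 tau ^ 3 - E6 tau ^ 2))%C.

Definition C_i (t : C) : C :=
  (t * (hyp2F1 (3/4) (3/4) (3/2) (4 * t ^ 2)
        / hyp2F1 (1/4) (1/4) (1/2) (4 * t ^ 2)))%C.

Definition Omega_i : R := 1 / sqrt (8 * PI) * (Gamma (1/4) / Gamma (3/4)).

Definition S_i_inv (w : C) : C := ((Ci - Cconj Ci * w) / (1 - w))%C.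

Definition s_i_inv (w : C) : C := S_i_inv (w / RtoC (2 * PI * Omega_i ^ 2))%C.

(* Main.v *)
(** K(x) = 2F1(1/2, 1/2; 1; x) solves a second-order equation whose solutions,
expanded at x = 1/2 in powers of t, where x = (1 - 2t)/2, are combinations of
the even function y1 = 2F1(1/4, 1/4; 1/2; 4t^2) and the odd function
y2 = t 2F1(3/4, 3/4; 3/2; 4t^2).  Since K(x) stays bounded as t -> 1/2 while y1
diverges, K((1 - 2t)/2) is proportional to kappa y1 - y2, where kappa = lim y2/y1 is
read off the coefficients of the two series and equals 2 pi Omega_i^2.  Hence
s_i^{-1}(C_i(t)) = i K(1 - x)/K(x), and the nome at (s_i^{-1}(C_i(t)) + 1)/2 is
N = - exp(- pi K(1 - x)/K(x)).

Legendre's relation makes N dx/dN = x (1 - x) K(x)^2, so the explicit functions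
K^4 (1 - 16x + 16x^2) and K^6 (1 - 2x)(1 + 32x - 32x^2), with a companion for E2,
satisfy Ramanujan's differential equations for E2, E4, E6 at N.  As x -> 0 both
solutions agree up to O(x^2), because N = - x/16 + O(x^2) (the constant 16 is forced
by Landen's transformation); as the linearised system has no eigenvalue above 1
there, they coincide near x = 0, and then on the whole disk by uniqueness along
segments (Gronwall).  That |N| < 1 on the disk is the bound |y2/y1| < kappa, which follows from
its real case because y2/y1 has nonnegative Taylor coefficients.

Ramanujan's equations are convolution identities for divisor sums; they come from a
descent on the solutions of ax + by = n. *)

Require Import Defs.
From Stdlib Require Import Reals Lra Lia List Arith.
From Coquelicot Require Import Coquelicot.
Open Scope R_scope.

(** * Convolution sums of divisor functions *)

(** Ramanujan's equations are invariant under rescaling N by a constant, so they cannot single out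
    the triple (E2, E4, E6)(N): every rescaled triple satisfies them and has the same value (1, 1,
    1) at the cusp. What separates these solutions is the first-order coefficient there. This is why
    N must be known up to O(x^2), and why the constant 16, which these equations cannot provide, is
    indispensable. With it the first coefficients -24, 240, -504 of the Eisenstein series become
    slopes 3/2, -15, 63/2 in x, and the hypergeometric side has the same ones. The comparison starts
    at the cusp rather than at t = 0 because interior values of the q-series would require a modular
    transformation law, whereas near N = 0 they are read off the coefficients. The price is a
    singular point, where the usual Gronwall argument fails; one point of agreement obtained near it
    is enough for the ordinary argument on the rest of the disk. *)

Fixpoint rsum (n : nat) (f : nat -> R) : R :=
  match n with O => 0 | S m => rsum m f + f m end.

Lemma rsum_S (n : nat) (f : nat -> R) : rsum (S n) f = rsum n f + f n.
Proof. reflexivity. Qed.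

Lemma rsum_ext (n : nat) (f g : nat -> R) :
  (forall i, (i < n)%nat -> f i = g i) -> rsum n f = rsum n g.
Proof.
induction n as [|n IH]; simpl; intros H; auto.
rewrite IH, H; auto.
Qed.

Lemma rsum_zero (n : nat) (f : nat -> R) :
  (forall i, (i < n)%nat -> f i = 0) -> rsum n f = 0.
Proof.
induction n as [|n IH]; simpl; intros H; auto.
rewrite IH, H by auto; ring.
Qed.

Lemma rsum_plus (n : nat) (f g : nat -> R) :
  rsum n (fun i => f i + g i) = rsum n f + rsum n g.
Proof. induction n as [|n IH]; simpl; [|rewrite IH]; ring. Qed.

Lemma rsum_scal (n : nat) (c : R) (f : nat -> R) :
  rsum n (fun i => c * f i) = c * rsum n f.
Proof. induction n as [|n IH]; simpl; [|rewrite IH]; ring. Qed.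

Lemma rsum_swap (n m : nat) (f : nat -> nat -> R) :
  rsum n (fun i => rsum m (f i)) = rsum m (fun j => rsum n (fun i => f i j)).
Proof.
induction n as [|n IH]; simpl.
- now rewrite rsum_zero.
- now rewrite IH, <- rsum_plus.
Qed.

Lemma rsum_add (n m : nat) (f : nat -> R) :
  rsum (n + m) f = rsum n f + rsum m (fun i => f (n + i)%nat).
Proof.
induction m as [|m IH]; simpl.
- rewrite Nat.add_0_r; ring.
- rewrite Nat.add_succ_r; simpl; rewrite IH; ring.
Qed.

Lemma rsum_trunc (n m : nat) (f : nat -> R) : (n <= m)%nat ->
  (forall i, (n <= i < m)%nat -> f i = 0) -> rsum m f = rsum n f.
Proof.
intros Hnm H; replace m with (n + (m - n))%nat by lia.
rewrite rsum_add, (rsum_zero (m - n)); [ring|].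
intros i Hi; apply H; lia.
Qed.

Lemma rsum_single (n k : nat) (f : nat -> R) : (k < n)%nat ->
  rsum n (fun i => if Nat.eqb i k then f i else 0) = f k.
Proof.
intros Hk; rewrite (rsum_trunc (S k)).
- simpl; rewrite Nat.eqb_refl, rsum_zero; [ring|].
  intros i Hi; destruct (Nat.eqb_spec i k); [lia|auto].
- lia.
- intros i Hi; destruct (Nat.eqb_spec i k); [lia|auto].
Qed.

(** The vanishing of [f] from [n] on lets the bound [n] survive the shift. In the uses it holds
    because a product exceeding [n] cannot occur in a representation of [n]. *)
Lemma rsum_shift (n y : nat) (f : nat -> R) :
  (forall i, (n <= i)%nat -> f i = 0) ->
  rsum n (fun x => if Nat.ltb y x then f x else 0) =
  rsum n (fun x => f (S y + x)%nat).
Proof.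
intros H.
transitivity (rsum (S y + n) (fun x => if Nat.ltb y x then f x else 0)).
- symmetry; apply rsum_trunc; [lia|].
  intros i Hi; destruct (Nat.ltb y i); auto; apply H; lia.
- rewrite rsum_add, rsum_zero.
  + rewrite Rplus_0_l; apply rsum_ext; intros i _.
    destruct (Nat.ltb_spec y (S y + i)); [auto|lia].
  + intros i Hi; destruct (Nat.ltb_spec y i); [lia|auto].
Qed.

(* Sum of [F a b x y] over the positive solutions of [a x + b y = n]; the
   summation variables are the predecessors of [a], [b], [x], [y]. *)
Definition qsum (n : nat) (F : nat -> nat -> nat -> nat -> R) : R :=
  rsum n (fun a => rsum n (fun b => rsum n (fun x => rsum n (fun y =>
    if Nat.eqb (S a * S x + S b * S y) n then F a b x y else 0)))).

Lemma qsum_ext (n : nat) (F G : nat -> nat -> nat -> nat -> R) :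
  (forall a b x y, F a b x y = G a b x y) -> qsum n F = qsum n G.
Proof.
intros H; unfold qsum.
repeat (apply rsum_ext; intros ? _).
now rewrite H.
Qed.

Lemma qsum_plus (n : nat) (F G : nat -> nat -> nat -> nat -> R) :
  qsum n (fun a b x y => F a b x y + G a b x y) = qsum n F + qsum n G.
Proof.
unfold qsum.
do 4 (rewrite <- rsum_plus; apply rsum_ext; intros ? _).
destruct Nat.eqb; ring.
Qed.

Lemma qsum_scal (n : nat) (c : R) (F : nat -> nat -> nat -> nat -> R) :
  qsum n (fun a b x y => c * F a b x y) = c * qsum n F.
Proof.
unfold qsum.
do 4 (rewrite <- rsum_scal; apply rsum_ext; intros ? _).
destruct Nat.eqb; ring.
Qed.

Lemma qsum_sym (n : nat) (F : nat -> nat -> nat -> nat -> R) :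
  qsum n (fun a b x y => F b a y x) = qsum n F.
Proof.
unfold qsum; rewrite rsum_swap.
apply rsum_ext; intros a _; apply rsum_ext; intros b _.
rewrite rsum_swap; apply rsum_ext; intros x _; apply rsum_ext; intros y _.
now rewrite Nat.add_comm.
Qed.

(** Both sides are the same sum over a x + (a + b) y = n: on the left x is replaced by x + y, on the
    right b by a + b. *)
Lemma qsum_shift (n : nat) (p : R -> R -> R) :
  qsum n (fun a b x y => if Nat.ltb y x then p (INR (S a)) (INR (S b)) else 0) =
  qsum n (fun a b x y =>
    if Nat.ltb a b then p (INR (S a)) (INR (S b) - INR (S a)) else 0).
Proof.
transitivity (rsum n (fun a => rsum n (fun b => rsum n (fun x => rsum n (fun y =>
    if Nat.eqb (S a * S x + (S a + S b) * S y) n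
    then p (INR (S a)) (INR (S b)) else 0))))).
- unfold qsum; apply rsum_ext; intros a _; apply rsum_ext; intros b _.
  rewrite rsum_swap, (rsum_swap _ _ (fun x y => if Nat.eqb (S a * S x + (S a + S b) * S y) n then _ else _)).
  apply rsum_ext; intros y _.
  rewrite <- (rsum_ext _ (fun x => if Nat.ltb y x then
     (if Nat.eqb (S a * S x + S b * S y) n then p (INR (S a)) (INR (S b)) else 0) else 0)).
  + rewrite rsum_shift.
    * apply rsum_ext; intros x _.
      replace (S a * S (S y + x) + S b * S y)%nat with (S a * S x + (S a + S b) * S y)%nat by ring.
      reflexivity.
    * intros i Hi; destruct (Nat.eqb_spec (S a * S i + S b * S y) n); [exfalso; simpl in *; nia|auto].
  + intros x _; destruct Nat.eqb, Nat.ltb; auto.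
- unfold qsum; apply rsum_ext; intros a _.
  rewrite rsum_swap.
  rewrite (rsum_swap n n (fun b x => rsum n (fun y => if Nat.eqb (S a * S x + S b * S y) n then _ else _))).
  apply rsum_ext; intros x _.
  rewrite rsum_swap.
  rewrite (rsum_swap n n (fun b y => if Nat.eqb (S a * S x + S b * S y) n then _ else _)).
  apply rsum_ext; intros y _.
  symmetry.
  rewrite (rsum_ext _ _ (fun b => if Nat.ltb a b then
     (if Nat.eqb (S a * S x + S b * S y) n then p (INR (S a)) (INR (S b) - INR (S a)) else 0) else 0)).
  + rewrite rsum_shift.
    * apply rsum_ext; intros b _.
      replace (S a * S x + S (S a + b) * S y)%nat with (S a * S x + (S a + S b) * S y)%nat by ring.
      destruct Nat.eqb; auto; f_equal.
      rewrite <- minus_INR by lia; apply f_equal; lia.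
    * intros i Hi; destruct (Nat.eqb_spec (S a * S x + S i * S y) n); [exfalso; simpl in *; nia|auto].
  + intros b _; destruct Nat.eqb, Nat.ltb; auto.
Qed.

(** The cofactor is kept because the descent produces weights e - 1, and d e = n turns them into
    terms with a factor n. *)
Definition dsum (n : nat) (f : R -> R -> R) : R :=
  rsum n (fun d => rsum n (fun e =>
    if Nat.eqb (S d * S e) n then f (INR (S d)) (INR (S e)) else 0)).

(** With x = y the equation is (a + b) x = n, so d = a + b divides n and a runs through 1, ..., d -
    1. *)
Lemma qsum_diag (n : nat) (p : R -> R -> R) :
  qsum n (fun a b x y => if Nat.eqb x y then p (INR (S a)) (INR (S b)) else 0) =
  rsum n (fun d => rsum n (fun e => if Nat.eqb (S d * S e) n
     then rsum d (fun a => p (INR (S a)) (INR (S d) - INR (S a))) else 0)).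
Proof.
transitivity (rsum n (fun a => rsum n (fun b => rsum n (fun x =>
    if Nat.eqb ((S a + S b) * S x) n then p (INR (S a)) (INR (S b)) else 0)))).
- unfold qsum; apply rsum_ext; intros i _; apply rsum_ext; intros i0 _; apply rsum_ext; intros i1 Hi.
  rewrite (rsum_ext _ _ (fun y => if Nat.eqb y i1 then
    (if Nat.eqb (S i * S i1 + S i0 * S y) n then p (INR (S i)) (INR (S i0)) else 0) else 0)).
  + rewrite rsum_single by auto.
    now rewrite Nat.mul_add_distr_r.
  + intros y _; rewrite (Nat.eqb_sym y); destruct Nat.eqb, Nat.eqb; auto.
- transitivity (rsum n (fun d => rsum n (fun e => if Nat.eqb (S d * S e) n
     then rsum n (fun a => if Nat.ltb a d then p (INR (S a)) (INR (S d) - INR (S a)) else 0) else 0))).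
  + rewrite (rsum_swap n n (fun d e => if Nat.eqb (S d * S e) n then _ else _)).
    transitivity (rsum n (fun e => rsum n (fun a => rsum n (fun d => if Nat.ltb a d then
       if Nat.eqb (S d * S e) n then p (INR (S a)) (INR (S d) - INR (S a)) else 0 else 0)))).
    * rewrite (rsum_swap n n (fun e a => rsum n (fun d => if Nat.ltb a d then _ else _))).
      apply rsum_ext; intros a _; rewrite rsum_swap; apply rsum_ext; intros x _.
      symmetry.
      rewrite rsum_shift.
      -- apply rsum_ext; intros b _.
         replace (S (S a + b) * S x)%nat with ((S a + S b) * S x)%nat by ring.
         destruct Nat.eqb; auto; f_equal.
         rewrite <- minus_INR by lia; apply f_equal; lia.
      -- intros i Hi; destruct (Nat.eqb_spec (S i * S x) n); [exfalso; simpl in *; nia|auto].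
    * apply rsum_ext; intros e _; rewrite rsum_swap; apply rsum_ext; intros d _.
      destruct Nat.eqb; [reflexivity|].
      apply rsum_zero; intros a _; now destruct Nat.ltb.
  + apply rsum_ext; intros d Hd; apply rsum_ext; intros e _.
    destruct Nat.eqb; auto.
    rewrite (rsum_trunc d).
    * apply rsum_ext; intros a Ha; destruct (Nat.ltb_spec a d); [auto|lia].
    * lia.
    * intros a Ha; destruct (Nat.ltb_spec a d); [lia|auto].
Qed.

Lemma rsum_const (n : nat) (c : R) : rsum n (fun _ => c) = INR n * c.
Proof.
induction n as [|n IH]; [simpl; ring|].
rewrite S_INR; simpl rsum; rewrite IH; ring.
Qed.

(** With a = b the equation is a (x + y) = n, and e = x + y has e - 1 decompositions. The proof
    exchanges (a, b) with (x, y) and reuses the argument for x = y. *)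
Lemma qsum_eq (n : nat) (g : R -> R) :
  qsum n (fun a b x y => if Nat.eqb a b then g (INR (S a)) else 0) =
  dsum n (fun d e => (e - 1) * g d).
Proof.
transitivity (qsum n (fun a b x y => if Nat.eqb x y then g (INR (S x)) else 0)).
- unfold qsum. 
  transitivity (rsum n (fun a => rsum n (fun x => rsum n (fun b => rsum n (fun y =>
    if Nat.eqb (S a * S x + S b * S y) n then if Nat.eqb a b then g (INR (S a)) else 0 else 0))))).
  + apply rsum_ext; intros a _; apply rsum_swap.
  + rewrite rsum_swap.
    apply rsum_ext; intros x _.
    rewrite rsum_ext with (g := fun a => rsum n (fun y => rsum n (fun b =>
       if Nat.eqb (S a * S x + S b * S y) n then if Nat.eqb a b then g (INR (S a)) else 0 else 0)))
      by (intros; apply rsum_swap).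
    rewrite rsum_swap.
    apply rsum_ext; intros y _.
    apply rsum_ext; intros a _; apply rsum_ext; intros b _.
    rewrite (Nat.mul_comm (S a)), (Nat.mul_comm (S b)); reflexivity.
- unfold dsum.
  rewrite rsum_swap.
  unfold qsum.
  transitivity (rsum n (fun a => rsum n (fun b => rsum n (fun x =>
    if Nat.eqb ((S a + S b) * S x) n then g (INR (S x)) else 0)))).
  + apply rsum_ext; intros i _; apply rsum_ext; intros i0 _; apply rsum_ext; intros i1 Hi.
    rewrite (rsum_ext _ _ (fun y => if Nat.eqb y i1 then
      (if Nat.eqb (S i * S i1 + S i0 * S y) n then g (INR (S i1)) else 0) else 0)).
    * rewrite rsum_single by auto.
      now rewrite Nat.mul_add_distr_r.
    * intros y _; rewrite (Nat.eqb_sym y); destruct Nat.eqb, Nat.eqb; auto.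
  + transitivity (rsum n (fun a => rsum n (fun d => if Nat.ltb a d then rsum n (fun x =>
       if Nat.eqb (S d * S x) n then g (INR (S x)) else 0) else 0))).
    * apply rsum_ext; intros a _.
      rewrite rsum_shift.
      -- apply rsum_ext; intros b _; apply rsum_ext; intros x _.
         now replace (S (S a + b))%nat with (S a + S b)%nat by lia.
      -- intros i Hi; apply rsum_zero; intros x _.
         destruct (Nat.eqb_spec (S i * S x) n); [exfalso; simpl in *; nia|auto].
    * rewrite rsum_swap; apply rsum_ext; intros d Hd.
      rewrite (rsum_trunc d), (rsum_ext d _ (fun _ => rsum n (fun x =>
         if Nat.eqb (S d * S x) n then g (INR (S x)) else 0))).
      -- rewrite rsum_const, <- rsum_scal; apply rsum_ext; intros e _.
         rewrite Nat.mul_comm, (S_INR d); destruct Nat.eqb; ring.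
      -- intros a Ha; destruct (Nat.ltb_spec a d); [auto|lia].
      -- lia.
      -- intros a Ha; destruct (Nat.ltb_spec a d); [lia|auto].
Qed.

(* Split according to [x > y], [x < y], [x = y]; the substitution [x = y + x']
   turns [a x + b y] into [a x' + (a + b) y]. *)
Lemma qsum_descent (n : nat) (p : R -> R -> R) :
  (forall a b, p a b = p b a) -> (forall a b, p a (b - a) = p b (a - b)) ->
  qsum n (fun a b _ _ => p (INR (S a)) (INR (S b)) -
                         p (INR (S a)) (INR (S b) - INR (S a))) =
  rsum n (fun d => rsum n (fun e => if Nat.eqb (S d * S e) n
     then rsum d (fun a => p (INR (S a)) (INR (S d) - INR (S a))) else 0))
  - dsum n (fun d e => (e - 1) * p d 0).
Proof.
intros Hs Hg.
set (P := fun a b (_ _ : nat) => p (INR (S a)) (INR (S b))).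
set (G := fun a b (_ _ : nat) => p (INR (S a)) (INR (S b) - INR (S a))).
assert (HP : qsum n P = 2 * qsum n (fun a b x y => if Nat.ltb a b then G a b x y else 0) +
   rsum n (fun d => rsum n (fun e => if Nat.eqb (S d * S e) n
     then rsum d (fun a => p (INR (S a)) (INR (S d) - INR (S a))) else 0))).
{ rewrite <- qsum_diag.
  unfold G; rewrite <- qsum_shift.
  rewrite <- qsum_scal, <- qsum_plus.
  transitivity (qsum n (fun a b x y => (if Nat.ltb y x then P a b x y else 0) + 
     ((if Nat.ltb x y then P a b x y else 0) + (if Nat.eqb x y then P a b x y else 0)))).
  { apply qsum_ext; intros.
    destruct (Nat.ltb_spec x y), (Nat.ltb_spec y x), (Nat.eqb_spec x y); try lia; ring. }
  rewrite !qsum_plus.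
  rewrite <- (qsum_sym n (fun a b x y => if Nat.ltb x y then _ else _)).
  rewrite qsum_scal. unfold P.
  rewrite (qsum_ext n (fun a b x y => if Nat.ltb y x then p (INR (S b)) (INR (S a)) else 0)
     (fun a b x y => if Nat.ltb y x then p (INR (S a)) (INR (S b)) else 0)).
  - ring.
  - intros; now rewrite Hs. }
(* The sum over a < b is the one found for [P], so it cancels in the difference and only the
   diagonals x = y and a = b survive. *)
assert (HG : qsum n G = 2 * qsum n (fun a b x y => if Nat.ltb a b then G a b x y else 0) +
   dsum n (fun d e => (e - 1) * p d 0)).
{ rewrite <- (qsum_eq n (fun d => p d 0)).
  transitivity (qsum n (fun a b x y => (if Nat.ltb a b then G a b x y else 0) + 
     ((if Nat.ltb b a then G a b x y else 0) + (if Nat.eqb a b then p (INR (S a)) 0 else 0)))).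
  { apply qsum_ext; intros.
    destruct (Nat.ltb_spec a b), (Nat.ltb_spec b a), (Nat.eqb_spec a b); try lia; try ring.
    subst; unfold G; rewrite Rminus_diag; ring. }
  rewrite !qsum_plus.
  rewrite <- (qsum_sym n (fun a b x y => if Nat.ltb b a then _ else _)).
  unfold G.
  rewrite (qsum_ext n (fun a b x y => if Nat.ltb a b then p (INR (S b)) (INR (S a) - INR (S b)) else 0)
     (fun a b x y => if Nat.ltb a b then p (INR (S a)) (INR (S b) - INR (S a)) else 0)).
  - ring.
  - intros; now rewrite Hg. }
rewrite (qsum_ext n _ (fun a b x y => P a b x y + (-1) * G a b x y)) by
  (intros; unfold P, G, Rminus; ring).
rewrite qsum_plus, qsum_scal, HP, HG; ring.
Qed.

(** * Products of divisor-sum series *)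

Definition sg (k n : nat) : R := dsum n (fun d _ => d ^ k).

Lemma rsum_dsum_trunc (N n : nat) (f : R -> R -> R) : (n <= N)%nat ->
  rsum N (fun d => rsum N (fun e =>
    if Nat.eqb (S d * S e) n then f (INR (S d)) (INR (S e)) else 0)) = dsum n f.
Proof.
intros HN; unfold dsum; rewrite (rsum_trunc n); auto.
- apply rsum_ext; intros d Hd; rewrite (rsum_trunc n); auto.
  intros e He; destruct (Nat.eqb_spec (S d * S e) n); [exfalso; simpl in *; nia|auto].
- intros d Hd; apply rsum_zero; intros e _.
  destruct (Nat.eqb_spec (S d * S e) n); [exfalso; simpl in *; nia|auto].
Qed.

Lemma rsum_mult (n m : nat) (f g : nat -> R) :
  rsum n f * rsum m g = rsum n (fun i => rsum m (fun j => f i * g j)).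
Proof.
rewrite Rmult_comm, <- rsum_scal; apply rsum_ext; intros i _.
now rewrite Rmult_comm, <- rsum_scal.
Qed.

Lemma rsum_sum_f_R0 (n : nat) (f : nat -> R) : rsum (S n) f = sum_f_R0 f n.
Proof.
induction n as [|n IH]; [simpl; ring|].
change (rsum (S (S n)) f) with (rsum (S n) f + f (S n)); now rewrite IH.
Qed.

(** An index m together with factorisations m = a x and n - m = b y is a solution of a x + b y = n;
    summing over m then removes it. *)
Lemma PS_mult_sg (i j n : nat) :
  PS_mult (sg i) (sg j) n =
  qsum n (fun a b _ _ => INR (S a) ^ i * INR (S b) ^ j).
Proof.
unfold PS_mult; rewrite <- rsum_sum_f_R0.
transitivity (rsum n (fun a => rsum n (fun x => rsum n (fun b => rsum n (fun y =>
  rsum (S n) (fun m => if Nat.eqb m (S a * S x) then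
    if Nat.eqb (S a * S x + S b * S y) n then INR (S a) ^ i * INR (S b) ^ j else 0 else 0)))))).
- transitivity (rsum (S n) (fun m => rsum n (fun a => rsum n (fun x => rsum n (fun b => rsum n (fun y =>
  (if Nat.eqb m (S a * S x) then
    if Nat.eqb (S a * S x + S b * S y) n then INR (S a) ^ i * INR (S b) ^ j else 0 else 0))))))).
  + apply rsum_ext; intros m Hm.
    unfold sg.
    rewrite <- (rsum_dsum_trunc n m), <- (rsum_dsum_trunc n (n - m)) by lia.
    rewrite Rmult_comm, <- rsum_scal.
    apply rsum_ext; intros a _.
    rewrite Rmult_comm, rsum_mult.
    rewrite rsum_swap.
    rewrite rsum_swap; apply rsum_ext; intros x _.
    apply rsum_ext; intros b _.
    rewrite <- rsum_scal; apply rsum_ext; intros y _.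
    destruct (Nat.eqb_spec (S a * S x) m), (Nat.eqb_spec (S b * S y) (n - m)),
      (Nat.eqb_spec m (S a * S x)), (Nat.eqb_spec (S a * S x + S b * S y) n); try ring; exfalso; lia.
  + rewrite rsum_swap; apply rsum_ext; intros a _.
    rewrite rsum_swap; apply rsum_ext; intros x _.
    rewrite rsum_swap; apply rsum_ext; intros b _.
    now rewrite rsum_swap.
- unfold qsum; apply rsum_ext; intros a _.
  rewrite rsum_swap; apply rsum_ext; intros b _.
  apply rsum_ext; intros x _.
  apply rsum_ext; intros y _.
  destruct (Nat.eqb_spec (S a * S x + S b * S y) n).
  + rewrite (rsum_single (S n) (S a * S x) (fun _ => INR (S a) ^ i * INR (S b) ^ j)); [auto|lia].
  + apply rsum_zero; intros; now destruct Nat.eqb.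
Qed.

Lemma dsum_ext (n : nat) (f g : R -> R -> R) :
  (forall d e, d * e = INR n -> f d e = g d e) -> dsum n f = dsum n g.
Proof.
intros H; unfold dsum; apply rsum_ext; intros d _; apply rsum_ext; intros e _.
destruct (Nat.eqb_spec (S d * S e) n); auto.
apply H; now rewrite <- mult_INR, e0.
Qed.

Lemma dsum_plus (n : nat) (f g : R -> R -> R) :
  dsum n (fun d e => f d e + g d e) = dsum n f + dsum n g.
Proof.
unfold dsum; do 2 (rewrite <- rsum_plus; apply rsum_ext; intros ? _).
destruct Nat.eqb; ring.
Qed.

Lemma dsum_scal (n : nat) (c : R) (f : R -> R -> R) :
  dsum n (fun d e => c * f d e) = c * dsum n f.
Proof.
unfold dsum; do 2 (rewrite <- rsum_scal; apply rsum_ext; intros ? _).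
destruct Nat.eqb; ring.
Qed.

(** A divisor has exactly one cofactor; this translates the divisibility test in [sigma] into
    factorisations. *)
Lemma divisor_count (n d : nat) : (d < n)%nat ->
  rsum n (fun e => if Nat.eqb (S d * S e) n then 1 else 0) =
  if Nat.eqb (n mod S d) 0 then 1 else 0.
Proof.
intros Hd.
destruct (Nat.eqb_spec (n mod S d) 0) as [H|H].
- apply Nat.Lcm0.mod_divide in H.
  destruct H as [c Hc].
  destruct c as [|c]; [lia|].
  transitivity (rsum n (fun e => if Nat.eqb e c then 1 else 0));
    [|apply (rsum_single n c (fun _ => 1)); nia].
  apply rsum_ext; intros e _.
  destruct (Nat.eqb_spec (S d * S e) n) as [E|E], (Nat.eqb_spec e c) as [F|F]; try reflexivity; exfalso.
  + apply F; rewrite Hc, (Nat.mul_comm (S c)) in E; apply Nat.mul_cancel_l in E; lia.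
  + apply E; rewrite Hc, F; ring.
- apply rsum_zero; intros e _.
  destruct (Nat.eqb_spec (S d * S e) n); auto.
  exfalso; apply H, Nat.Lcm0.mod_divide; exists (S e); lia.
Qed.

Lemma INR_list_sum_filter (f : nat -> nat) (p : nat -> bool) (n : nat) :
  INR (list_sum (map f (filter p (seq 1 n)))) =
  rsum n (fun d => if p (S d) then INR (f (S d)) else 0).
Proof.
induction n as [|n IH]; [reflexivity|].
rewrite seq_S, filter_app, map_app, list_sum_app, plus_INR, IH.
simpl rsum; f_equal; simpl.
destruct (p (S n)); simpl; [now rewrite Nat.add_0_r|reflexivity].
Qed.

Lemma INR_sigma (k n : nat) : INR (Defs.sigma k n) = sg k n.
Proof.
unfold Defs.sigma, sg, dsum; rewrite INR_list_sum_filter.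
apply rsum_ext; intros d Hd.
transitivity (INR (S d) ^ k * rsum n (fun e => if Nat.eqb (S d * S e) n then 1 else 0)).
- rewrite divisor_count by auto.
  rewrite pow_INR; destruct Nat.eqb; ring.
- rewrite <- rsum_scal; apply rsum_ext; intros e _; destruct Nat.eqb; ring.
Qed.

(** * Faulhaber's formulas and the convolution identities *)

Lemma rsum_pow (d : nat) (c0 c1 c2 c3 c4 c5 c6 : R) :
  rsum d (fun a => let x := INR (S a) in
    c0 + c1 * x + c2 * x ^ 2 + c3 * x ^ 3 + c4 * x ^ 4 + c5 * x ^ 5 + c6 * x ^ 6) =
  let x := INR d in
  c0 * x + c1 * (x * (x + 1) / 2) + c2 * (x * (x + 1) * (2 * x + 1) / 6)
  + c3 * (x ^ 2 * (x + 1) ^ 2 / 4)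
  + c4 * (x * (x + 1) * (2 * x + 1) * (3 * x ^ 2 + 3 * x - 1) / 30)
  + c5 * (x ^ 2 * (x + 1) ^ 2 * (2 * x ^ 2 + 2 * x - 1) / 12)
  + c6 * (x * (x + 1) * (2 * x + 1) * (3 * x ^ 4 + 6 * x ^ 3 - 3 * x + 1) / 42).
Proof.
induction d as [|d IH]; [simpl; field|].
rewrite rsum_S, IH; cbv zeta; rewrite S_INR; field.
Qed.

(** The slots of the descent for a polynomial [p]: [q] is the difference being summed, the [c0],
    ..., [c6] are the coefficients of a -> p(a, d - a), which Faulhaber's formulas sum over 1 <= a <
    d into [s], and [r] subtracts the diagonal a = b. Degree 6 is what the identities involving
    sigma_7 require. *)
Lemma qsum_descent_poly (n : nat) (p q r : R -> R -> R) (s : R -> R)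
  (c0 c1 c2 c3 c4 c5 c6 : R -> R) :
  (forall a b, p a b = p b a) -> (forall a b, p a (b - a) = p b (a - b)) ->
  (forall a b, p a b - p a (b - a) = q a b) ->
  (forall a d, p a (d - a) = c0 d + c1 d * a + c2 d * a ^ 2 + c3 d * a ^ 3
     + c4 d * a ^ 4 + c5 d * a ^ 5 + c6 d * a ^ 6) ->
  (forall x, let d := x + 1 in
  c0 d * x + c1 d * (x * (x + 1) / 2) + c2 d * (x * (x + 1) * (2 * x + 1) / 6)
  + c3 d * (x ^ 2 * (x + 1) ^ 2 / 4)
  + c4 d * (x * (x + 1) * (2 * x + 1) * (3 * x ^ 2 + 3 * x - 1) / 30)
  + c5 d * (x ^ 2 * (x + 1) ^ 2 * (2 * x ^ 2 + 2 * x - 1) / 12)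
  + c6 d * (x * (x + 1) * (2 * x + 1) * (3 * x ^ 4 + 6 * x ^ 3 - 3 * x + 1) / 42) = s d) ->
  (forall d e, d * e = INR n -> s d - (e - 1) * p d 0 = r d e) ->
  qsum n (fun a b _ _ => q (INR (S a)) (INR (S b))) = dsum n r.
Proof.
intros Hs Hg Hq Hp Hc Hr.
rewrite <- (dsum_ext n (fun d e => s d + (-1) * ((e - 1) * p d 0))).
2:{ intros d e H; rewrite <- Hr by auto; ring. }
rewrite dsum_plus, dsum_scal.
rewrite <- (qsum_ext n (fun a b _ _ => p (INR (S a)) (INR (S b)) -
                         p (INR (S a)) (INR (S b) - INR (S a)))) by (intros; apply Hq).
rewrite qsum_descent by auto.
unfold Rminus at 1; apply f_equal2; [|ring].
unfold dsum; apply rsum_ext; intros d _; apply rsum_ext; intros e _.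
destruct Nat.eqb; auto.
rewrite S_INR, <- (Hc (INR d)); cbv zeta.
erewrite rsum_ext by (intros; apply Hp).
apply (rsum_pow d (c0 (INR d + 1))).
Qed.

Lemma PS_mult_sg_comm (i j n : nat) : 
  PS_mult (sg i) (sg j) n = PS_mult (sg j) (sg i) n.
Proof.
rewrite !PS_mult_sg, <- qsum_sym; apply qsum_ext; intros; ring.
Qed.

(** For p = a^2 + ab + b^2 one has p(a, b - a) = a^2 - ab + b^2 = p(a, -b): both symmetry conditions
    hold and the difference keeps twice the part odd in b. Powers of this form serve other
    weights. *)
Lemma PS_mult_sg_1_1 (n : nat) :
  2 * PS_mult (sg 1) (sg 1) n = 5 / 6 * sg 3 n + (1 / 6 - INR n) * sg 1 n.
Proof.
rewrite PS_mult_sg, <- qsum_scal.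
rewrite (qsum_ext _ _ (fun a b _ _ => 2 * (INR (S a) * INR (S b)))) by (intros; ring).
rewrite (qsum_descent_poly n (fun a b => a ^ 2 + a * b + b ^ 2) (fun a b => 2 * (a * b))
  (fun d e => 5 / 6 * d ^ 3 + (1 / 6 - INR n) * d ^ 1)
  (fun d => d * (d - 1) * (5 * d - 1) / 6)
  (fun d => d ^ 2) (fun d => - d) (fun d => 1) (fun _ => 0) (fun _ => 0) (fun _ => 0) (fun _ => 0));
  try (intros; ring).
- now rewrite dsum_plus, !dsum_scal.
- intros x d; unfold d; field.
- intros d e H; rewrite <- H; field.
Qed.

Lemma PS_mult_sg_1_3 (n : nat) :
  8 * PS_mult (sg 1) (sg 3) n =
  7 / 10 * sg 5 n + (1 / 3 - INR n) * sg 3 n - 1 / 30 * sg 1 n.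
Proof.
replace (8 * _) with (4 * PS_mult (sg 1) (sg 3) n + 4 * PS_mult (sg 3) (sg 1) n)
  by (rewrite (PS_mult_sg_comm 3 1); ring).
rewrite !PS_mult_sg, <- !qsum_scal, <- qsum_plus.
rewrite (qsum_ext _ _ (fun a b _ _ => 
   4 * (INR (S a) * INR (S b) * (INR (S a) ^ 2 + INR (S b) ^ 2)))) by (intros; ring).
rewrite (qsum_descent_poly n (fun a b => (a ^ 2 + a * b + b ^ 2) ^ 2)
  (fun x y => 4 * (x * y * (x ^ 2 + y ^ 2)))
  (fun d e => 7 / 10 * d ^ 5 + ((1 / 3 - INR n) * d ^ 3 + (- 1 / 30) * d ^ 1))
  (fun d => 7 / 10 * d ^ 5 - d ^ 4 + d ^ 3 / 3 - d / 30)
  (fun d => d ^ 4) (fun d => - 2 * d ^ 3) (fun d => 3 * d ^ 2) (fun d => - 2 * d)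
  (fun _ => 1) (fun _ => 0) (fun _ => 0));
  try (intros; ring).
- rewrite !dsum_plus, !dsum_scal; unfold sg; field.
- intros x d; unfold d; field.
- intros d e H; rewrite <- H; field.
Qed.

(** Under b -> b - a the product ab(a + b) becomes ab(b - a); its square has the required
    symmetries, and (a + b)^2 - (a - b)^2 = 4ab. It vanishes at b = 0, so no term with a factor n
    appears: this is E4^2 = E8. *)
Lemma PS_mult_sg_3_3 (n : nat) :
  120 * PS_mult (sg 3) (sg 3) n = sg 7 n - sg 3 n.
Proof.
replace (120 * _) with (30 * (4 * PS_mult (sg 3) (sg 3) n)) by ring.
rewrite !PS_mult_sg, <- !qsum_scal.
rewrite (qsum_descent_poly n (fun a b => 30 * (a ^ 2 * b ^ 2 * (a + b) ^ 2))
  (fun x y => 30 * (4 * (x ^ 3 * y ^ 3)))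
  (fun d e => d ^ 7 + (- 1) * d ^ 3)
  (fun d => d ^ 7 - d ^ 3)
  (fun d => 0) (fun d => 0) (fun d => 30 * d ^ 4) (fun d => - 60 * d ^ 3)
  (fun d => 30 * d ^ 2) (fun _ => 0) (fun _ => 0));
  try (intros; ring).
- rewrite !dsum_plus, !dsum_scal; unfold sg; field.
- intros x d; unfold d; field.
Qed.

(** The cube of a^2 + ab + b^2 yields 6ab^5 + 14a^3b^3 + 6a^5b; the middle term is removed with the
    identity for the square of sigma_3. *)
Lemma PS_mult_sg_1_5 (n : nat) :
  12 * PS_mult (sg 1) (sg 5) n =
  10 / 21 * sg 7 n + (1 / 2 - INR n) * sg 5 n + 1 / 42 * sg 1 n.
Proof.
assert (H : 6 * PS_mult (sg 1) (sg 5) n + 6 * PS_mult (sg 5) (sg 1) n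
  + 14 * PS_mult (sg 3) (sg 3) n =
  83 / 140 * sg 7 n + (1 / 2 - INR n) * sg 5 n - 7 / 60 * sg 3 n + 1 / 42 * sg 1 n).
{ rewrite !PS_mult_sg, <- !qsum_scal, <- !qsum_plus.
  rewrite (qsum_ext _ _ (fun a b _ _ => 
    6 * INR (S a) * INR (S b) ^ 5 + 6 * INR (S a) ^ 5 * INR (S b)
    + 14 * INR (S a) ^ 3 * INR (S b) ^ 3)) by (intros; ring).
  rewrite (qsum_descent_poly n (fun a b => (a ^ 2 + a * b + b ^ 2) ^ 3)
    (fun x y => 6 * x * y ^ 5 + 6 * x ^ 5 * y + 14 * x ^ 3 * y ^ 3)
    (fun d e => 83 / 140 * d ^ 7 + ((1 / 2 - INR n) * d ^ 5 + (- 7 / 60 * d ^ 3 + 1 / 42 * d ^ 1)))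
    (fun d => 83 / 140 * d ^ 7 - d ^ 6 + d ^ 5 / 2 - 7 / 60 * d ^ 3 + d / 42)
    (fun d => d ^ 6) (fun d => - 3 * d ^ 5) (fun d => 6 * d ^ 4) (fun d => - 7 * d ^ 3)
    (fun d => 6 * d ^ 2) (fun d => - 3 * d) (fun _ => 1));
    try (intros; ring).
  - rewrite !dsum_plus, !dsum_scal; unfold sg; field.
  - intros x d; unfold d; field.
  - intros d e E; rewrite <- E; field. }
rewrite (PS_mult_sg_comm 5 1) in H.
pose proof (PS_mult_sg_3_3 n); lra.
Qed.

(** * Complex power series and derivatives along paths *)

Definition summable (f : nat -> C) : Prop := ex_series (fun n => Cmod (f n)).

Lemma im_le_Cmod (z : C) : Rabs (Im z) <= Cmod z.
Proof. exact (Rle_trans _ _ _ (Rmax_r _ _) (Rmax_Cmod z)). Qed.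

Lemma Cmod_le_Re_Im (z : C) : Cmod z <= Rabs (Re z) + Rabs (Im z).
Proof.
rewrite <- (Rabs_pos_eq (Cmod z)) by apply Cmod_ge_0.
rewrite <- (Rabs_pos_eq (Rabs (Re z) + Rabs (Im z)))
  by (generalize (Rabs_pos (Re z)) (Rabs_pos (Im z)); lra).
apply Rsqr_le_abs_0; unfold Cmod; rewrite Rsqr_sqrt by nra.
unfold Rsqr; change (fst z) with (Re z); change (snd z) with (Im z).
rewrite <- (pow2_abs (Re z)), <- (pow2_abs (Im z)).
generalize (Rabs_pos (Re z)) (Rabs_pos (Im z)); nra.
Qed.

Lemma summable_Re (f : nat -> C) : summable f -> ex_series (fun n => Rabs (Re (f n))).
Proof.
intros H; apply (ex_series_le (V := R_CompleteNormedModule) _ (fun n => Cmod (f n))); auto.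
intros n; simpl; rewrite Rabs_Rabsolu; apply re_le_Cmod.
Qed.

Lemma summable_Im (f : nat -> C) : summable f -> ex_series (fun n => Rabs (Im (f n))).
Proof.
intros H; apply (ex_series_le (V := R_CompleteNormedModule) _ (fun n => Cmod (f n))); auto.
intros n; simpl; rewrite Rabs_Rabsolu; apply im_le_Cmod.
Qed.

Lemma CSeries_ext (f g : nat -> C) : (forall n, f n = g n) -> CSeries f = CSeries g.
Proof.
intros H; unfold CSeries.
now rewrite (Series_ext _ _ (fun n => f_equal Re (H n))),
            (Series_ext _ _ (fun n => f_equal Im (H n))).
Qed.

Lemma CSeries_plus (f g : nat -> C) : summable f -> summable g ->
  (CSeries (fun n => f n + g n) = CSeries f + CSeries g)%C.
Proof.
intros Hf Hg; unfold CSeries, Cplus; simpl.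
rewrite <- !Series_plus; auto using ex_series_Rabs, summable_Re, summable_Im.
Qed.

Lemma CSeries_scal (c : C) (f : nat -> C) : summable f ->
  (CSeries (fun n => c * f n) = c * CSeries f)%C.
Proof.
intros Hf; unfold CSeries, Cmult; simpl.
assert (H1 := ex_series_Rabs _ (summable_Re f Hf)).
assert (H2 := ex_series_Rabs _ (summable_Im f Hf)).
rewrite <- !Series_scal_l.
rewrite <- Series_minus, <- Series_plus; try reflexivity; 
  now apply (ex_series_scal (V := R_NormedModule)).
Qed.

Lemma CSeries_incr_1 (f : nat -> C) : summable f ->
  (CSeries f = f O + CSeries (fun n => f (S n)))%C.
Proof.
intros Hf; unfold CSeries.
assert (H1 := ex_series_Rabs _ (summable_Re f Hf)).
assert (H2 := ex_series_Rabs _ (summable_Im f Hf)).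
rewrite Series_incr_1, (Series_incr_1 (fun n => Im (f n))) by auto.
destruct (f O) as [x y]; reflexivity.
Qed.

Lemma summable_incr_1 (f : nat -> C) : summable f <-> summable (fun n => f (S n)).
Proof. apply (ex_series_incr_1 (fun n => Cmod (f n))). Qed.

Lemma Cmod_CSeries (f : nat -> C) : summable f ->
  Cmod (CSeries f) <= Series (fun n => Cmod (f n)).
Proof.
intros Hf; set (L := CSeries f).
destruct (Req_dec (Cmod L) 0) as [E|E].
- rewrite E; apply Rle_trans with (1 := Rabs_pos (Re L)).
  apply Rle_trans with (1 := Series_Rabs _ (summable_Re _ Hf)).
  apply Series_le; auto; intros n; split; [apply Rabs_pos|apply re_le_Cmod].
(* Multiplication by the unimodular [c] rotates the sum onto its modulus, so that bounding real
   parts is enough. *)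
- set (c := (Cconj L / Cmod L)%C).
  assert (Hc : Cmod c = 1).
  { unfold c; rewrite Cmod_div by (intros H; apply E; now apply RtoC_inj in H).
    rewrite Cmod_conj, Cmod_R, Rabs_pos_eq by apply Cmod_ge_0; now field. }
  assert (H : (c * L)%C = RtoC (Cmod L)).
  { unfold c. rewrite (Cmult_comm _ L); unfold Cdiv; rewrite Cmult_assoc, <- Cmod2_conj.
    rewrite RtoC_pow; field; intros H; apply E; now apply RtoC_inj in H. }
  rewrite <- (re_RtoC (Cmod L)), <- H.
  unfold L; rewrite <- CSeries_scal by auto; unfold CSeries; simpl.
  apply Rle_trans with (1 := Rle_abs _).
  assert (Hs : summable (fun n => c * f n)%C).
  { apply (ex_series_ext (V := R_NormedModule) (fun n => Cmod (f n))); auto.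
    intros n; rewrite Cmod_mult, Hc; now rewrite Rmult_1_l. }
  apply Rle_trans with (1 := Series_Rabs _ (summable_Re _ Hs)).
  apply Series_le; auto; intros n; split; [apply Rabs_pos|].
  apply Rle_trans with (1 := re_le_Cmod (c * f n)%C).
  rewrite Cmod_mult, Hc; lra.
Qed.

Definition cps (a : nat -> R) (z : C) : C := CSeries (fun n => RtoC (a n) * z ^ n)%C.

Definition in_disk (a : nat -> R) (z : C) : Prop := Rbar_lt (Cmod z) (CV_radius a).

Lemma Cmod_term (a : R) (z : C) (n : nat) :
  Cmod (RtoC a * z ^ n) = Rabs (a * Cmod z ^ n).
Proof.
rewrite Cmod_mult, Cmod_R, Cmod_pow, Rabs_mult, (Rabs_pos_eq (_ ^ _)); auto.
apply pow_le, Cmod_ge_0.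
Qed.

Lemma summable_cps (a : nat -> R) (z : C) : in_disk a z ->
  summable (fun n => RtoC (a n) * z ^ n)%C.
Proof.
intros H; unfold summable.
apply (ex_series_ext (V := R_NormedModule) (fun n => Rabs (a n * Cmod z ^ n))).
- intros n; symmetry; apply Cmod_term.
- apply CV_disk_inside; now rewrite Rabs_pos_eq by apply Cmod_ge_0.
Qed.

Lemma cps_ext (a b : nat -> R) (z : C) : (forall n, a n = b n) -> cps a z = cps b z.
Proof. intros H; apply CSeries_ext; intros n; now rewrite H. Qed.

Lemma in_disk_ext (a b : nat -> R) (z : C) :
  (forall n, a n = b n) -> in_disk a z -> in_disk b z.
Proof. intros H; unfold in_disk; now rewrite (CV_radius_ext _ _ H). Qed.

Lemma cps_plus (a b : nat -> R) (z : C) : in_disk a z -> in_disk b z ->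
  cps (PS_plus a b) z = (cps a z + cps b z)%C.
Proof.
intros Ha Hb; unfold cps; rewrite <- CSeries_plus by now apply summable_cps.
apply CSeries_ext; intros n; change (PS_plus a b n) with (a n + b n).
rewrite RtoC_plus; ring.
Qed.

Lemma cps_scal (c : R) (a : nat -> R) (z : C) : in_disk a z ->
  cps (PS_scal c a) z = (c * cps a z)%C.
Proof.
intros Ha; unfold cps; rewrite <- CSeries_scal by now apply summable_cps.
apply CSeries_ext; intros n; change (PS_scal c a n) with (c * a n).
rewrite RtoC_mult; ring.
Qed.

Lemma in_disk_incr_1 (a : nat -> R) (z : C) : in_disk a z -> in_disk (PS_incr_1 a) z.
Proof. unfold in_disk; now rewrite CV_radius_incr_1. Qed.

Lemma in_disk_derive (a : nat -> R) (z : C) : in_disk a z -> in_disk (PS_derive a) z.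
Proof. unfold in_disk; now rewrite CV_radius_derive. Qed.

Lemma in_disk_scal (c : R) (a : nat -> R) (z : C) : in_disk a z -> in_disk (PS_scal c a) z.
Proof.
unfold in_disk; destruct (Req_dec c 0) as [->|Hc].
- intros _.
  rewrite (CV_radius_ext _ (fun _ => 0)).
  + now rewrite CV_radius_const_0.
  + intros n; change (0 * a n = 0); ring.
- now rewrite CV_radius_scal.
Qed.

Lemma in_disk_plus (a b : nat -> R) (z : C) :
  in_disk a z -> in_disk b z -> in_disk (PS_plus a b) z.
Proof.
unfold in_disk; intros Ha Hb.
eapply Rbar_lt_le_trans; [|apply CV_radius_plus].
now apply Rbar_min_case.
Qed.

Lemma cps_incr_1 (a : nat -> R) (z : C) : in_disk a z ->
  cps (PS_incr_1 a) z = (z * cps a z)%C.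
Proof.
intros Ha; unfold cps at 1.
rewrite CSeries_incr_1 by (apply summable_cps; now apply in_disk_incr_1).
unfold cps; rewrite <- CSeries_scal by now apply summable_cps.
simpl (PS_incr_1 _ 0%nat); unfold zero; simpl (AbelianMonoid.zero _ _).
rewrite (CSeries_ext _ (fun n => z * (RtoC (a n) * z ^ n))%C).
- change (AbelianMonoid.zero _ _) with 0; ring.
- intros n; simpl; ring.
Qed.

Lemma cps_mult (a b : nat -> R) (z : C) : in_disk a z -> in_disk b z ->
  cps (PS_mult a b) z = (cps a z * cps b z)%C.
Proof.
intros Ha Hb.
assert (Hm : forall a b : nat -> R, ex_series (fun n => Rabs (a n)) ->
   ex_series (fun n => Rabs (b n)) ->
   is_series (fun n => sum_f_R0 (fun k => a k * b (n - k)%nat) n) (Series a * Series b)).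
{ intros u v Hu Hv; apply is_series_mult; auto; apply Series_correct, ex_series_Rabs; auto. }
assert (F := summable_cps a z Ha); assert (G := summable_cps b z Hb).
assert (F1 := summable_Re _ F); assert (F2 := summable_Im _ F).
assert (G1 := summable_Re _ G); assert (G2 := summable_Im _ G).
assert (E : forall n k, (k <= n)%nat -> (z ^ n = z ^ k * z ^ (n - k)%nat)%C).
{ intros n k Hk; rewrite <- Cpow_add_r; f_equal; lia. }
unfold cps, CSeries, Cmult; apply injective_projections; simpl fst; simpl snd;
  apply is_series_unique.
- eapply is_series_ext; [|apply (is_series_minus (V := R_NormedModule) _ _ _ _ (Hm _ _ F1 G1) (Hm _ _ F2 G2))].
  intros n; cbv beta; change (plus ?u (opp ?v)) with (u - v).
  rewrite <- minus_sum; unfold PS_mult; simpl.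
  rewrite Rmult_0_l, Rminus_0_r, (Rmult_comm (sum_f_R0 _ _)), scal_sum.
  apply sum_eq; intros k Hk; rewrite (E n k) by auto; simpl; ring.
- eapply is_series_ext; [|apply (is_series_plus (V := R_NormedModule) _ _ _ _ (Hm _ _ F1 G2) (Hm _ _ F2 G1))].
  intros n; cbv beta; change (plus ?u ?v) with (u + v).
  rewrite <- plus_sum; unfold PS_mult; simpl.
  rewrite Rmult_0_l, Rplus_0_r, (Rmult_comm (sum_f_R0 _ _)), scal_sum.
  apply sum_eq; intros k Hk; rewrite (E n k) by auto; simpl; ring.
Qed.

Lemma cps_RtoC (a : nat -> R) (x : R) : cps a x = PSeries a x.
Proof.
unfold cps, CSeries, PSeries; apply injective_projections; simpl fst; simpl snd.
- apply Series_ext; intros n; rewrite <- RtoC_pow; simpl; ring.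
- rewrite (Series_ext _ (fun n => 0 * 0)).
  + rewrite Series_scal_l; ring.
  + intros n; rewrite <- RtoC_pow; simpl; ring.
Qed.

Lemma Cmod_cps (a : nat -> R) (z : C) : (forall n, 0 <= a n) -> in_disk a z ->
  Cmod (cps a z) <= PSeries a (Cmod z).
Proof.
intros Hp Ha; apply Rle_trans with (1 := Cmod_CSeries _ (summable_cps _ _ Ha)).
apply Req_le, Series_ext; intros n; rewrite Cmod_term; apply Rabs_pos_eq.
apply Rmult_le_pos; [apply Hp|apply pow_le, Cmod_ge_0].
Qed.

(** * Derivatives of complex-valued paths *)

Definition pd (g : R -> C) (u : R) (m : C) : Prop :=
  is_derive (fun x => Re (g x)) u (Re m) /\ is_derive (fun x => Im (g x)) u (Im m).

(** Clearing the quotient by h admits h = 0 and lets the estimates for two coordinates merge into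
    one for [Cmod]. *)
Lemma is_derive_eps (f : R -> R) (x l : R) :
  is_derive f x l <->
  forall eps, 0 < eps -> exists d, 0 < d /\
    forall h, Rabs h < d -> Rabs (f (x + h) - f x - h * l) <= eps * Rabs h.
Proof.
rewrite is_derive_Reals; split; intros H eps Heps.
- destruct (H eps Heps) as [d Hd]; exists d; split; [apply cond_pos|].
  intros h Hh; destruct (Req_dec h 0) as [->|Hn].
  + rewrite Rplus_0_r, Rabs_R0; replace (_ - _ - _) with 0 by ring; rewrite Rabs_R0; lra.
  + replace (f (x + h) - f x - h * l) with (((f (x + h) - f x) / h - l) * h) by (now field).
    rewrite Rabs_mult; apply Rmult_le_compat_r; [apply Rabs_pos|].
    apply Rlt_le, Hd; auto.
- destruct (H (eps / 2)) as [d [Hd Hh]]; [lra|].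
  exists (mkposreal d Hd); intros h Hn Hhd.
  replace ((f (x + h) - f x) / h - l) with ((f (x + h) - f x - h * l) / h) by (now field).
  unfold Rdiv; rewrite Rabs_mult, Rabs_inv.
  apply Rle_lt_trans with (eps / 2 * Rabs h * / Rabs h).
  + apply Rmult_le_compat_r; [|now apply Hh].
    apply Rlt_le, Rinv_0_lt_compat, Rabs_pos_lt; auto.
  + rewrite Rmult_assoc, Rinv_r by (now apply Rabs_no_R0); lra.
Qed.

Lemma pd_eps (g : R -> C) (u : R) (m : C) :
  pd g u m <->
  forall eps, 0 < eps -> exists d, 0 < d /\
    forall h, Rabs h < d -> Cmod (g (u + h)%R - g u - h * m) <= eps * Rabs h.
Proof.
unfold pd; rewrite !is_derive_eps; split.
- intros [H1 H2] eps Heps.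
  destruct (H1 (eps / 2)) as [d1 [Hd1 K1]]; [lra|].
  destruct (H2 (eps / 2)) as [d2 [Hd2 K2]]; [lra|].
  exists (Rmin d1 d2); split; [now apply Rmin_pos|].
  intros h Hh; apply Rle_trans with (1 := Cmod_le_Re_Im _).
  assert (A1 := K1 h (Rlt_le_trans _ _ _ Hh (Rmin_l _ _))).
  assert (A2 := K2 h (Rlt_le_trans _ _ _ Hh (Rmin_r _ _))).
  replace (Re (_ - _ - _)%C) with (Re (g (u + h)) - Re (g u) - h * Re m)
    by (unfold Cminus; rewrite !re_plus, !re_opp, re_scal_l; ring).
  replace (Im (_ - _ - _)%C) with (Im (g (u + h)) - Im (g u) - h * Im m)
    by (unfold Cminus; rewrite !im_plus, !im_opp, im_scal_l; ring).
  lra.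
- intros H; split; intros eps Heps; destruct (H eps Heps) as [d [Hd K]];
    exists d; split; auto; intros h Hh; apply Rle_trans with (2 := K h Hh).
  + replace (Re (g (u + h)) - Re (g u) - h * Re m) with (Re (g (u + h)%R - g u - h * m)%C)
      by (unfold Cminus; rewrite !re_plus, !re_opp, re_scal_l; ring).
    apply re_le_Cmod.
  + replace (Im (g (u + h)) - Im (g u) - h * Im m) with (Im (g (u + h)%R - g u - h * m)%C)
      by (unfold Cminus; rewrite !im_plus, !im_opp, im_scal_l; ring).
    apply im_le_Cmod.
Qed.

Lemma pd_ext_loc (f g : R -> C) (u : R) (m : C) :
  locally u (fun x => f x = g x) -> pd f u m -> pd g u m.
Proof.
intros E [H1 H2]; split; [apply (is_derive_ext_loc _ _ _ _) with (2 := H1)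
 | apply (is_derive_ext_loc _ _ _ _) with (2 := H2)];
 apply filter_imp with (2 := E); intros x ->; auto.
Qed.

Lemma pd_ext (f g : R -> C) (u : R) (m : C) :
  (forall x, f x = g x) -> pd f u m -> pd g u m.
Proof. intros E; apply pd_ext_loc; now apply filter_forall. Qed.

Lemma pd_const (c : C) (u : R) : pd (fun _ => c) u 0.
Proof. split; apply (is_derive_const (V := R_NormedModule)). Qed.

Lemma pd_plus (f g : R -> C) (u : R) (l m : C) :
  pd f u l -> pd g u m -> pd (fun x => f x + g x)%C u (l + m)%C.
Proof. intros [F1 F2] [G1 G2]; split; now apply (is_derive_plus (V := R_NormedModule)). Qed.

Lemma is_derive_eq (f : R -> R) (u l m : R) : is_derive f u l -> l = m -> is_derive f u m.
Proof. now intros H <-. Qed.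

Lemma pd_mult (f g : R -> C) (u : R) (l m : C) :
  pd f u l -> pd g u m -> pd (fun x => f x * g x)%C u (l * g u + f u * m)%C.
Proof.
intros [F1 F2] [G1 G2].
assert (D : forall f1 f2 g1 g2 : R -> R, forall l1 l2 m1 m2 s, is_derive (fun x : R => f1 x) u l1 -> is_derive (fun x : R => f2 x) u l2 ->
  is_derive (fun x : R => g1 x) u m1 -> is_derive (fun x : R => g2 x) u m2 ->
  is_derive (fun x => f1 x * g1 x + s * (f2 x * g2 x)) u
    (l1 * g1 u + f1 u * m1 + s * (l2 * g2 u + f2 u * m2))).
{ intros f1 f2 g1 g2 l1 l2 m1 m2 s A1 A2 B1 B2.
  auto_derive; [repeat split; now eexists; eassumption|].
  rewrite (is_derive_unique _ _ _ A1), (is_derive_unique _ _ _ A2),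
    (is_derive_unique _ _ _ B1), (is_derive_unique _ _ _ B2); ring. }
split.
- eapply is_derive_ext; [|eapply is_derive_eq; [apply (D _ _ _ _ _ _ _ _ (-1) F1 F2 G1 G2)|]].
  + intros x; unfold Re, Im; simpl; ring.
  + unfold Re, Im; simpl; ring.
- eapply is_derive_ext; [|eapply is_derive_eq; [apply (D _ _ _ _ _ _ _ _ 1 F1 F2 G2 G1)|]].
  + intros x; unfold Re, Im; simpl; ring.
  + unfold Re, Im; simpl; ring.
Qed.

Lemma pd_opp (f : R -> C) (u : R) (l : C) : pd f u l -> pd (fun x => - f x)%C u (- l)%C.
Proof. intros [F1 F2]; split; now apply (is_derive_opp (V := R_NormedModule)). Qed.

Lemma pd_RtoC (f : R -> R) (u l : R) : is_derive f u l -> pd (fun x => RtoC (f x)) u l.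
Proof.
intros H; split; [exact H|].
change (is_derive (fun _ : R => 0) u 0); apply (is_derive_const (V := R_NormedModule)).
Qed.

Lemma pd_eq (f : R -> C) (u : R) (l m : C) : l = m -> pd f u l -> pd f u m.
Proof. now intros ->. Qed.

Lemma pd_inv (f : R -> C) (u : R) (l : C) : f u <> 0 -> pd f u l ->
  pd (fun x => / f x)%C u (- l / (f u * f u))%C.
Proof.
intros Hn [F1 F2].
assert (Hp : (Re (f u)) ^ 2 + (Im (f u)) ^ 2 <> 0).
{ rewrite <- Cmod2_alt; apply Rgt_not_eq, pow_lt; now apply Cmod_gt_0. }
(* Over the real denominator |f u|^4 both coordinates become rational expressions in the coordinates
   of [f u] and [l]. *)
assert (E : (- l / (f u * f u))%C = (- l * Cconj (f u) * Cconj (f u) *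
  RtoC (/ ((Re (f u) ^ 2 + Im (f u) ^ 2) * (Re (f u) ^ 2 + Im (f u) ^ 2))))%C).
{ rewrite <- Cmod2_alt, RtoC_inv, RtoC_mult, !Cmod2_conj.
  - field; split; auto.
    intros H; apply Hn; rewrite <- (Cconj_conj (f u)), H; unfold Cconj, RtoC; simpl; f_equal; ring.
  - rewrite Cmod2_alt; now apply Rmult_integral_contrapositive. }
rewrite E; clear E.
assert (D : forall g f1 f2 : R -> R, forall k l1 l2, is_derive (fun x : R => g x) u k ->
   is_derive (fun x : R => f1 x) u l1 -> is_derive (fun x : R => f2 x) u l2 -> f1 u ^ 2 + f2 u ^ 2 <> 0 ->
   is_derive (fun x => g x / (f1 x ^ 2 + f2 x ^ 2)) u
     (k / (f1 u ^ 2 + f2 u ^ 2) - g u * (2 * f1 u * l1 + 2 * f2 u * l2) /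
       ((f1 u ^ 2 + f2 u ^ 2) * (f1 u ^ 2 + f2 u ^ 2)))).
{ intros g f1 f2 k l1 l2 A B1 B2 Hd.
  auto_derive; [repeat split; auto; try (now eexists; eassumption); simpl in Hd; lra|].
  rewrite (is_derive_unique _ _ _ A), (is_derive_unique _ _ _ B1), (is_derive_unique _ _ _ B2).
  field; simpl in Hd; lra. }
split.
- eapply is_derive_ext; [|eapply is_derive_eq; [apply (D _ _ _ _ _ _ F1 F1 F2 Hp)|]].
  + intros x; reflexivity.
  + rewrite re_scal_r; unfold Re, Im in *; simpl; field; simpl in Hp; lra.
- eapply is_derive_ext; [|eapply is_derive_eq; [apply (D (fun x => - Im (f x)) _ _ (- Im l) _ _ (is_derive_opp _ _ _ F2) F1 F2 Hp)|]].
  + intros x; reflexivity.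
  + rewrite im_scal_r; unfold Re, Im in *; simpl; field; simpl in Hp; lra.
Qed.

Lemma pd_Cexp (f : R -> C) (u : R) (l : C) : pd f u l ->
  pd (fun x => Cexp (f x)) u (l * Cexp (f u))%C.
Proof.
intros [F1 F2].
assert (D : forall f1 f2 : R -> R, forall l1 l2, is_derive (fun x : R => f1 x) u l1 -> is_derive (fun x : R => f2 x) u l2 ->
  is_derive (fun x => exp (f1 x) * cos (f2 x)) u (exp (f1 u) * (l1 * cos (f2 u) - l2 * sin (f2 u))) /\
  is_derive (fun x => exp (f1 x) * sin (f2 x)) u (exp (f1 u) * (l1 * sin (f2 u) + l2 * cos (f2 u)))).
{ intros f1 f2 l1 l2 A1 A2; split; (auto_derive; [repeat split; now eexists; eassumption|]);
  rewrite (is_derive_unique _ _ _ A1), (is_derive_unique _ _ _ A2); ring. }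
destruct (D _ _ _ _ F1 F2) as [D1 D2].
split.
- eapply is_derive_eq; [apply D1|unfold Cexp, Re, Im; simpl; ring].
- eapply is_derive_eq; [apply D2|unfold Cexp, Re, Im; simpl; ring].
Qed.

(* Complex differentiability, tested along real paths. *)
Definition cdiff (f : C -> C) (z l : C) : Prop :=
  forall (g : R -> C) (u : R) (m : C), g u = z -> pd g u m ->
  pd (fun x => f (g x)) u (l * m)%C.

(** The remainders satisfy e_(n+1) = (z + h) e_n + n h^2 z^(n-1). The factor r^2 stays on the left
    so that no power r^(n-2) occurs, and n^2 is a convenient substitute for n(n - 1)/2. *)
Lemma Cpow_taylor2 (z h : C) (r : R) (n : nat) : 0 < r ->
  Cmod z <= r -> Cmod (z + h) <= r ->
  r ^ 2 * Cmod ((z + h) ^ n - z ^ n - h * (INR n * z ^ pred n)) <=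
  Cmod h ^ 2 * (INR n * (INR n * r ^ n)).
Proof.
intros Hr Hz Hzh; induction n as [|n IH].
- simpl; replace (_ - _ - _)%C with (RtoC 0) by ring; rewrite Cmod_0; lra.
- set (e := ((z + h) ^ n - z ^ n - h * (INR n * z ^ pred n))%C) in *.
  replace (_ - _ - _)%C with ((z + h) * e + h * h * (INR n * z ^ pred n))%C.
  2:{ unfold e; rewrite S_INR, RtoC_plus; destruct n as [|n]; simpl pred.
      - simpl; ring.
      - simpl Cpow; ring. }
  assert (Hn := pos_INR n).
  assert (B : r ^ 2 * (INR n * Cmod z ^ pred n) <= INR n * r ^ S n).
  { destruct n as [|n]; [simpl; lra|]; simpl pred.
    replace (INR (S n) * r ^ S (S n)) with (r ^ 2 * (INR (S n) * r ^ n)) by (simpl; ring).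
    apply Rmult_le_compat_l; [nra|]. apply Rmult_le_compat_l; auto.
    apply pow_incr; split; auto; apply Cmod_ge_0. }
  apply Rle_trans with (r * (r ^ 2 * Cmod e) + Cmod h ^ 2 * (r ^ 2 * (INR n * Cmod z ^ pred n))).
  + apply Rle_trans with (r ^ 2 * (Cmod ((z + h) * e) + Cmod (h * h * (INR n * z ^ pred n)))).
    * apply Rmult_le_compat_l; [nra|apply Cmod_triangle].
    * rewrite !Cmod_mult, Cmod_R, Cmod_pow, (Rabs_pos_eq (INR n)) by auto.
      assert (0 <= r ^ 2 * Cmod e) by (apply Rmult_le_pos; [nra|apply Cmod_ge_0]).
      nra.
  + apply Rle_trans with (r * (Cmod h ^ 2 * (INR n * (INR n * r ^ n))) + Cmod h ^ 2 * (INR n * r ^ S n)).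
    * apply Rplus_le_compat; apply Rmult_le_compat_l; auto; [lra|apply pow_le, Cmod_ge_0].
    * rewrite S_INR; simpl (r ^ S n).
      assert (0 <= Cmod h ^ 2 * (r * r ^ n)).
      { apply Rmult_le_pos; [apply pow_le, Cmod_ge_0|]; apply Rmult_le_pos; [lra|apply pow_le; lra]. }
      nra.
Qed.

Lemma in_disk_radius (a : nat -> R) (z : C) : in_disk a z ->
  exists r : R, Cmod z < r /\ Rbar_lt r (CV_radius a).
Proof.
unfold in_disk; destruct (CV_radius a) as [x| |]; simpl; intros H.
- exists ((Cmod z + x) / 2); lra.
- exists (Cmod z + 1); split; [lra|exact I].
- easy.
Qed.

Lemma cps_taylor2 (a : nat -> R) (z : C) : in_disk a z ->
  exists M d, 0 <= M /\ 0 < d /\ forall h, Cmod h < d ->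
    Cmod (cps a (z + h) - cps a z - h * cps (PS_derive a) z) <= M * Cmod h ^ 2.
Proof.
intros Ha; destruct (in_disk_radius a z Ha) as [r [Hzr Hr]].
assert (Hr0 : 0 < r) by (apply Rle_lt_trans with (2 := Hzr), Cmod_ge_0).
(* This is n^2 a_n, written with derivatives and shifts because both preserve the radius of
   convergence. *)
set (b := PS_incr_1 (PS_derive (PS_incr_1 (PS_derive a)))).
assert (Hb : forall n, b n = INR n * (INR n * a n)).
{ intros [|n]; [change (0 = INR 0 * (INR 0 * a 0%nat)); simpl; ring|].
  unfold b; simpl PS_incr_1; unfold PS_derive; simpl PS_incr_1; reflexivity. }
assert (HB : ex_series (fun n => Rabs (b n * r ^ n))).
{ apply CV_disk_inside; unfold b.
  rewrite CV_radius_incr_1, CV_radius_derive, CV_radius_incr_1, CV_radius_derive.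
  now rewrite Rabs_pos_eq by lra. }
set (S := Series (fun n => Rabs (b n * r ^ n))).
exists (S / r ^ 2), (r - Cmod z); split; [|split; [lra|]].
{ apply Rmult_le_pos; [|apply Rlt_le, Rinv_0_lt_compat, pow_lt; lra].
  unfold S; rewrite <- (Series_ext (fun n => Rabs (Rabs (b n * r ^ n)))) by (intros; apply Rabs_Rabsolu).
  apply Rle_trans with (2 := Series_Rabs (fun n => Rabs (b n * r ^ n))
    (ex_series_ext (V := R_NormedModule) _ _ (fun n => eq_sym (Rabs_Rabsolu _)) HB)).
  apply Rabs_pos. }
intros h Hh.
assert (Hzh : Cmod (z + h) <= r) by (apply Rle_trans with (1 := Cmod_triangle _ _); lra).
assert (Ha' : in_disk a (z + h)%C).
{ unfold in_disk; apply Rbar_le_lt_trans with (2 := Hr); exact Hzh. }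
set (f := fun n => (RtoC (a n) * ((z + h) ^ n - z ^ n - h * (INR n * z ^ pred n)))%C).
assert (Hf : forall n, Cmod (f n) <= Cmod h ^ 2 / r ^ 2 * Rabs (b n * r ^ n)).
{ intros n; unfold f; rewrite Cmod_mult, Cmod_R, Hb.
  assert (T := Cpow_taylor2 z h r n Hr0 (Rlt_le _ _ Hzr) Hzh).
  assert (Hr2 : 0 < r ^ 2) by (apply pow_lt; lra).
  apply Rmult_le_reg_l with (r ^ 2); auto.
  replace (r ^ 2 * (Cmod h ^ 2 / r ^ 2 * _))
   with (Rabs (a n) * (Cmod h ^ 2 * (INR n * (INR n * r ^ n)))).
  - rewrite <- Rmult_assoc, (Rmult_comm _ (Rabs _)), Rmult_assoc.
    apply Rmult_le_compat_l; [apply Rabs_pos|exact T].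
  - rewrite !Rabs_mult, (Rabs_pos_eq (r ^ n)), (Rabs_pos_eq (INR n)).
    + field; lra.
    + apply pos_INR.
    + apply pow_le; lra. }
assert (HS : ex_series (fun n => Cmod h ^ 2 / r ^ 2 * Rabs (b n * r ^ n)))
  by now apply (ex_series_scal (V := R_NormedModule)).
assert (Hfs : summable f).
{ apply (ex_series_le (V := R_CompleteNormedModule) _ _) with (2 := HS).
  intros n; change (norm (Cmod (f n))) with (Rabs (Cmod (f n))).
  rewrite Rabs_pos_eq by apply Cmod_ge_0; apply Hf. }
(* At n = 0 the factor [INR 0] kills the spurious term caused by [pred 0 = 0]. *)
set (g := fun n => (RtoC (a n) * (INR n * z ^ pred n))%C).
assert (Hg1 : forall n, g (Datatypes.S n) = (RtoC (PS_derive a n) * z ^ n)%C).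
{ intros n; unfold g, PS_derive; simpl pred; rewrite RtoC_mult; ring. }
assert (Hgs : summable g).
{ apply summable_incr_1.
  apply (ex_series_ext (V := R_NormedModule) (fun n => Cmod (RtoC (PS_derive a n) * z ^ n))).
  - intros n; now rewrite Hg1.
  - apply summable_cps; now apply in_disk_derive. }
assert (Hg : CSeries g = cps (PS_derive a) z).
{ rewrite CSeries_incr_1 by auto.
  rewrite (CSeries_ext _ _ Hg1); unfold g; simpl INR; fold (cps (PS_derive a) z); ring. }
assert (E : (cps a (z + h) - cps a z - h * cps (PS_derive a) z)%C = CSeries f).
{ rewrite <- Hg; unfold cps.
  transitivity (CSeries (fun n => RtoC (a n) * (z + h) ^ n)
    + ((- (1)) * CSeries (fun n => RtoC (a n) * z ^ n) + (- h) * CSeries g))%C; [ring|].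
  assert (H1 := summable_cps a z Ha). assert (H2 := summable_cps a _ Ha').
  assert (Hsc : forall c u, summable u -> summable (fun n => c * u n)%C).
  { intros c u Hu; apply (ex_series_ext (V := R_NormedModule) (fun n => Cmod c * Cmod (u n))).
    - intros n; now rewrite Cmod_mult.
    - now apply (ex_series_scal (V := R_NormedModule)). }
  assert (Hpl : forall u v, summable u -> summable v -> summable (fun n => u n + v n)%C).
  { intros u v Hu Hv.
    apply (ex_series_le (V := R_CompleteNormedModule) _ (fun n => Cmod (u n) + Cmod (v n))).
    - intros n; change (norm (Cmod (u n + v n))) with (Rabs (Cmod (u n + v n))).
      rewrite Rabs_pos_eq by apply Cmod_ge_0; apply Cmod_triangle.
    - now apply (ex_series_plus (V := R_NormedModule)). }
  rewrite <- !CSeries_scal, <- !CSeries_plus by auto.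
  apply CSeries_ext; intros n; unfold f, g; ring. }
rewrite E; apply Rle_trans with (1 := Cmod_CSeries f Hfs).
replace (S / r ^ 2 * Cmod h ^ 2) with (Series (fun n => Cmod h ^ 2 / r ^ 2 * Rabs (b n * r ^ n))).
- apply Series_le; auto; intros n; split; [apply Cmod_ge_0|apply Hf].
- rewrite Series_scal_l; unfold S, Rdiv; ring.
Qed.

Lemma cps_cdiff (a : nat -> R) (z : C) : in_disk a z ->
  cdiff (cps a) z (cps (PS_derive a) z).
Proof.
intros Ha g u m Hgu Hg; apply pd_eps; intros eps Heps.
destruct (cps_taylor2 a z Ha) as [M [d [HM [Hd HT]]]].
set (l := cps (PS_derive a) z) in *.
set (B := Cmod m + 1).
assert (HB : 0 < B) by (generalize (Cmod_ge_0 m); unfold B; lra).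
assert (Hl := Cmod_ge_0 l).
rewrite pd_eps in Hg.
destruct (Hg 1 Rlt_0_1) as [d1 [Hd1 K1]].
set (e2 := eps / (2 * (Cmod l + 1))).
assert (He2 : 0 < e2) by (apply Rdiv_lt_0_compat; lra).
destruct (Hg e2 He2) as [d2 [Hd2 K2]].
(* The first bound keeps the increment of [g] within the range of the Taylor estimate, the second
   makes M B^2 |h| at most eps / 2; [e2] does the same for the linear term. *)
set (d3 := Rmin (d / B) (eps / (2 * (M + 1) * B ^ 2))).
assert (HB2 : 0 < B ^ 2) by (apply pow_lt; auto).
assert (Hd3 : 0 < d3).
{ apply Rmin_pos; apply Rdiv_lt_0_compat; auto; apply Rmult_lt_0_compat; lra. }
exists (Rmin (Rmin d1 d2) d3); split; [apply Rmin_pos; [now apply Rmin_pos|exact Hd3]|].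
intros h Hh.
assert (Hh1 : Rabs h < d1) by (eapply Rlt_le_trans, Rle_trans; [apply Hh|apply Rmin_l|apply Rmin_l]).
assert (Hh2 : Rabs h < d2) by (eapply Rlt_le_trans, Rle_trans; [apply Hh|apply Rmin_l|apply Rmin_r]).
assert (Hh3 : Rabs h < d3) by (eapply Rlt_le_trans; [apply Hh|apply Rmin_r]).
specialize (K1 h Hh1); specialize (K2 h Hh2).
set (k := (g (u + h)%R - g u)%C) in *.
assert (Hk : Cmod k <= B * Rabs h).
{ replace k with ((k - h * m) + h * m)%C by ring.
  apply Rle_trans with (1 := Cmod_triangle _ _); rewrite Cmod_mult, Cmod_R; unfold B.
  lra. }
assert (Hkd : Cmod k < d).
{ apply Rle_lt_trans with (1 := Hk).
  replace d with (B * (d / B)) by (field; lra).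
  apply Rmult_lt_compat_l; auto. apply Rlt_le_trans with (1 := Hh3), Rmin_l. }
specialize (HT k Hkd).
replace (g (u + h)%R) with (z + k)%C by (unfold k; rewrite Hgu; ring).
rewrite Hgu.
replace (_ - _ - _)%C with ((cps a (z + k) - cps a z - k * l) + l * (k - h * m))%C by ring.
apply Rle_trans with (1 := Cmod_triangle _ _).
replace (eps * Rabs h) with (eps / 2 * Rabs h + eps / 2 * Rabs h) by field.
apply Rplus_le_compat.
- apply Rle_trans with (1 := HT).
  apply Rle_trans with (M * (B * Rabs h) ^ 2).
  + apply Rmult_le_compat_l; auto; apply pow_incr; split; [apply Cmod_ge_0|auto].
  + replace (M * (B * Rabs h) ^ 2) with ((M * B ^ 2 * Rabs h) * Rabs h) by ring.
    apply Rmult_le_compat_r; [apply Rabs_pos|].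
    apply Rle_trans with ((M + 1) * B ^ 2 * d3).
    * apply Rmult_le_compat; [apply Rmult_le_pos; lra|apply Rabs_pos| |lra].
      apply Rmult_le_compat_r; lra.
    * apply Rle_trans with ((M + 1) * B ^ 2 * (eps / (2 * (M + 1) * B ^ 2))).
      -- apply Rmult_le_compat_l; [apply Rmult_le_pos; lra|apply Rmin_r].
      -- apply Req_le; field; split; lra.
- rewrite Cmod_mult.
  apply Rle_trans with (Cmod l * (e2 * Rabs h)); [apply Rmult_le_compat_l; auto|].
  rewrite <- Rmult_assoc; apply Rmult_le_compat_r; [apply Rabs_pos|].
  apply Rle_trans with ((Cmod l + 1) * e2); [apply Rmult_le_compat_r; lra|].
  apply Req_le; unfold e2; field; lra.
Qed.

(** * Eisenstein series and Ramanujan's differential equations *)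

Lemma CV_radius_one : CV_radius (fun _ => 1) = 1.
Proof.
rewrite (CV_radius_finite_DAlembert (fun _ => 1) 1).
- now rewrite Rinv_1.
- intros _; lra.
- lra.
- apply is_lim_seq_ext with (fun _ => 1); [|apply is_lim_seq_const].
  intros _; rewrite Rdiv_diag, Rabs_R1; lra.
Qed.

Lemma CV_radius_INR_pow (m : nat) : CV_radius (fun n => INR n ^ m) = 1.
Proof.
induction m as [|m IH].
- now rewrite <- CV_radius_one.
- rewrite <- IH, <- (CV_radius_derive (fun n => INR n ^ m)).
  rewrite <- (CV_radius_incr_1 (PS_derive (fun n => INR n ^ m))).
  apply CV_radius_ext; intros [|n].
  + change (INR 0 ^ S m = 0); simpl; ring.
  + change (INR (S n) ^ S m = PS_derive (fun n => INR n ^ m) n); reflexivity.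
Qed.

Lemma in_disk_le_pow (a : nat -> R) (K : R) (m : nat) (z : C) :
  (forall n, Rabs (a n) <= K * INR n ^ m) -> Cmod z < 1 -> in_disk a z.
Proof.
intros Ha Hz; unfold in_disk.
set (r := (Cmod z + 1) / 2).
assert (Hz0 := Cmod_ge_0 z).
assert (Hr : Cmod z < r < 1) by (unfold r; lra).
apply Rbar_lt_le_trans with r; [simpl; lra|].
unfold CV_radius; apply (proj1 (Lub_Rbar_correct _)).
unfold CV_disk.
apply (ex_series_le (V := R_CompleteNormedModule) _ (fun n => K * Rabs (INR n ^ m * r ^ n))).
- intros n; change (norm (Rabs (a n * r ^ n))) with (Rabs (Rabs (a n * r ^ n))).
  rewrite Rabs_Rabsolu, !Rabs_mult, (Rabs_pos_eq (INR n ^ m)) by apply pow_le, pos_INR.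
  rewrite <- Rmult_assoc; apply Rmult_le_compat_r; [apply Rabs_pos|auto].
- apply (ex_series_scal (V := R_NormedModule)), CV_disk_inside.
  rewrite CV_radius_INR_pow, Rabs_pos_eq; simpl; lra.
Qed.

Definition eis (c : R) (k n : nat) : R :=
  match n with O => 1 | S _ => c * sg k n end.

Lemma eis_delta (c : R) (k n : nat) :
  eis c k n = (if Nat.eqb n 0 then 1 else 0) + c * sg k n.
Proof. destruct n as [|n]; simpl Nat.eqb; simpl; [unfold sg, dsum; simpl|]; ring. Qed.

Lemma rsum_le (n : nat) (f g : nat -> R) :
  (forall i, (i < n)%nat -> f i <= g i) -> rsum n f <= rsum n g.
Proof.
induction n as [|n IH]; simpl; intros H; [lra|].
apply Rplus_le_compat; auto.
Qed.

Lemma rsum_nonneg (n : nat) (f : nat -> R) :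
  (forall i, (i < n)%nat -> 0 <= f i) -> 0 <= rsum n f.
Proof.
induction n as [|n IH]; simpl; intros H; [lra|].
apply Rplus_le_le_0_compat; auto.
Qed.

Lemma sg_bound (k n : nat) : 0 <= sg k n <= INR n ^ (k + 2).
Proof.
split.
- unfold sg, dsum; apply rsum_nonneg; intros d _; apply rsum_nonneg; intros e _.
  destruct Nat.eqb; [apply pow_le, pos_INR|lra].
- apply Rle_trans with (rsum n (fun _ => rsum n (fun _ => INR n ^ k))).
  + apply rsum_le; intros d Hd; apply rsum_le; intros e _; destruct Nat.eqb.
    * apply pow_incr; split; [apply pos_INR|apply le_INR; lia].
    * apply pow_le, pos_INR.
  + rewrite !rsum_const, pow_add; simpl; lra.
Qed.

Lemma in_disk_eis (c : R) (k : nat) (z : C) : Cmod z < 1 -> in_disk (eis c k) z.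
Proof.
intros Hz; apply (in_disk_ext (PS_plus (fun n => if Nat.eqb n 0 then 1 else 0) (PS_scal c (sg k)))).
{ intros n; rewrite eis_delta; reflexivity. }
apply in_disk_plus.
- apply (in_disk_le_pow _ 1 0); auto; intros n; simpl; destruct Nat.eqb;
   rewrite ?Rabs_R1, ?Rabs_R0; lra.
- apply in_disk_scal, (in_disk_le_pow _ 1 (k + 2)); auto.
  intros n; rewrite Rabs_pos_eq; generalize (sg_bound k n); lra.
Qed.

Lemma PS_mult_eis (c d : R) (k l n : nat) :
  PS_mult (eis c k) (eis d l) n =
  (if Nat.eqb n 0 then 1 else 0) + c * sg k n + d * sg l n + c * d * PS_mult (sg k) (sg l) n.
Proof.
unfold PS_mult; rewrite <- !rsum_sum_f_R0.
rewrite (rsum_ext _ _ (fun i => (if Nat.eqb i 0 then (fun i => eis d l (n - i)) i else 0) +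
  ((if Nat.eqb i n then (fun i => c * sg k i) i else 0) + c * d * (sg k i * sg l (n - i))))).
- rewrite !rsum_plus, rsum_scal, (rsum_single _ 0), (rsum_single _ n) by lia.
  rewrite Nat.sub_0_r, eis_delta; ring.
- intros i Hi; rewrite !eis_delta.
  destruct (Nat.eqb_spec i 0), (Nat.eqb_spec i n), (Nat.eqb_spec (n - i) 0); try lia;
   cbv beta; rewrite ?eis_delta; subst; rewrite ?Nat.sub_diag, ?Nat.sub_0_r; simpl Nat.eqb; 
   try ring.
Qed.

Definition cE2 : C -> C := cps (eis (-24) 1).
Definition cE4 : C -> C := cps (eis 240 3).
Definition cE6 : C -> C := cps (eis (-504) 5).

Lemma ramanujan_coef (n : nat) :
  12 * (INR n * eis (-24) 1 n) = PS_mult (eis (-24) 1) (eis (-24) 1) n - eis 240 3 n /\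
  3 * (INR n * eis 240 3 n) = PS_mult (eis (-24) 1) (eis 240 3) n - eis (-504) 5 n /\
  2 * (INR n * eis (-504) 5 n) =
    PS_mult (eis (-24) 1) (eis (-504) 5) n - PS_mult (eis 240 3) (eis 240 3) n.
Proof.
rewrite !PS_mult_eis, !eis_delta.
generalize (PS_mult_sg_1_1 n) (PS_mult_sg_1_3 n) (PS_mult_sg_1_5 n) (PS_mult_sg_3_3 n).
intros H1 H2 H3 H4.
assert (Hn : INR n * (if Nat.eqb n 0 then 1 else 0) = 0).
{ destruct n; simpl; ring. }
repeat split; rewrite ?Rmult_plus_distr_l, ?Hn; lra.
Qed.

Lemma cps_theta (a : nat -> R) (z : C) : in_disk a z ->
  (z * cps (PS_derive a) z)%C = cps (fun n => INR n * a n) z.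
Proof.
intros Ha; rewrite <- cps_incr_1 by now apply in_disk_derive.
apply cps_ext; intros [|n]; [|reflexivity].
change (0 = INR 0 * a 0%nat); simpl; ring.
Qed.

Lemma in_disk_theta (a : nat -> R) (z : C) : in_disk a z ->
  in_disk (fun n => INR n * a n) z.
Proof.
intros Ha; apply (in_disk_ext (PS_incr_1 (PS_derive a))).
- intros [|n]; [|reflexivity]. change (0 = INR 0 * a 0%nat); simpl; ring.
- now apply in_disk_incr_1, in_disk_derive.
Qed.

Lemma cps_ramanujan (a b c d : nat -> R) (s : R) (z : C) :
  (forall n, s * (INR n * a n) = PS_mult b c n - d n) -> 
  in_disk a z -> in_disk b z -> in_disk c z -> in_disk d z ->
  (s * (z * cps (PS_derive a) z) = cps b z * cps c z - cps d z)%C.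
Proof.
intros H Ha Hb Hc Hd.
rewrite cps_theta, <- cps_scal, <- cps_mult by auto using in_disk_theta.
assert (E : cps (PS_mult b c) z = cps (PS_plus (PS_scal s (fun n => INR n * a n)) d) z).
{ apply cps_ext; intros n.
  change (PS_mult b c n = s * (INR n * a n) + d n); rewrite H; ring. }
rewrite E, cps_plus by auto using in_disk_scal, in_disk_theta; ring.
Qed.

Lemma ramanujan (z : C) : Cmod z < 1 ->
  (12 * (z * cps (PS_derive (eis (-24) 1)) z) = cE2 z * cE2 z - cE4 z)%C /\
  (3 * (z * cps (PS_derive (eis 240 3)) z) = cE2 z * cE4 z - cE6 z)%C /\
  (2 * (z * cps (PS_derive (eis (-504) 5)) z) = cE2 z * cE6 z - cE4 z * cE4 z)%C.
Proof.
intros Hz; unfold cE2, cE4, cE6.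
assert (P := in_disk_eis (-24) 1 z Hz).
assert (Q := in_disk_eis 240 3 z Hz).
assert (S := in_disk_eis (-504) 5 z Hz).
repeat split.
- apply cps_ramanujan; auto; intros n; apply ramanujan_coef.
- apply cps_ramanujan; auto; intros n; apply ramanujan_coef.
(* E4^2 = E8: written with the coefficients 480 sigma_7, the square is a series known to converge in
   the unit disk. *)
- assert (E : forall n, PS_mult (eis 240 3) (eis 240 3) n = eis 480 7 n).
  { intros n; rewrite PS_mult_eis, eis_delta; generalize (PS_mult_sg_3_3 n); lra. }
  rewrite <- (cps_mult (eis 240 3)), (cps_ext _ _ _ E) by auto.
  apply cps_ramanujan; auto using in_disk_eis.
  intros n; rewrite <- E; apply ramanujan_coef.
Qed.

(** * The hypergeometric equation *)

Definition hc (a b c : R) (n : nat) : R :=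
  pochhammer a n * pochhammer b n / (pochhammer c n * INR (fact n)).

Lemma pochhammer_pos (s : R) (n : nat) : 0 < s -> 0 < pochhammer s n.
Proof.
intros Hs; induction n as [|n IH]; simpl; [lra|].
apply Rmult_lt_0_compat; auto; generalize (pos_INR n); lra.
Qed.

Lemma INR_fact_pos (n : nat) : 0 < INR (fact n).
Proof. apply lt_0_INR, lt_O_fact. Qed.

Lemma hc_pos (a b c : R) (n : nat) : 0 < a -> 0 < b -> 0 < c -> 0 < hc a b c n.
Proof.
intros Ha Hb Hc; unfold hc; apply Rdiv_lt_0_compat; apply Rmult_lt_0_compat;
  auto using pochhammer_pos, INR_fact_pos.
Qed.

Lemma hc_0 (a b c : R) : hc a b c 0 = 1.
Proof. unfold hc; simpl; field. Qed.

Lemma hc_S (a b c : R) (n : nat) : 0 < c ->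
  hc a b c (S n) = (a + INR n) * (b + INR n) / ((c + INR n) * INR (S n)) * hc a b c n.
Proof.
intros Hc; unfold hc; simpl pochhammer.
rewrite fact_simpl, mult_INR.
assert (H1 := pochhammer_pos c n Hc); assert (H2 := INR_fact_pos n).
assert (H3 := pos_INR n); assert (H4 : 0 < INR (S n)) by (rewrite S_INR; lra).
field; repeat split; lra.
Qed.

Lemma is_lim_seq_INR_shift (c : R) : is_lim_seq (fun n => / (c + INR n)) 0.
Proof.
assert (H : is_lim_seq (fun n => c + INR n) p_infty).
{ apply (is_lim_seq_plus (fun _ => c) INR c p_infty p_infty);
   [apply is_lim_seq_const|apply is_lim_seq_INR|reflexivity]. }
apply (is_lim_seq_inv _ p_infty) in H; [exact H|easy].
Qed.

Lemma is_lim_seq_ratio (a c : R) : 0 < c ->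
  is_lim_seq (fun n => (a + INR n) / (c + INR n)) 1.
Proof.
intros Hc.
apply is_lim_seq_ext with (fun n => 1 + (a - c) * / (c + INR n)).
{ intros n; generalize (pos_INR n); intros; field; lra. }
replace (Finite 1) with (Finite (1 + (a - c) * 0)) by (f_equal; ring).
apply is_lim_seq_plus'; [apply is_lim_seq_const|].
apply (is_lim_seq_scal_l _ (a - c) 0), is_lim_seq_INR_shift.
Qed.

Lemma CV_radius_hc (a b c : R) : 0 < a -> 0 < b -> 0 < c -> CV_radius (hc a b c) = 1.
Proof.
intros Ha Hb Hc; rewrite (CV_radius_finite_DAlembert _ 1); [now rewrite Rinv_1| |lra|].
- intros n; generalize (hc_pos a b c n Ha Hb Hc); lra.
- apply is_lim_seq_ext with (fun n => (a + INR n) / (c + INR n) * ((b + INR n) / (1 + INR n))).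
  + intros n; assert (H := hc_pos a b c n Ha Hb Hc); assert (Hn := pos_INR n).
    rewrite Rabs_pos_eq.
    * rewrite hc_S, S_INR by auto; field; lra.
    * apply Rlt_le, Rdiv_lt_0_compat; auto using hc_pos.
  + replace (Finite 1) with (Finite (1 * 1)) by (f_equal; ring).
    apply is_lim_seq_mult'; apply is_lim_seq_ratio; lra.
Qed.

Lemma in_disk_hc (a b c : R) (z : C) : 0 < a -> 0 < b -> 0 < c ->
  Cmod z < 1 -> in_disk (hc a b c) z.
Proof. intros Ha Hb Hc Hz; unfold in_disk; now rewrite CV_radius_hc. Qed.

Lemma hypergeometric_ode (a b c : R) (z : C) : 0 < a -> 0 < b -> 0 < c -> Cmod z < 1 ->
  let F := cps (hc a b c) z in
  let F1 := cps (PS_derive (hc a b c)) z in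
  let F2 := cps (PS_derive (PS_derive (hc a b c))) z in
  (z * (1 - z) * F2 + (c - (a + b + 1) * z) * F1 = a * b * F)%C.
Proof.
intros Ha Hb Hc Hz F F1 F2.
assert (D := in_disk_hc a b c z Ha Hb Hc Hz).
assert (D1 := in_disk_derive _ _ D).
assert (E1 := cps_theta _ _ D1); fold F2 in E1.
assert (E0 := cps_theta _ _ D); fold F1 in E0.
assert (E2 := cps_incr_1 _ _ (in_disk_theta _ _ D1)).
(* With z d/dz and multiplication by z as the only operations, both sides are power series, and
   comparing coefficients gives the recurrence [H]. *)
assert (E : (cps (fun n => (INR n * PS_derive (hc a b c) n)%R) z + c * F1 =
  cps (PS_incr_1 (fun n => (INR n * PS_derive (hc a b c) n)%R)) z
  + ((a + b + 1)%R * cps (fun n => (INR n * hc a b c n)%R) z + (a * b)%R * F))%C).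
{ unfold F, F1.
  rewrite <- !cps_scal, <- !cps_plus by
    auto 6 using in_disk_theta, in_disk_scal, in_disk_plus, in_disk_incr_1.
  apply cps_ext; intros n.
  change (INR n * PS_derive (hc a b c) n + c * PS_derive (hc a b c) n =
    PS_incr_1 (fun n => INR n * PS_derive (hc a b c) n) n +
    ((a + b + 1) * (INR n * hc a b c n) + a * b * hc a b c n)).
  assert (H : INR (S n) * (c + INR n) * hc a b c (S n) = (a + INR n) * (b + INR n) * hc a b c n).
  { rewrite hc_S by auto; generalize (pos_INR n); intros; field.
    rewrite S_INR; lra. }
  unfold PS_derive; destruct n as [|n].
  - change (PS_incr_1 _ 0%nat) with 0; simpl INR in *; lra.
  - change (PS_incr_1 _ (S n)) with (INR n * (INR (S n) * hc a b c (S n))).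
    transitivity (INR (S (S n)) * (c + INR (S n)) * hc a b c (S (S n))); [ring|].
    rewrite H, (S_INR n); ring. }
rewrite <- E1, E2, <- E0, <- E1, !RtoC_plus, RtoC_mult in E.
transitivity ((z * F2 + c * F1) - (z * (z * F2) + (a + b + 1) * (z * F1)))%C; [ring|].
rewrite E; ring.
Qed.

(** * Wallis' product *)

Lemma ex_RInt_cont (f : R -> R) (a b : R) :
  (forall x, continuous f x) -> ex_RInt f a b.
Proof. intros H; apply (ex_RInt_continuous (V := R_CompleteNormedModule)); auto. Qed.

Lemma continuous_sin_pow (n : nat) (x : R) : continuous (fun x => sin x ^ n) x.
Proof.
apply (ex_derive_continuous (V := R_NormedModule)); auto_derive; auto.
Qed.

Definition wallis (n : nat) : R := RInt (fun x => sin x ^ n) 0 (PI / 2).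

Lemma wallis_rec (n : nat) : INR (n + 2) * wallis (n + 2) = INR (n + 1) * wallis n.
Proof.
assert (H : is_RInt (fun x => INR (n + 2) * sin x ^ (n + 2) - INR (n + 1) * sin x ^ n)
  0 (PI / 2) ((- cos (PI / 2) * sin (PI / 2) ^ (n + 1)) - (- cos 0 * sin 0 ^ (n + 1)))).
{ apply (is_RInt_derive (V := R_CompleteNormedModule) (fun x => - cos x * sin x ^ (n + 1))).
  - intros x _; auto_derive; auto.
    replace (Init.Nat.pred (n + 1)) with n by lia.
    rewrite !plus_INR; simpl INR; rewrite !pow_add; simpl.
    assert (H := sin2_cos2 x); unfold Rsqr in H.
    replace (- cos x * (1 * cos x * ((INR n + 1) * sin x ^ n)))
      with (- (cos x * cos x) * ((INR n + 1) * sin x ^ n)) by ring.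
    replace (cos x * cos x) with (1 - sin x * sin x) by lra; ring.
  - intros x _; apply (ex_derive_continuous (V := R_NormedModule)); auto_derive; auto. }
assert (W : forall m, is_RInt (fun x => sin x ^ m) 0 (PI / 2) (wallis m)).
{ intros m; apply (RInt_correct (V := R_CompleteNormedModule)), ex_RInt_cont, continuous_sin_pow. }
assert (H' := is_RInt_minus (V := R_NormedModule) _ _ _ _ _ _
  (is_RInt_scal (V := R_NormedModule) _ _ _ (INR (n + 2)) _ (W (n + 2)%nat))
  (is_RInt_scal (V := R_NormedModule) _ _ _ (INR (n + 1)) _ (W n))).
apply (is_RInt_unique (V := R_CompleteNormedModule)) in H.
apply (is_RInt_unique (V := R_CompleteNormedModule)) in H'.
assert (E : INR (n + 2) * wallis (n + 2) - INR (n + 1) * wallis n =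
  - cos (PI / 2) * sin (PI / 2) ^ (n + 1) - - cos 0 * sin 0 ^ (n + 1)) by (rewrite <- H; symmetry; exact H').
rewrite cos_PI2, sin_0, (pow_i (n + 1)) in E by lia; lra.
Qed.

Lemma wallis_0 : wallis 0 = PI / 2.
Proof.
unfold wallis; simpl; rewrite RInt_const; change (scal ?x ?y) with (x * y); ring.
Qed.

Lemma wallis_1 : wallis 1 = 1.
Proof.
assert (H : is_RInt (fun x => sin x ^ 1) 0 (PI / 2) (- cos (PI / 2) - - cos 0)).
{ apply (is_RInt_derive (V := R_CompleteNormedModule) (fun x => - cos x)).
  - intros x _; auto_derive; auto; ring.
  - intros x _; apply continuous_sin_pow. }
unfold wallis; rewrite (is_RInt_unique _ _ _ _ H), cos_PI2, cos_0; ring.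
Qed.

Lemma wallis_decr (n : nat) : wallis (S n) <= wallis n.
Proof.
assert (Hpi := PI_RGT_0).
apply RInt_le; try (apply ex_RInt_cont, continuous_sin_pow); [lra|].
intros x Hx; simpl.
assert (H1 : 0 < sin x) by (apply sin_gt_0; lra).
assert (H2 := SIN_bound x).
assert (H3 := pow_lt (sin x) n H1); nra.
Qed.

(** The central binomial coefficient divided by 4^n; its square is the coefficient of x^n in K. *)
Definition wratio (n : nat) : R := pochhammer (1 / 2) n / INR (fact n).

Lemma pochhammer_1 (n : nat) : pochhammer 1 n = INR (fact n).
Proof.
induction n as [|n IH]; [reflexivity|].
rewrite fact_simpl, mult_INR; simpl pochhammer; rewrite IH, S_INR; ring.
Qed.

Lemma wratio_pos (n : nat) : 0 < wratio n.
Proof. apply Rdiv_lt_0_compat; [apply pochhammer_pos; lra|apply INR_fact_pos]. Qed.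

Lemma hc_wratio (n : nat) : hc (1 / 2) (1 / 2) 1 n = wratio n ^ 2.
Proof.
unfold hc, wratio; rewrite pochhammer_1; generalize (INR_fact_pos n); intros; field; lra.
Qed.

Lemma wratio_S (n : nat) : wratio (S n) = (2 * INR n + 1) / (2 * INR n + 2) * wratio n.
Proof.
unfold wratio; rewrite fact_simpl, mult_INR, S_INR; simpl pochhammer.
generalize (INR_fact_pos n) (pos_INR n); intros; field; lra.
Qed.

Lemma wallis_wratio (n : nat) :
  wallis (2 * n) = PI / 2 * wratio n /\ (2 * INR n + 1) * wallis (2 * n + 1) * wratio n = 1.
Proof.
induction n as [|n [IH1 IH2]].
- simpl (2 * 0)%nat; simpl (0 + 1)%nat; rewrite wallis_0, wallis_1.
  unfold wratio; simpl; split; field.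
- replace (2 * S n)%nat with (2 * n + 2)%nat by lia.
  replace (2 * n + 2 + 1)%nat with (2 * n + 1 + 2)%nat by lia.
  assert (H1 : (2 * INR n + 2) * wallis (2 * n + 2) = (2 * INR n + 1) * wallis (2 * n)).
  { generalize (wallis_rec (2 * n)).
    replace (INR (2 * n + 2)) with (2 * INR n + 2) by (rewrite plus_INR, mult_INR; simpl; ring).
    replace (INR (2 * n + 1)) with (2 * INR n + 1) by (rewrite plus_INR, mult_INR; simpl; ring).
    auto. }
  assert (H2 : (2 * INR n + 3) * wallis (2 * n + 1 + 2) = (2 * INR n + 2) * wallis (2 * n + 1)).
  { generalize (wallis_rec (2 * n + 1)).
    replace (INR (2 * n + 1 + 2)) with (2 * INR n + 3) by (rewrite !plus_INR, mult_INR; simpl; ring).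
    replace (INR (2 * n + 1 + 1)) with (2 * INR n + 2) by (rewrite !plus_INR, mult_INR; simpl; ring).
    auto. }
  rewrite wratio_S, S_INR.
  assert (Hn := pos_INR n).
  split.
  + apply Rmult_eq_reg_l with (2 * INR n + 2); [|lra].
    rewrite H1, IH1; field; lra.
  + transitivity ((2 * INR n + 3) * wallis (2 * n + 1 + 2) * wratio n
      * (2 * INR n + 1) / (2 * INR n + 2)); [field; lra|].
    rewrite H2; transitivity ((2 * INR n + 1) * wallis (2 * n + 1) * wratio n); [field; lra|exact IH2].
Qed.

(** Wallis' squeeze W(2n + 1) <= W(2n) <= W(2n - 1), rewritten through [wratio]. Its purpose is the
    limit 1/pi of n times the coefficients of K, which fixes the constant in Legendre's relation. *)
Lemma wallis_bounds (n : nat) :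
  INR n * hc (1 / 2) (1 / 2) 1 n <= / PI /\
  2 * / PI <= (2 * INR n + 1) * hc (1 / 2) (1 / 2) 1 n.
Proof.
rewrite hc_wratio; assert (Hpi := PI_RGT_0); assert (Hn := pos_INR n).
destruct (wallis_wratio n) as [E1 E2]; assert (Hw := wratio_pos n).
split.
- destruct n as [|n].
  { simpl; assert (0 < / PI) by now apply Rinv_0_lt_compat. lra. }
  assert (D := wallis_decr (2 * n + 1)).
  replace (S (2 * n + 1)) with (2 * S n)%nat in D by lia.
  destruct (wallis_wratio n) as [_ E3].
  rewrite E1 in D; rewrite S_INR in *; rewrite wratio_S in *.
  assert (Hn' := pos_INR n); assert (Hw' := wratio_pos n).
  apply Rmult_le_reg_l with PI; auto; rewrite Rinv_r by lra.
  set (w := wratio n) in *; set (v := wallis (2 * n + 1)) in *.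
  assert (D' : PI / 2 * ((2 * INR n + 1) / (2 * INR n + 2) * w) * ((2 * INR n + 1) * w) <= 1).
  { apply Rle_trans with (v * ((2 * INR n + 1) * w)); [|lra].
    apply Rmult_le_compat_r; auto; apply Rmult_le_pos; lra. }
  replace (PI * _) with (PI / 2 * ((2 * INR n + 1) / (2 * INR n + 2) * w) * ((2 * INR n + 1) * w));
   [exact D'|field; lra].
- assert (D := wallis_decr (2 * n)).
  replace (S (2 * n)) with (2 * n + 1)%nat in D by lia.
  apply Rmult_le_reg_l with (PI / 2); [lra|].
  replace (PI / 2 * (2 * / PI)) with 1 by (field; lra).
  apply Rle_trans with ((2 * INR n + 1) * wallis (2 * n + 1) * wratio n); [lra|].
  replace (PI / 2 * _) with ((2 * INR n + 1) * (PI / 2 * wratio n) * wratio n) by ring.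
  rewrite <- E1; apply Rmult_le_compat_r; [lra|]; apply Rmult_le_compat_l; lra.
Qed.

Lemma is_lim_seq_n_hc : is_lim_seq (fun n => INR n * hc (1 / 2) (1 / 2) 1 n) (/ PI).
Proof.
apply is_lim_seq_le_le with (fun n => / PI * (1 - / 2 * / (1 / 2 + INR n))) (fun _ => / PI).
- intros n; destruct (wallis_bounds n) as [H1 H2]; split; auto.
  assert (Hn := pos_INR n).
  apply Rle_trans with (INR n / (2 * INR n + 1) * (2 * / PI)).
  + apply Req_le; generalize PI_neq0; intros; field; repeat split; auto; lra.
  + apply Rle_trans with (INR n / (2 * INR n + 1) * ((2 * INR n + 1) * hc (1 / 2) (1 / 2) 1 n)).
    * apply Rmult_le_compat_l; auto; apply Rmult_le_pos; auto; apply Rlt_le, Rinv_0_lt_compat; lra.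
    * apply Req_le; field; lra.
- replace (Finite (/ PI)) with (Finite (/ PI * (1 - / 2 * 0))) by (f_equal; ring).
  apply (is_lim_seq_scal_l _ (/ PI) (1 - / 2 * 0)).
  apply is_lim_seq_minus'; [apply is_lim_seq_const|].
  apply (is_lim_seq_scal_l _ (/ 2) 0), is_lim_seq_INR_shift.
- apply is_lim_seq_const.
Qed.

(** * Power series at the boundary of the disk *)

(** Absorbs finitely many exceptional coefficients into a convergent series independent of x. *)
Lemma geometric_majorant (u : nat -> R) (N : nat) :
  exists M, 0 <= M /\ forall n, (n <= N)%nat -> u n <= M * (1 / 2) ^ n.
Proof.
induction N as [|N [M [HM H]]].
- exists (Rabs (u O)); split; [apply Rabs_pos|].
  intros n Hn; replace n with O by lia; simpl; generalize (Rle_abs (u O)); lra.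
- set (M' := Rabs (u (S N)) * 2 ^ S N).
  assert (HM' : 0 <= M') by (apply Rmult_le_pos; [apply Rabs_pos|apply pow_le; lra]).
  exists (M + M'); split; [lra|].
  intros n Hn; rewrite Rmult_plus_distr_r.
  assert (Hp : 0 <= (1 / 2) ^ n) by (apply pow_le; lra).
  destruct (Nat.eq_dec n (S N)) as [->|Hne].
  + apply Rle_trans with (1 := Rle_abs _).
    replace (M' * (1 / 2) ^ S N) with (Rabs (u (S N))).
    * generalize (Rmult_le_pos _ _ HM Hp); lra.
    * unfold M'; rewrite Rmult_assoc, <- Rpow_mult_distr.
      replace (2 * (1 / 2)) with 1 by field; rewrite pow1; ring.
  + apply Rle_trans with (1 := H n ltac:(lia)); generalize (Rmult_le_pos _ _ HM' Hp); lra.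
Qed.

Lemma ex_series_unit_disk (a : nat -> R) (x : R) : Rbar_le 1 (CV_radius a) ->
  0 <= x < 1 -> ex_series (fun n => Rabs (a n * x ^ n)).
Proof.
intros Ha Hx; apply CV_disk_inside.
apply Rbar_lt_le_trans with (2 := Ha); rewrite Rabs_pos_eq; simpl; lra.
Qed.

Lemma PSeries_unbounded (a : nat -> R) : (forall n, 0 <= a n) ->
  Rbar_le 1 (CV_radius a) -> (forall M, exists n, M <= sum_f_R0 a n) ->
  forall M, exists d, 0 < d < 1 /\ forall x, 1 - d < x < 1 -> M <= PSeries a x.
Proof.
intros Ha HC Hs M.
destruct (Hs (2 * Rabs M)) as [N HN].
assert (HN1 : 0 < / (2 * (INR N + 1))) by (apply Rinv_0_lt_compat; generalize (pos_INR N); lra).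
assert (HN2 : / (2 * (INR N + 1)) < 1).
{ rewrite <- Rinv_1; apply Rinv_lt_contravar; generalize (pos_INR N); lra. }
exists (/ (2 * (INR N + 1))); split; [lra|].
intros x Hx.
assert (Hx0 : 0 <= x < 1) by lra.
assert (HxN : forall n, (n <= N)%nat -> 1 / 2 <= x ^ n).
{ intros n Hn.
  (* Bernoulli's inequality: the chosen distance from x to 1 makes every x^n with n <= N at least
     1/2. *)
  assert (Bern : forall n, 1 - INR n * (1 - x) <= x ^ n).
  { clear - Hx0; induction n as [|n IH]; [simpl; lra|].
    rewrite S_INR; simpl; assert (Hn := pos_INR n).
    assert (H1 := Rmult_le_compat_l x _ _ (proj1 Hx0) IH).
    assert (0 <= INR n * (1 - x) * (1 - x)) by (repeat apply Rmult_le_pos; lra).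
    lra. }
  apply Rle_trans with (2 := Bern n).
  assert (INR n <= INR N) by (apply le_INR; auto).
  assert (INR n * (1 - x) <= (INR N + 1) * / (2 * (INR N + 1))).
  { apply Rmult_le_compat; try lra; apply pos_INR. }
  replace ((INR N + 1) * / (2 * (INR N + 1))) with (1 / 2) in H0 by (field; generalize (pos_INR N); lra).
  lra. }
assert (E := ex_series_Rabs _ (ex_series_unit_disk a x HC Hx0)).
apply Rle_trans with (sum_f_R0 (fun n => a n * x ^ n) N).
- apply Rle_trans with (sum_f_R0 (fun n => a n * (1 / 2)) N).
  + rewrite <- scal_sum; generalize (Rle_abs M); lra.
  + apply sum_Rle; intros n Hn; apply Rmult_le_compat_l; auto.
- unfold PSeries; rewrite (Series_incr_n _ (S N)) by (auto; lia).
  simpl pred.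
  assert (0 <= Series (fun k => a (S N + k)%nat * x ^ (S N + k))); [|lra].
  apply Rle_trans with (Series (fun n : nat => 0 * 0)); [rewrite Series_scal_l; lra|].
  apply Series_le.
  + intros n; split; [lra|]; rewrite Rmult_0_l; apply Rmult_le_pos; auto; apply pow_le; lra.
  + apply (ex_series_incr_n (V := R_NormedModule) (fun k => a k * x ^ k)); exact E.
Qed.

(** An Abelian theorem: beyond some N the coefficients of b - L a are at most eps / 2 times those of
    a, and the earlier ones contribute a bounded amount, absorbed because the sum of a diverges at
    1. *)
Lemma PSeries_ratio (a b r : nat -> R) (L : R) : (forall n, 0 <= a n) ->
  (forall n, b n = r n * a n) -> is_lim_seq r L ->
  Rbar_le 1 (CV_radius a) -> Rbar_le 1 (CV_radius b) ->
  (forall M, exists n, M <= sum_f_R0 a n) ->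
  forall eps, 0 < eps -> exists d, 0 < d < 1 /\ forall x, 1 - d < x < 1 ->
    Rabs (PSeries b x - L * PSeries a x) <= eps * PSeries a x.
Proof.
intros Ha Hb Hr HCa HCb Hs eps Heps.
assert (He2 : 0 < eps / 2) by lra.
apply is_lim_seq_spec in Hr; destruct (Hr (mkposreal _ He2)) as [N HN]; simpl in HN.
destruct (geometric_majorant (fun n => Rabs (b n - L * a n)) N) as [M [HM HMn]].
(* The geometric majorant sums to 2M, which is eps / 2 times this bound. *)
destruct (PSeries_unbounded a Ha HCa Hs (4 * M / eps)) as [d [Hd Hx]].
exists d; split; auto; intros x Hxd; specialize (Hx x Hxd).
assert (Hx0 : 0 <= x < 1) by lra.
assert (Ea := ex_series_Rabs _ (ex_series_unit_disk a x HCa Hx0)).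
assert (Eb := ex_series_Rabs _ (ex_series_unit_disk b x HCb Hx0)).
assert (Eg : ex_series (fun n => M * (1 / 2) ^ n)).
{ apply (ex_series_scal (V := R_NormedModule)), ex_series_geom; rewrite Rabs_pos_eq; lra. }
assert (Em : ex_series (fun n => eps / 2 * (a n * x ^ n) + M * (1 / 2) ^ n)).
{ apply (ex_series_plus (V := R_NormedModule)); auto.
  now apply (ex_series_scal (V := R_NormedModule)). }
assert (Hle : forall n, Rabs (b n * x ^ n - L * (a n * x ^ n)) <= eps / 2 * (a n * x ^ n) + M * (1 / 2) ^ n).
{ intros n.
  assert (Hxn : 0 <= x ^ n <= 1) by (split; [apply pow_le; lra|rewrite <- (pow1 n); apply pow_incr; lra]).
  replace (b n * x ^ n - L * (a n * x ^ n)) with ((b n - L * a n) * x ^ n) by ring.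
  rewrite Rabs_mult, (Rabs_pos_eq (x ^ n)) by lra.
  assert (Hgn : 0 <= M * (1 / 2) ^ n) by (apply Rmult_le_pos; auto; apply pow_le; lra).
  assert (Han := Ha n).
  destruct (le_lt_dec n N) as [Hn|Hn].
  - specialize (HMn n Hn); simpl in HMn.
    assert (Rabs (b n - L * a n) * x ^ n <= M * (1 / 2) ^ n * 1).
    { apply Rmult_le_compat; try lra; apply Rabs_pos. }
    assert (0 <= eps / 2 * (a n * x ^ n)) by (apply Rmult_le_pos; [lra|apply Rmult_le_pos; lra]).
    lra.
  - rewrite Hb; replace (r n * a n - L * a n) with ((r n - L) * a n) by ring.
    rewrite Rabs_mult, (Rabs_pos_eq (a n)) by auto.
    specialize (HN n (Nat.lt_le_incl _ _ Hn)).
    assert (Rabs (r n - L) * (a n * x ^ n) <= eps / 2 * (a n * x ^ n)).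
    { apply Rmult_le_compat_r; [apply Rmult_le_pos; lra|lra]. }
    lra. }
unfold PSeries at 1 2; rewrite <- Series_scal_l, <- Series_minus; auto.
2:{ now apply (ex_series_scal (V := R_NormedModule)). }
eapply Rle_trans; [apply Series_Rabs|].
- apply (ex_series_le (V := R_CompleteNormedModule) _ _) with (2 := Em).
  intros n; change (norm ?u) with (Rabs u); rewrite Rabs_Rabsolu; apply Hle.
- eapply Rle_trans; [apply Series_le; [|exact Em]|].
  + intros n; split; [apply Rabs_pos|apply Hle].
  + rewrite Series_plus, !Series_scal_l, Series_geom; auto.
    * fold (PSeries a x).
      apply Rmult_le_compat_r with (r := eps / 2) in Hx; [|lra].
      replace (4 * M / eps * (eps / 2)) with (M * / (1 - 1 / 2)) in Hx by (field; lra).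
      lra.
    * rewrite Rabs_pos_eq; lra.
    * now apply (ex_series_scal (V := R_NormedModule)).
Qed.

(** Comparison with the telescoping sum of ln(n + 2) - ln(n + 1) <= 1/(n + 1). *)
Lemma sum_unbounded_harmonic (a : nat -> R) (c : R) : 0 < c ->
  (forall n, c <= INR (S n) * a n) -> forall M, exists n, M <= sum_f_R0 a n.
Proof.
intros Hc Ha M.
assert (H : forall n, c * ln (INR n + 2) <= sum_f_R0 a n + c * ln 1).
{ assert (Hl : forall n, c * (ln (INR n + 2) - ln (INR n + 1)) <= a n).
  { intros n; assert (Hn := pos_INR n).
    apply Rle_trans with (c * / (INR n + 1)).
    - apply Rmult_le_compat_l; [lra|].
      replace (INR n + 2) with ((INR n + 1) * (1 + / (INR n + 1))) by (field; lra).
      assert (Hi : 0 < / (INR n + 1)) by (apply Rinv_0_lt_compat; lra).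
      rewrite ln_mult by lra.
      assert (ln (1 + / (INR n + 1)) <= / (INR n + 1)); [|lra].
      rewrite <- (ln_exp (/ (INR n + 1))) at 2; apply ln_le; [lra|].
      apply exp_ineq1_le.
    - apply Rmult_le_reg_l with (INR n + 1); [lra|].
      rewrite <- S_INR; apply Rle_trans with (2 := Ha n).
      apply Req_le; field; rewrite S_INR; lra. }
  induction n as [|n IH].
  - generalize (Hl O); simpl; rewrite !Rplus_0_l; lra.
  - simpl sum_f_R0; generalize (Hl (S n)); rewrite S_INR.
    replace (INR n + 1 + 1) with (INR n + 2) by ring; lra. }
destruct (nfloor_ex (exp (Rabs M / c))) as [n [_ Hn]]; [apply Rlt_le, exp_pos|].
exists n; rewrite ln_1 in H.
apply Rle_trans with (c * ln (INR n + 2)); [|generalize (H n); lra].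
apply Rle_trans with (c * (Rabs M / c)).
- replace (c * (Rabs M / c)) with (Rabs M) by (field; lra); apply Rle_abs.
- apply Rmult_le_compat_l; [lra|].
  rewrite <- (ln_exp (Rabs M / c)); apply ln_le; [apply exp_pos|lra].
Qed.

(** * The complete elliptic integral: Landen's and Legendre's relations *)

Lemma constant_of_derive_0 (f : R -> R) (a b : R) : a <= b ->
  (forall x, a < x < b -> is_derive f x 0) ->
  (forall x, a <= x <= b -> continuity_pt f x) -> f a = f b.
Proof.
intros Hab Hd Hc.
destruct (MVT_gen f a b (fun _ => 0)) as [c [_ H]].
- rewrite Rmin_left, Rmax_right by auto; exact Hd.
- rewrite Rmin_left, Rmax_right by auto; exact Hc.
- lra.
Qed.

Definition kc : nat -> R := hc (1 / 2) (1 / 2) 1.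
(** 2/pi times the complete elliptic integral of the first kind, in the parameter x = k^2. *)
Definition K (x : R) : R := PSeries kc x.
Definition K1 (x : R) : R := PSeries (PS_derive kc) x.
(** The conjugate variable of [K]: as Phi' = K/4, the second-order equation becomes a first-order
    system, and the Wronskians of [K] are written with it. *)
Definition Phi (x : R) : R := x * (1 - x) * K1 x.

Lemma CV_radius_kc : CV_radius kc = 1.
Proof. apply CV_radius_hc; lra. Qed.

Lemma is_derive_K (x : R) : Rabs x < 1 -> is_derive K x (K1 x).
Proof. intros Hx; apply is_derive_PSeries; now rewrite CV_radius_kc. Qed.

Lemma is_derive_K1 (x : R) : Rabs x < 1 -> is_derive K1 x (PSeries (PS_derive (PS_derive kc)) x).
Proof. intros Hx; apply is_derive_PSeries; now rewrite CV_radius_derive, CV_radius_kc. Qed.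

Lemma is_derive_Phi (x : R) : Rabs x < 1 -> is_derive Phi x (K x / 4).
Proof.
intros Hx.
assert (H1 := is_derive_K1 x Hx).
assert (O := hypergeometric_ode (1 / 2) (1 / 2) 1 x).
assert (H2 : x * (1 - x) * PSeries (PS_derive (PS_derive kc)) x + (1 - (1 / 2 + 1 / 2 + 1) * x) * K1 x
  = 1 / 2 * (1 / 2) * K x).
{ apply RtoC_inj; unfold K, K1, kc; rewrite RtoC_plus, !RtoC_mult, !RtoC_minus, !RtoC_mult, !RtoC_plus, <- !cps_RtoC.
  apply O; try lra; now rewrite Cmod_R. }
unfold Phi; auto_derive.
- repeat split; eexists; exact H1.
- rewrite (is_derive_unique (fun x : R => K1 x) x _ H1).
  lra.
Qed.

Lemma K_ge_1 (x : R) : 0 <= x < 1 -> 1 <= K x.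
Proof.
intros Hx; unfold K, PSeries.
assert (E : ex_series (fun n => kc n * x ^ n)).
{ apply ex_series_Rabs, CV_disk_inside; rewrite CV_radius_kc, Rabs_pos_eq; simpl; lra. }
rewrite Series_incr_1 by exact E.
unfold kc at 1; rewrite hc_0; simpl pow at 1.
assert (0 <= Series (fun k => kc (S k) * x ^ S k)); [|lra].
apply Rle_trans with (Series (fun n : nat => 0 * 0)); [rewrite Series_scal_l; lra|].
apply Series_le.
- intros n; split; [lra|]; rewrite Rmult_0_l; apply Rmult_le_pos; [|apply pow_le; lra].
  apply Rlt_le, hc_pos; lra.
- now apply (ex_series_incr_1 (V := R_NormedModule) (fun n => kc n * x ^ n)).
Qed.

Lemma K_0 : K 0 = 1.
Proof. unfold K; rewrite PSeries_0; apply hc_0. Qed.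

Lemma landen_arg (k : R) : 0 <= k < 1 -> 0 <= 4 * k / (1 + k) ^ 2 < 1.
Proof.
intros Hk; assert (H : 0 < (1 + k) ^ 2) by (apply pow_lt; lra); split.
- apply Rmult_le_pos; [lra|now apply Rlt_le, Rinv_0_lt_compat].
- apply Rmult_lt_reg_r with ((1 + k) ^ 2); auto.
  unfold Rdiv; rewrite Rmult_assoc, Rinv_l by lra.
  assert (0 < (1 - k) ^ 2) by (apply pow_lt; lra); lra.
Qed.

(* Both sides solve the same second-order equation in [k], regular at [k = 0];
   [V] is their Wronskian, weighted so as to be constant. *)
Lemma landen_wronskian (k : R) : 0 <= k < 1 ->
  let V k := Phi (4 * k / (1 + k) ^ 2) * ((1 + k) * K (k ^ 2)) -
    (k * (1 - k) / (1 + k) * K (k ^ 2) + 2 * Phi (k ^ 2) / (1 + k)) * K (4 * k / (1 + k) ^ 2) in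
  is_derive V k 0.
Proof.
intros Hk V; unfold V; clear V.
assert (Hl := landen_arg k Hk).
assert (Hk2 : 0 <= k ^ 2 < 1) by nra.
assert (Hl' : Rabs (4 * k / (1 + k) ^ 2) < 1) by (rewrite Rabs_pos_eq; lra).
assert (Hk2' : Rabs (k ^ 2) < 1) by (rewrite Rabs_pos_eq; lra).
assert (A1 := is_derive_K _ Hl'); assert (A2 := is_derive_K _ Hk2').
assert (B1 := is_derive_Phi _ Hl'); assert (B2 := is_derive_Phi _ Hk2').
auto_derive.
- simpl in A1, A2, B1, B2. repeat split; try lra; try nra; eexists; eassumption.
- change ((1 + k) * ((1 + k) * 1)) with ((1 + k) ^ 2); change (k * (k * 1)) with (k ^ 2);
    change (4 * k * / (1 + k) ^ 2) with (4 * k / (1 + k) ^ 2).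
  rewrite (is_derive_unique (fun x : R => K x) _ _ A1), (is_derive_unique (fun x : R => K x) _ _ A2),
   (is_derive_unique (fun x : R => Phi x) _ _ B1), (is_derive_unique (fun x : R => Phi x) _ _ B2).
  unfold Phi; generalize (K (k ^ 2)) (K1 (k ^ 2)) (K (4 * k / (1 + k) ^ 2)) (K1 (4 * k / (1 + k) ^ 2)).
  intros; field; lra.
Qed.

Lemma is_derive_continuity (f : R -> R) (x l : R) : is_derive f x l -> continuity_pt f x.
Proof.
intros H; apply continuity_pt_filterlim.
apply (ex_derive_continuous (V := R_NormedModule)); now exists l.
Qed.

Lemma landen (k : R) : 0 <= k < 1 -> K (4 * k / (1 + k) ^ 2) = (1 + k) * K (k ^ 2).
Proof.
intros Hk.
set (V k := Phi (4 * k / (1 + k) ^ 2) * ((1 + k) * K (k ^ 2)) -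
    (k * (1 - k) / (1 + k) * K (k ^ 2) + 2 * Phi (k ^ 2) / (1 + k)) * K (4 * k / (1 + k) ^ 2)).
(* The Wronskian is constant and vanishes at k = 0, where [Phi] does. *)
assert (HV : forall x, 0 <= x < 1 -> V x = 0).
{ intros x Hx; transitivity (V 0).
  - symmetry; apply constant_of_derive_0; [lra| |].
    + intros y Hy; apply landen_wronskian; lra.
    + intros y Hy; apply is_derive_continuity with 0, landen_wronskian; lra.
  - unfold V, Phi; replace (4 * 0 / (1 + 0) ^ 2) with 0 by field.
    replace (0 ^ 2) with 0 by ring; field. }
set (q := fun k => K (4 * k / (1 + k) ^ 2) / ((1 + k) * K (k ^ 2))).
(* The derivative of the quotient is [V] divided by a weight that vanishes at k = 0; at that end
   only continuity is used, hence the conditional [l = 0]. *)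
assert (Hq : forall k, 0 <= k < 1 -> exists l, is_derive q k l /\ (0 < k -> l = 0)).
{ clear k Hk; intros k Hk; assert (HVk := HV k Hk); unfold V in HVk; clear V HV.
  assert (Hl := landen_arg k Hk).
  assert (Hk2 : 0 <= k ^ 2 < 1) by nra.
  assert (Hl' : Rabs (4 * k / (1 + k) ^ 2) < 1) by (rewrite Rabs_pos_eq; lra).
  assert (Hk2' : Rabs (k ^ 2) < 1) by (rewrite Rabs_pos_eq; lra).
  assert (A1 := is_derive_K _ Hl'); assert (A2 := is_derive_K _ Hk2').
  assert (P1 := K_ge_1 _ Hl); assert (P2 := K_ge_1 _ Hk2).
  eexists; split.
  - unfold q; auto_derive; [|reflexivity].
    simpl in A1, A2, P1, P2; repeat split; try (eexists; eassumption); try nra.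
  - intros Hk0.
    change ((1 + k) * ((1 + k) * 1)) with ((1 + k) ^ 2); change (k * (k * 1)) with (k ^ 2);
    change (4 * k * / (1 + k) ^ 2) with (4 * k / (1 + k) ^ 2).
    rewrite (is_derive_unique (fun x : R => K x) _ _ A1), (is_derive_unique (fun x : R => K x) _ _ A2).
    revert HVk P1 P2; unfold Phi.
    generalize (K (k ^ 2)) (K1 (k ^ 2)) (K (4 * k / (1 + k) ^ 2)) (K1 (4 * k / (1 + k) ^ 2)).
    intros a b c d HV P1 P2.
    match goal with |- ?u = 0 => replace u with
     ((4 * k / (1 + k) ^ 2 * (1 - 4 * k / (1 + k) ^ 2) * d * ((1 + k) * a) -
      (k * (1 - k) / (1 + k) * a + 2 * (k ^ 2 * (1 - k ^ 2) * b) / (1 + k)) * c) *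
      ((1 + k) / (k * (1 - k) * ((1 + k) * a) ^ 2))) by (field; repeat split; nra) end.
    rewrite HV; apply Rmult_0_l. }
assert (E : q 0 = q k).
{ apply constant_of_derive_0; [lra| |].
  - intros x Hx; destruct (Hq x) as [l [Hd Hl]]; [lra|]; rewrite Hl in Hd by lra; exact Hd.
  - intros x Hx; destruct (Hq x) as [l [Hd Hl]]; [lra|]; now apply is_derive_continuity with l. }
unfold q in E; replace (4 * 0 / (1 + 0) ^ 2) with 0 in E by field.
replace (0 ^ 2) with 0 in E by ring; rewrite K_0 in E.
assert (Hk2 : 0 <= k ^ 2 < 1) by nra; assert (P2 := K_ge_1 _ Hk2).
apply Rmult_eq_reg_r with (/ ((1 + k) * K (k ^ 2))).
- rewrite Rinv_r; [|nra]. 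
  change (K (4 * k / (1 + k) ^ 2) / ((1 + k) * K (k ^ 2)) = 1); rewrite <- E; field.
- apply Rinv_neq_0_compat; nra.
Qed.

Lemma sum_ones_unbounded : forall M, exists n, M <= sum_f_R0 (fun _ => 1) n.
Proof.
intros M; destruct (nfloor_ex (Rabs M)) as [n [_ Hn]]; [apply Rabs_pos|].
exists n; rewrite sum_cte, S_INR; generalize (Rle_abs M); lra.
Qed.

Lemma PSeries_1 (x : R) : 0 <= x < 1 -> PSeries (fun _ => 1) x = / (1 - x).
Proof.
intros Hx; unfold PSeries; rewrite (Series_ext _ (fun n => x ^ n)) by (intros; ring).
apply Series_geom; rewrite Rabs_pos_eq; lra.
Qed.

(** The Abelian comparison with the geometric series, whose value at 1 - x is 1/x. *)
Lemma limit_at_1 (b : nat -> R) (L : R) : is_lim_seq b L -> Rbar_le 1 (CV_radius b) ->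
  forall eps, 0 < eps -> exists d, 0 < d < 1 /\ forall x, 0 < x < d ->
    Rabs (x * PSeries b (1 - x) - L) <= eps.
Proof.
intros Hb HC eps Heps.
destruct (PSeries_ratio (fun _ => 1) b b L) with (eps := eps) as [d [Hd H]]; auto.
- intros; lra.
- intros; ring.
- rewrite CV_radius_one; apply Rbar_le_refl.
- apply sum_ones_unbounded.
- exists d; split; auto; intros x Hx.
  specialize (H (1 - x) ltac:(lra)); rewrite PSeries_1 in H by lra.
  replace (1 - (1 - x)) with x in H by ring.
  replace (x * PSeries b (1 - x) - L) with (x * (PSeries b (1 - x) - L * / x)) by (field; lra).
  rewrite Rabs_mult, (Rabs_pos_eq x) by lra.
  apply Rle_trans with (x * (eps * / x)); [apply Rmult_le_compat_l; lra|].
  apply Req_le; field; lra.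
Qed.

Lemma limit_at_1_seq (b y : nat -> R) (L : R) :
  is_lim_seq b L -> Rbar_le 1 (CV_radius b) ->
  (forall n, 0 < y n < 1) -> is_lim_seq y 0 ->
  is_lim_seq (fun n => y n * PSeries b (1 - y n)) L.
Proof.
intros Hb HC Hy Hy0; apply is_lim_seq_spec; intros eps.
destruct (limit_at_1 b L Hb HC (eps / 2)) as [d [Hd H]]; [generalize (cond_pos eps); lra|].
apply is_lim_seq_spec in Hy0; destruct (Hy0 (mkposreal d (proj1 Hd))) as [N HN].
exists N; intros n Hn; specialize (HN n Hn); simpl in HN.
rewrite Rminus_0_r, Rabs_pos_eq in HN by (generalize (Hy n); lra).
apply Rle_lt_trans with (1 := H (y n) (conj (proj1 (Hy n)) HN)).
generalize (cond_pos eps); lra.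
Qed.

Lemma is_lim_seq_kc_derive : is_lim_seq (PS_derive kc) (/ PI).
Proof. apply (is_lim_seq_incr_1 (fun n => INR n * kc n)), is_lim_seq_n_hc. Qed.

Lemma is_lim_seq_kc : is_lim_seq kc 0.
Proof.
apply is_lim_seq_incr_1.
apply is_lim_seq_ext with (fun n => PS_derive kc n * / (1 + INR n)).
- intros n; unfold PS_derive; rewrite S_INR; field; generalize (pos_INR n); lra.
- replace (Finite 0) with (Finite (/ PI * 0)) by (f_equal; ring).
  apply is_lim_seq_mult'; [apply is_lim_seq_kc_derive|apply is_lim_seq_INR_shift].
Qed.

(* The left-hand side is the weighted Wronskian of [K x] and [K (1 - x)]; Wallis'
   product gives its limit as [x] tends to 0. *)
Lemma legendre (x : R) : 0 < x < 1 ->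
  K (1 - x) * Phi x + K x * Phi (1 - x) = / PI.
Proof.
intros Hx.
set (W x := K (1 - x) * Phi x + K x * Phi (1 - x)).
assert (HW : forall x, 0 < x < 1 -> is_derive W x 0).
{ clear x Hx; intros x Hx.
  assert (Hx1 : Rabs x < 1) by (rewrite Rabs_pos_eq; lra).
  assert (Hx2 : Rabs (1 - x) < 1) by (rewrite Rabs_pos_eq; lra).
  assert (A1 := is_derive_K _ Hx1); assert (A2 := is_derive_K _ Hx2).
  assert (B1 := is_derive_Phi _ Hx1); assert (B2 := is_derive_Phi _ Hx2).
  unfold W; auto_derive; [repeat split; eexists; eassumption|].
  change (1 + - x) with (1 - x).
  rewrite (is_derive_unique (fun x : R => K x) _ _ A1), (is_derive_unique (fun x : R => K x) _ _ A2),
   (is_derive_unique (fun x : R => Phi x) _ _ B1), (is_derive_unique (fun x : R => Phi x) _ _ B2).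
  unfold Phi; field. }
assert (Hc : forall y, 0 < y < 1 -> W y = W x).
{ intros y Hy; destruct (Rle_lt_dec x y).
  - symmetry; apply constant_of_derive_0; auto.
    + intros z Hz; apply HW; lra.
    + intros z Hz; apply is_derive_continuity with 0, HW; lra.
  - apply constant_of_derive_0; [lra| |].
    + intros z Hz; apply HW; lra.
    + intros z Hz; apply is_derive_continuity with 0, HW; lra. }
change (W x = / PI).
set (y n := / (2 + INR n)).
assert (Hy : forall n, 0 < y n < 1).
{ intros n; assert (Hn := pos_INR n); split; [apply Rinv_0_lt_compat; lra|].
  unfold y; rewrite <- Rinv_1; apply Rinv_lt_contravar; lra. }
assert (Hy0 : is_lim_seq y 0) by apply is_lim_seq_INR_shift.
assert (HK : is_lim_seq (fun n => K (y n)) (K 0)).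
{ apply is_lim_seq_continuous; auto; apply is_derive_continuity with (K1 0), is_derive_K.
  rewrite Rabs_R0; lra. }
assert (HK1 : is_lim_seq (fun n => K1 (y n)) (K1 0)).
{ apply is_lim_seq_continuous; auto.
  eapply is_derive_continuity, is_derive_K1; rewrite Rabs_R0; lra. }
assert (HA : is_lim_seq (fun n => y n * K (1 - y n)) 0).
{ apply limit_at_1_seq; auto; [apply is_lim_seq_kc|rewrite CV_radius_kc; apply Rbar_le_refl]. }
assert (HB : is_lim_seq (fun n => y n * K1 (1 - y n)) (/ PI)).
{ apply limit_at_1_seq; auto; [apply is_lim_seq_kc_derive|rewrite CV_radius_derive, CV_radius_kc; apply Rbar_le_refl]. }
assert (HC : is_lim_seq (fun n => 1 - y n) 1).
{ replace (Finite 1) with (Finite (1 - 0)) by (f_equal; ring).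
  apply is_lim_seq_minus'; auto; apply is_lim_seq_const. }
assert (L : is_lim_seq (fun n => (y n * K (1 - y n)) * ((1 - y n) * K1 (y n)) +
   (K (y n) * (1 - y n)) * (y n * K1 (1 - y n))) (0 * (1 * K1 0) + (K 0 * 1) * / PI)).
{ apply is_lim_seq_plus'; repeat (apply is_lim_seq_mult'; auto). }
apply is_lim_seq_ext with (v := fun _ => W x) in L.
- apply is_lim_seq_unique in L; rewrite Lim_seq_const in L; injection L as ->.
  rewrite K_0; ring.
- intros n; rewrite <- (Hc (y n)) by auto; unfold W, Phi; ring.
Qed.

Lemma PSeries_le (a : nat -> R) (x y : R) : (forall n, 0 <= a n) ->
  Rbar_le 1 (CV_radius a) -> 0 <= x <= y -> y < 1 -> 0 <= PSeries a x <= PSeries a y.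
Proof.
intros Ha HC Hxy Hy.
assert (H : forall z, 0 <= z <= y -> 0 <= PSeries a z <= PSeries a y).
{ intros z Hz.
  assert (E := fun u H => ex_series_Rabs _ (ex_series_unit_disk a u HC H)).
  split.
  - apply Rle_trans with (Series (fun n : nat => 0 * 0)); [rewrite Series_scal_l; lra|].
    apply Series_le; [|apply E; lra].
    intros n; split; [lra|]; rewrite Rmult_0_l; apply Rmult_le_pos; auto; apply pow_le; lra.
  - apply Series_le; [|apply E; lra].
    intros n; split; [apply Rmult_le_pos; auto; apply pow_le; lra|].
    apply Rmult_le_compat_l; auto; apply pow_incr; lra. }
apply H; lra.
Qed.

Lemma kc_nonneg (n : nat) : 0 <= kc n.
Proof. apply Rlt_le, hc_pos; lra. Qed.

Lemma PS_derive_kc_nonneg (n : nat) : 0 <= PS_derive kc n.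
Proof. apply Rmult_le_pos; [apply pos_INR|apply kc_nonneg]. Qed.

Lemma K_bound (x : R) : 0 <= x <= 1 / 2 -> 0 <= K x <= K (1 / 2).
Proof.
intros Hx; apply PSeries_le; try lra; [apply kc_nonneg|rewrite CV_radius_kc; apply Rbar_le_refl].
Qed.

Lemma K1_bound (x : R) : 0 <= x <= 1 / 2 -> 0 <= K1 x <= K1 (1 / 2).
Proof.
intros Hx; apply PSeries_le; try lra; [apply PS_derive_kc_nonneg|].
rewrite CV_radius_derive, CV_radius_kc; apply Rbar_le_refl.
Qed.

(** * Asymptotics of the nome at the cusp *)

Definition rho (x : R) : R := K (1 - x) / K x.
(** The logarithm of exp(- pi rho)/x. It extends continuously to x = 0, with value - ln 16. *)
Definition lognome (x : R) : R := - PI * rho x - ln x.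

Lemma lipschitz_of_derive (f df : R -> R) (a b M : R) : 
  (forall z, a < z <= b -> is_derive f z (df z) /\ Rabs (df z) <= M) ->
  forall x y, a < x <= b -> a < y <= b -> Rabs (f x - f y) <= M * Rabs (x - y).
Proof.
intros H x y Hx Hy.
destruct (MVT_gen f y x df) as [c [Hc E]].
- intros z Hz; apply H.
  generalize (Rmin_l y x) (Rmin_r y x) (Rmax_lub _ _ _ (proj2 Hy) (proj2 Hx)).
  generalize (Rmin_glb_lt _ _ _ (proj1 Hy) (proj1 Hx)); lra.
- intros z Hz; apply is_derive_continuity with (df z), H.
  generalize (Rmin_glb_lt _ _ _ (proj1 Hy) (proj1 Hx)) (Rmax_lub _ _ _ (proj2 Hy) (proj2 Hx)); lra.
- rewrite E, Rabs_mult; apply Rmult_le_compat_r; [apply Rabs_pos|]; apply H.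
  generalize (Rmin_glb_lt _ _ _ (proj1 Hy) (proj1 Hx)) (Rmax_lub _ _ _ (proj2 Hy) (proj2 Hx)); lra.
Qed.

Lemma is_derive_rho (x : R) : 0 < x < 1 ->
  is_derive rho x (- / PI / (x * (1 - x) * K x ^ 2)).
Proof.
intros Hx.
assert (Hx1 : Rabs x < 1) by (rewrite Rabs_pos_eq; lra).
assert (Hx2 : Rabs (1 - x) < 1) by (rewrite Rabs_pos_eq; lra).
assert (A1 := is_derive_K _ Hx1); assert (A2 := is_derive_K _ Hx2).
assert (P := K_ge_1 x ltac:(lra)).
unfold rho; auto_derive; [repeat split; try (eexists; eassumption); lra|].
change (1 + - x) with (1 - x).
rewrite (is_derive_unique (fun x : R => K x) _ _ A1), (is_derive_unique (fun x : R => K x) _ _ A2).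
rewrite <- (legendre x Hx); unfold Phi.
replace (1 - (1 - x)) with x by ring.
field; repeat split; lra.
Qed.

(** The derivative is (1 - (1 - x) K^2) / (x (1 - x) K^2), whose numerator vanishes at x = 0, so it
    stays bounded. This gives [lognome] a limit at 0 but does not tell its value. *)
Lemma lognome_lipschitz : exists M, 0 <= M /\ forall x y, 0 < x <= 1 / 2 -> 0 < y <= 1 / 2 ->
  Rabs (lognome x - lognome y) <= M * Rabs (x - y).
Proof.
set (A := K (1 / 2)); set (B := K1 (1 / 2)).
assert (HA : 1 <= A) by (apply K_ge_1; lra).
assert (HB : 0 <= B) by (apply (K1_bound (1 / 2)); lra).
(* A bound for the derivative of (1 - x) K^2 on [0, 1/2]; the factor 2 in the Lipschitz constant
   comes from (1 - x) K^2 >= 1/2. *)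
set (M0 := A ^ 2 + 2 * A * B).
assert (HM0 : 0 <= M0) by (unfold M0; nra).
exists (2 * M0); split; [lra|].
assert (Hg : forall x, 0 < x <= 1 / 2 -> Rabs (1 - (1 - x) * K x ^ 2) <= M0 * x).
{ intros x Hx.
  destruct (MVT_gen (fun x => (1 - x) * K x ^ 2) 0 x
    (fun x => - K x ^ 2 + 2 * (1 - x) * K x * K1 x)) as [c [Hc E]].
  - rewrite Rmin_left, Rmax_right by lra; intros z Hz.
    assert (D := is_derive_K z ltac:(rewrite Rabs_pos_eq; lra)).
    auto_derive; [eexists; exact D|].
    rewrite (is_derive_unique (fun x : R => K x) _ _ D); ring.
  - rewrite Rmin_left, Rmax_right by lra; intros z Hz.
    assert (D := is_derive_K z ltac:(rewrite Rabs_pos_eq; lra)).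
    eapply is_derive_continuity; auto_derive; [eexists; exact D|reflexivity].
  - rewrite Rmin_left, Rmax_right in Hc by lra.
    rewrite K_0 in E.
    replace (1 - (1 - x) * K x ^ 2) with (- ((1 - x) * K x ^ 2 - (1 - 0) * 1 ^ 2)) by ring.
    rewrite E, Rabs_Ropp, Rminus_0_r, Rabs_mult, (Rabs_pos_eq x) by lra.
    apply Rmult_le_compat_r; [lra|].
    assert (C1 := K_bound c ltac:(lra)); assert (C2 := K1_bound c ltac:(lra)).
    fold A in C1; fold B in C2; unfold M0.
    assert (0 <= K c * K1 c <= A * B).
    { split; [apply Rmult_le_pos; lra|apply Rmult_le_compat; lra]. }
    assert (0 <= K c ^ 2 <= A ^ 2) by (split; [apply pow_le; lra|apply pow_incr; lra]).
    assert (0 <= (1 - c) * (K c * K1 c) <= 1 * (A * B)).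
    { split; [apply Rmult_le_pos; lra|apply Rmult_le_compat; lra]. }
    apply Rabs_le; lra. }
apply (lipschitz_of_derive lognome (fun x => (1 - (1 - x) * K x ^ 2) / (x * (1 - x) * K x ^ 2)) 0 (1 / 2)).
intros x Hx.
assert (P := K_ge_1 x ltac:(lra)).
assert (P2 : 1 <= K x ^ 2) by (rewrite <- (pow1 2); apply pow_incr; lra).
split.
- assert (D := is_derive_rho x ltac:(lra)).
  unfold lognome; auto_derive; [repeat split; [eexists; exact D|lra]|].
  rewrite (is_derive_unique (fun x : R => rho x) _ _ D).
  generalize PI_neq0; intros; field; repeat split; lra.
- assert (Hp : 1 / 2 <= (1 - x) * K x ^ 2) by nra.
  unfold Rdiv; rewrite Rabs_mult, Rabs_inv.
  rewrite (Rabs_pos_eq (x * (1 - x) * K x ^ 2)) by (rewrite Rmult_assoc; apply Rmult_le_pos; lra).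
  apply Rmult_le_reg_r with (x * (1 - x) * K x ^ 2); [rewrite Rmult_assoc; apply Rmult_lt_0_compat; lra|].
  rewrite Rmult_assoc, Rinv_l, Rmult_1_r.
  + apply Rle_trans with (1 := Hg x Hx).
    replace (2 * M0 * (x * (1 - x) * K x ^ 2)) with (M0 * (2 * x * ((1 - x) * K x ^ 2))) by ring.
    apply Rmult_le_compat_l; auto; nra.
  + rewrite Rmult_assoc; apply Rgt_not_eq, Rmult_lt_0_compat; lra.
Qed.

(** Landen's relation is used at k and at m = (1 - k)/(1 + k), whose two arguments m^2 and 4m/(1 +
    m)^2 are the complements of those of k. For the nome: passing from 4k/(1 + k)^2 to k^2 squares
    it. *)
Lemma rho_landen (k : R) : 0 < k < 1 -> rho (k ^ 2) = 2 * rho (4 * k / (1 + k) ^ 2).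
Proof.
intros Hk.
assert (L1 := landen k ltac:(lra)).
set (m := (1 - k) / (1 + k)).
assert (Hm : 0 < m < 1).
{ unfold m; split; [apply Rdiv_lt_0_compat; lra|].
  apply Rmult_lt_reg_r with (1 + k); [lra|]. unfold Rdiv; rewrite Rmult_assoc, Rinv_l; lra. }
assert (L2 := landen m ltac:(lra)).
replace (4 * m / (1 + m) ^ 2) with (1 - k ^ 2) in L2 by (unfold m; field; lra).
replace (m ^ 2) with (1 - 4 * k / (1 + k) ^ 2) in L2 by (unfold m; field; lra).
replace (1 + m) with (2 / (1 + k)) in L2 by (unfold m; field; lra).
assert (P := K_ge_1 (k ^ 2) ltac:(nra)).
unfold rho; rewrite L1, L2; field; lra.
Qed.

(** Since Landen squares the nome, l(k^2) = 2 l(x) + ln 16 - 4 ln(1 + k) for l = [lognome] and x =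
    4k/(1 + k)^2. Both arguments tend to 0 together, so the limit satisfies L = 2L + ln 16; the
    Lipschitz bound makes this quantitative. *)
Lemma lognome_limit : exists M, 0 <= M /\ forall x, 0 < x <= 1 / 2 ->
  Rabs (lognome x + ln 16) <= M * x.
Proof.
destruct lognome_lipschitz as [M [HM H]].
exists (M + 4); split; [lra|]; intros x Hx.
set (s := sqrt (1 - x)); assert (Hs2 : s * s = 1 - x) by (apply sqrt_sqrt; lra).
assert (Hs : 0 < s) by (apply sqrt_lt_R0; lra).
assert (Hs1 : s < 1) by nra.
(* The inverse of x = 4k/(1 + k)^2. *)
set (k := (1 - s) / (1 + s)).
assert (Hk : 0 < k < 1).
{ unfold k; split; [apply Rdiv_lt_0_compat; lra|].
  apply Rmult_lt_reg_r with (1 + s); [lra|]. unfold Rdiv; rewrite Rmult_assoc, Rinv_l; lra. }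
assert (Hkx : 4 * k / (1 + k) ^ 2 = x).
{ replace x with (1 - s * s) by lra; unfold k; field; lra. }
assert (Hk4 : k <= x).
{ rewrite <- Hkx; apply Rmult_le_reg_r with ((1 + k) ^ 2); [apply pow_lt; lra|].
  unfold Rdiv; rewrite Rmult_assoc, Rinv_l by (apply pow_nonzero; lra); nra. }
assert (R := rho_landen k Hk); rewrite Hkx in R.
assert (E : lognome x + ln 16 = (lognome (k ^ 2) - lognome x) + 4 * ln (1 + k)).
{ unfold lognome; rewrite R.
  assert (El : ln x = ln 4 + ln k - (ln (1 + k) + ln (1 + k))).
  { rewrite <- !ln_mult, <- ln_div by nra; f_equal; rewrite <- Hkx; field; lra. }
  replace (ln (k ^ 2)) with (ln k + ln k) by (rewrite <- ln_mult by lra; f_equal; ring).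
  replace (ln 16) with (ln 4 + ln 4) by (rewrite <- ln_mult by lra; f_equal; ring).
  rewrite El; ring. }
rewrite E; apply Rle_trans with (1 := Rabs_triang _ _).
assert (Hk2 : 0 < k ^ 2 <= k) by nra.
apply Rle_trans with (M * Rabs (k ^ 2 - x) + 4 * k).
- apply Rplus_le_compat; [apply H; lra|].
  assert (0 < ln (1 + k)) by (rewrite <- ln_1; apply ln_increasing; lra).
  rewrite Rabs_pos_eq by lra.
  apply Rmult_le_compat_l; [lra|].
  rewrite <- (ln_exp k) at 2; apply ln_le; [lra|apply exp_ineq1_le].
- rewrite Rmult_plus_distr_r; apply Rplus_le_compat; [|lra].
  apply Rmult_le_compat_l; auto; apply Rabs_le; lra.
Qed.

Lemma exp_minus_1_le (x X : R) : Rabs x <= X -> Rabs (exp x - 1) <= exp X * Rabs x.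
Proof.
intros H.
assert (HX : 1 <= exp X) by (apply Rle_trans with (2 := exp_ineq1_le X); generalize (Rabs_pos x); lra).
destruct (Rle_lt_dec 0 x) as [Hx|Hx].
- rewrite (Rabs_pos_eq x) in * by auto.
  assert (E1 : exp x <= exp X) by (destruct H as [H| ->]; [now apply Rlt_le, exp_increasing|lra]).
  assert (E2 := exp_ineq1_le (- x)).
  assert (E3 : exp x * exp (- x) = 1) by (rewrite <- exp_plus, Rplus_opp_r; apply exp_0).
  assert (E4 := exp_pos x); assert (E5 := exp_ineq1_le x).
  rewrite Rabs_pos_eq by lra.
  apply Rle_trans with (exp x * x); [nra|apply Rmult_le_compat_r; auto].
- rewrite (Rabs_left x) in * by auto.
  assert (E5 := exp_ineq1_le x).
  assert (exp x < 1) by (rewrite <- exp_0; now apply exp_increasing).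
  rewrite Rabs_left by lra; nra.
Qed.

Lemma nome_asymptotic : exists M, 0 <= M /\ forall x, 0 < x <= 1 / 2 ->
  Rabs (exp (- PI * rho x) - x / 16) <= M * x ^ 2.
Proof.
destruct lognome_limit as [M [HM H]].
exists (exp M * M / 16); split.
{ apply Rmult_le_pos; [|lra]; apply Rmult_le_pos; auto; apply Rlt_le, exp_pos. }
intros x Hx; specialize (H x Hx).
replace (- PI * rho x) with ((lognome x + ln 16) + ln x + - ln 16) by (unfold lognome; ring).
set (u := lognome x + ln 16) in *.
rewrite !exp_plus, exp_Ropp, !exp_ln by lra.
replace (exp u * x * / 16 - x / 16) with (x / 16 * (exp u - 1)) by field.
rewrite Rabs_mult, (Rabs_pos_eq (x / 16)) by lra.
apply Rle_trans with (x / 16 * (exp M * (M * x))); [|apply Req_le; field].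
apply Rmult_le_compat_l; [lra|].
apply Rle_trans with (exp M * Rabs u).
- apply exp_minus_1_le; nra.
- apply Rmult_le_compat_l; [apply Rlt_le, exp_pos|auto].
Qed.

(** * Quotients of Gamma values *)

Notation is_RInt_0_infty f l := (is_RInt_gen f (at_right 0) (Rbar_locally p_infty) l).

Lemma filter_prod_0_infty (P : R * R -> Prop) :
  (forall a b, 0 < a -> a <= b -> P (a, b)) ->
  filter_prod (at_right 0) (Rbar_locally p_infty) P.
Proof.
intros H; apply Filter_prod with (fun a => 0 < a < 1) (fun b => 1 < b).
- exists (mkposreal 1 Rlt_0_1); intros y Hy Hy0; split; auto.
  unfold ball in Hy; simpl in Hy; unfold AbsRing_ball, abs, minus, plus, opp in Hy; simpl in Hy.
  rewrite Ropp_0, Rplus_0_r, Rabs_pos_eq in Hy by lra; auto.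
- now exists 1.
- intros a b Ha Hb; apply H; lra.
Qed.

Lemma is_RInt_0_infty_derive (F f : R -> R) (la lb : R) :
  (forall x, 0 < x -> is_derive F x (f x)) -> (forall x, 0 < x -> continuous f x) ->
  filterlim F (at_right 0) (locally la) -> filterlim F (Rbar_locally p_infty) (locally lb) ->
  is_RInt_0_infty f (lb - la).
Proof.
intros HF Hf Ha Hb.
apply is_RInt_gen_ext with (Derive F); try apply filter_filter.
- apply filter_prod_0_infty; intros a b H1 H2 x Hx.
  apply is_derive_unique, HF; simpl in Hx; rewrite Rmin_left in Hx; lra.
- apply is_RInt_gen_Derive; auto; try apply filter_filter.
  + apply filter_prod_0_infty; intros a b H1 H2 x Hx.
    exists (f x); apply HF; simpl in Hx; rewrite Rmin_left in Hx; lra.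
  + apply filter_prod_0_infty; intros a b H1 H2 x Hx.
    simpl in Hx; rewrite Rmin_left in Hx by lra.
    assert (Hx0 : 0 < x) by lra.
    apply continuous_ext_loc with f; [|now apply Hf].
    exists (mkposreal x Hx0); intros y Hy.
    symmetry; apply is_derive_unique, HF.
    unfold ball in Hy; simpl in Hy; unfold AbsRing_ball, abs, minus, plus, opp in Hy; simpl in Hy.
    apply Rabs_def2 in Hy; lra.
Qed.

Lemma is_RInt_0_infty_le (f g : R -> R) (lf lg : R) :
  (forall x, 0 < x -> f x <= g x) -> is_RInt_0_infty f lf -> is_RInt_0_infty g lg -> lf <= lg.
Proof.
intros H Hf Hg.
assert (Hd := is_RInt_gen_minus (V := R_NormedModule) _ _ _ _ Hg Hf).
assert (Hz := is_RInt_gen_minus (V := R_NormedModule) _ _ _ _ Hf Hf).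
(* Monotonicity is extracted from the norm inequality for f - f, which g - f dominates. *)
assert (N := RInt_gen_norm (V := R_CompleteNormedModule) (Fa := at_right 0) (Fb := Rbar_locally p_infty)
  (fun y => minus (f y) (f y)) (fun y => minus (g y) (f y)) (minus lf lf) (minus lg lf)).
assert (E : norm (minus lf lf) <= minus lg lf).
{ apply N; auto.
  - apply filter_prod_0_infty; intros a b _ Hab; exact Hab.
  - apply filter_prod_0_infty; intros a b Ha Hab x Hx; simpl in Hx.
    specialize (H x ltac:(lra)).
    change (Rabs (f x - f x) <= g x - f x); rewrite Rminus_diag, Rabs_R0; lra. }
change (Rabs (lf - lf) <= lg - lf) in E; rewrite Rminus_diag, Rabs_R0 in E; lra.
Qed.

Lemma monotone_limit (f : R -> R) (M : R) :
  (forall x y, 1 <= x <= y -> f x <= f y) -> (forall x, 1 <= x -> f x <= M) ->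
  exists l, filterlim f (Rbar_locally p_infty) (locally l).
Proof.
intros Hm HM.
destruct (completeness (fun v => exists x, 1 <= x /\ v = f x)) as [l [Hl1 Hl2]].
- exists M; intros v [x [Hx ->]]; auto.
- exists (f 1), 1; split; [lra|auto].
- exists l; apply filterlim_locally; intros eps.
  assert (E : exists x, 1 <= x /\ l - eps < f x).
  { apply Classical_Prop.NNPP; intros HN.
    assert (B : l <= l - eps); [|generalize (cond_pos eps); lra].
    apply Hl2; intros v [x [Hx ->]].
    apply Rnot_lt_le; intros Hlt; apply HN; exists x; split; auto. }
  destruct E as [x [Hx Hlx]]; exists x; intros y Hy.
  change (Rabs (f y - l) < eps).
  assert (f x <= f y) by (apply Hm; lra).
  assert (f y <= l) by (apply Hl1; exists y; split; [lra|auto]).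
  rewrite Rabs_left1; lra.
Qed.

Lemma filterlim_exp_decay (c k : R) : 0 < c ->
  filterlim (fun x => k * exp (- c * x)) (Rbar_locally p_infty) (locally 0).
Proof.
intros Hc; apply filterlim_locally; intros eps.
set (Y := ln ((Rabs k + 1) / eps) / c).
exists Y; intros x Hx; change (Rabs (k * exp (- c * x) - 0) < eps).
assert (He := cond_pos eps); assert (Hk := Rabs_pos k).
rewrite Rminus_0_r, Rabs_mult, (Rabs_pos_eq (exp _)) by apply Rlt_le, exp_pos.
assert (E : exp (- c * x) < eps / (Rabs k + 1)).
{ rewrite <- (exp_ln (eps / (Rabs k + 1))) by (apply Rdiv_lt_0_compat; lra).
  apply exp_increasing.
  replace (eps / (Rabs k + 1)) with (/ ((Rabs k + 1) / eps)) by (field; lra).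
  rewrite ln_Rinv by (apply Rdiv_lt_0_compat; lra).
  unfold Y in Hx; apply Rmult_lt_compat_l with (r := c) in Hx; auto.
  replace (c * (ln ((Rabs k + 1) / eps) / c)) with (ln ((Rabs k + 1) / eps)) in Hx by (field; lra).
  lra. }
apply Rle_lt_trans with ((Rabs k) * (eps / (Rabs k + 1))).
- apply Rmult_le_compat_l; lra.
- apply Rlt_le_trans with ((Rabs k + 1) * (eps / (Rabs k + 1))).
  + apply Rmult_lt_compat_r; [apply Rdiv_lt_0_compat; lra|lra].
  + apply Req_le; field; lra.
Qed.

Definition gint (s x : R) : R := Rpower x (s - 1) * exp (- x).

Lemma continuous_gint (s x : R) : 0 < x -> continuous (gint s) x.
Proof.
intros Hx; apply (ex_derive_continuous (V := R_NormedModule)).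
unfold gint, Rpower; auto_derive; auto.
Qed.

(** ln u <= u at u = x/(2s) gives x^s exp(- x/2) <= (2s)^s. *)
Lemma Rpower_exp_bound (s x : R) : 0 < s -> 0 < x ->
  Rpower x s * exp (- x) <= exp (s * ln (2 * s)) * exp (- (1 / 2) * x).
Proof.
intros Hs Hx; unfold Rpower; rewrite <- !exp_plus.
assert (E : s * ln x + - x <= s * ln (2 * s) + - (1 / 2) * x).
{ assert (L : ln (x / (2 * s)) <= x / (2 * s)).
  { rewrite <- (ln_exp (x / (2 * s))) at 2; apply ln_le; [apply Rdiv_lt_0_compat; lra|].
    apply Rle_trans with (2 := exp_ineq1_le _); lra. }
  rewrite ln_div in L by lra.
  apply Rmult_le_compat_l with (r := s) in L; [|lra].
  replace (s * (x / (2 * s))) with (x / 2) in L by (field; lra); lra. }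
destruct E as [E| ->]; [apply Rlt_le, exp_increasing; exact E|lra].
Qed.

Lemma filterlim_squeeze_0 (F : (R -> Prop) -> Prop) (FF : Filter F) (f g : R -> R) :
  F (fun x => 0 <= f x <= g x) -> filterlim g F (locally 0) -> filterlim f F (locally 0).
Proof.
intros H Hg; apply filterlim_locally; intros eps.
apply filterlim_locally with (eps := eps) in Hg.
generalize (filter_and _ _ H Hg); apply filter_imp; intros x [Hx Hgx].
change (Rabs (g x - 0) < eps) in Hgx; change (Rabs (f x - 0) < eps).
rewrite Rminus_0_r in *; rewrite Rabs_pos_eq in * by lra; lra.
Qed.

Lemma at_right_0_pos (P : R -> Prop) : (forall x, 0 < x -> P x) -> at_right 0 P.
Proof. intros H; exists (mkposreal 1 Rlt_0_1); auto. Qed.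

Lemma filterlim_Rpower_exp_infty (s : R) : 0 < s ->
  filterlim (fun x => Rpower x s * exp (- x)) (Rbar_locally p_infty) (locally 0).
Proof.
intros Hs; eapply filterlim_squeeze_0; [apply filter_filter| |].
2: apply (filterlim_exp_decay (1 / 2) (exp (s * ln (2 * s)))); lra.
exists 0; intros x Hx; split; [|now apply Rpower_exp_bound].
apply Rmult_le_pos; apply Rlt_le, exp_pos.
Qed.

Lemma filterlim_Rpower_exp_0 (s : R) : 0 < s ->
  filterlim (fun x => Rpower x s * exp (- x)) (at_right 0) (locally 0).
Proof.
intros Hs; apply (filterlim_squeeze_0 _ _ _ (fun x => Rpower x s)).
- apply at_right_0_pos; intros x Hx; split.
  + apply Rmult_le_pos; apply Rlt_le, exp_pos.
  + rewrite <- (Rmult_1_r (Rpower x s)) at 2; apply Rmult_le_compat_l; [apply Rlt_le, exp_pos|].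
    rewrite <- exp_0; apply Rlt_le, exp_increasing; lra.
- apply filterlim_locally; intros eps.
  exists (mkposreal (Rpower eps (/ s)) (exp_pos _)); intros y Hy Hy0.
  change (Rabs (y - 0) < Rpower eps (/ s)) in Hy; change (Rabs (Rpower y s - 0) < eps).
  rewrite Rminus_0_r, Rabs_pos_eq in * by (try apply Rlt_le, exp_pos; lra).
  replace (pos eps) with (Rpower (Rpower eps (/ s)) s).
  + now apply Rlt_Rpower_l.
  + rewrite Rpower_mult, Rinv_l by lra; apply Rpower_1, cond_pos.
Qed.

Lemma is_derive_Rpower_exp (s x : R) : 0 < x ->
  is_derive (fun x => Rpower x s * exp (- x)) x (s * gint s x - gint (s + 1) x).
Proof.
intros Hx; unfold gint, Rpower; auto_derive; auto.
replace ((s - 1) * ln x) with (s * ln x + - ln x) by ring.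
rewrite exp_plus, (exp_Ropp (ln x)), exp_ln by auto.
replace ((s + 1 - 1) * ln x) with (s * ln x) by ring; field; lra.
Qed.

Lemma is_RInt_gint_parts (s : R) : 0 < s ->
  is_RInt_0_infty (fun x => s * gint s x - gint (s + 1) x) 0.
Proof.
intros Hs; replace 0 with (0 - 0) at 2 by ring.
apply is_RInt_0_infty_derive with (fun x => Rpower x s * exp (- x)).
- intros x Hx; now apply is_derive_Rpower_exp.
- intros x Hx; apply (continuous_minus (V := R_NormedModule)).
  + apply (continuous_mult (K := R_AbsRing)); [apply continuous_const|now apply continuous_gint].
  + now apply continuous_gint.
- now apply filterlim_Rpower_exp_0.
- now apply filterlim_Rpower_exp_infty.
Qed.

(** [Gamma] has some value for every [s]; this records that the integral converges to it. *)
Definition gamma_cv (s : R) : Prop := is_RInt_0_infty (gint s) (Gamma s).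

Lemma Gamma_unique (s l : R) : is_RInt_0_infty (gint s) l -> Gamma s = l.
Proof. apply (is_RInt_gen_unique (V := R_CompleteNormedModule)). Qed.

Lemma gamma_cv_intro (s l : R) : is_RInt_0_infty (gint s) l -> gamma_cv s.
Proof. intros H; unfold gamma_cv; now rewrite (Gamma_unique s l H). Qed.

Lemma Gamma_S (s : R) : 0 < s -> gamma_cv s -> gamma_cv (s + 1) /\ Gamma (s + 1) = s * Gamma s.
Proof.
intros Hs H.
assert (I := is_RInt_gen_minus (V := R_NormedModule) _ _ _ _
  (is_RInt_gen_scal (V := R_NormedModule) _ s _ H) (is_RInt_gint_parts s Hs)).
assert (E : is_RInt_0_infty (gint (s + 1)) (s * Gamma s)).
{ replace (s * Gamma s) with (minus (scal s (Gamma s)) 0) by (change (s * Gamma s - 0 = s * Gamma s); ring).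
  apply is_RInt_gen_ext with (2 := I); try apply filter_filter.
  apply filter_prod_0_infty; intros a b _ _ x _.
  change (s * gint s x - (s * gint s x - gint (s + 1) x) = gint (s + 1) x); ring. }
split; [exact (gamma_cv_intro _ _ E)|exact (Gamma_unique _ _ E)].
Qed.

(** The antiderivative [J] increases, and its increments are controlled by those of a bounded
    function [G], so monotone limits exist at both ends. Larger arguments are reached through s -> s
    + 1. *)
Lemma gamma_cv_le_1 (s : R) : 0 < s <= 1 -> gamma_cv s /\ 0 < Gamma s.
Proof.
intros Hs.
set (J x := RInt (gint s) 1 x).
assert (HR : forall x, 0 < x -> Rpower x s <= 1 + x).
{ intros x Hx; destruct (Rle_lt_dec 1 x) as [H1|H1].
  - apply Rle_trans with (Rpower x 1); [now apply Rle_Rpower|rewrite Rpower_1; lra].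
  - apply Rle_trans with (Rpower 1 s); [apply Rle_Rpower_l; lra|].
    unfold Rpower; rewrite ln_1, Rmult_0_r, exp_0; lra. }
assert (HJ : forall x, 0 < x -> is_derive J x (gint s x)).
{ intros x Hx; apply (is_derive_RInt (V := R_NormedModule) _ _ 1); [|now apply continuous_gint].
  exists (mkposreal x Hx); intros y Hy; apply (RInt_correct (V := R_CompleteNormedModule)).
  apply (ex_RInt_continuous (V := R_CompleteNormedModule)); intros z Hz; apply continuous_gint.
  change (Rabs (y - x) < x) in Hy; apply Rabs_def2 in Hy.
  apply Rlt_le_trans with (2 := proj1 Hz); apply Rmin_pos; lra. }
(* [G'] dominates [gint s] because [x ^ s <= 1 + x]. *)
set (G x := / s * (Rpower x s * exp (- x) - (2 + x) * exp (- x))).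
assert (HG : forall x, 0 < x -> exists l, is_derive G x l /\ gint s x <= l).
{ intros x Hx; eexists; split.
  - unfold G; auto_derive; [|reflexivity]; repeat split.
    eexists; apply is_derive_Reals, derivable_pt_lim_power; auto.
  - rewrite (is_derive_unique (fun x : R => Rpower x s) x (s * Rpower x (s - 1)))
      by (apply is_derive_Reals, derivable_pt_lim_power; auto).
    assert (B := HR x Hx).
    assert (E := exp_pos (- x)).
    unfold gint.
    replace (/ s * _) with (Rpower x (s - 1) * exp (- x) + / s * exp (- x) * (1 + x - Rpower x s))
      by (field; lra).
    assert (0 <= / s * exp (- x) * (1 + x - Rpower x s)); [|lra].
    apply Rmult_le_pos; [|lra]; apply Rmult_le_pos; [apply Rlt_le, Rinv_0_lt_compat|]; lra. }
assert (Hmono : forall f : R -> R, (forall x, 0 < x -> exists l, is_derive f x l /\ 0 <= l) ->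
  forall x y, 0 < x <= y -> f x <= f y).
{ intros f Hf x y Hxy.
  destruct (MVT_gen f x y (Derive f)) as [c [Hc E]].
  - rewrite Rmin_left, Rmax_right by lra; intros z Hz; destruct (Hf z) as [l [Hl _]]; [lra|].
    apply Derive_correct; now exists l.
  - rewrite Rmin_left, Rmax_right by lra; intros z Hz; destruct (Hf z) as [l [Hl _]]; [lra|].
    apply continuity_pt_filterlim, (ex_derive_continuous (V := R_NormedModule)); now exists l.
  - rewrite Rmin_left, Rmax_right in Hc by lra.
    destruct (Hf c) as [l [Hl Hl0]]; [lra|].
    rewrite (is_derive_unique _ _ _ Hl) in E; nra. }
assert (MJ : forall x y, 0 < x <= y -> J x <= J y).
{ apply Hmono; intros x Hx; exists (gint s x); split; auto.
  apply Rlt_le, Rmult_lt_0_compat; apply exp_pos. }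
assert (MG : forall x y, 0 < x <= y -> J y - J x <= G y - G x).
{ intros x y Hxy; assert (H := Hmono (fun x => G x - J x)).
  assert (G x - J x <= G y - J y); [|lra].
  apply H; auto; intros z Hz; destruct (HG z Hz) as [l [Hl Hl']].
  exists (l - gint s z); split; [|lra].
  apply (is_derive_minus (V := R_NormedModule)); auto. }
assert (BG : forall x, 0 < x -> - (3 / s) <= G x <= 2 / s).
{ intros x Hx; unfold G.
  assert (B1 : 0 <= Rpower x s * exp (- x)) by (apply Rmult_le_pos; apply Rlt_le, exp_pos).
  assert (E1 := exp_ineq1_le x). assert (E2 := exp_pos (- x)).
  assert (E3 : exp (- x) * exp x = 1) by (rewrite <- exp_plus, Rplus_opp_l; apply exp_0).
  assert (B2 : exp (- x) * (1 + x) <= 1) by nra.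
  assert (B3 : exp (- x) <= 1) by nra.
  assert (B := HR x Hx).
  assert (B4 : Rpower x s * exp (- x) <= 1) by nra.
  assert (Hi : 0 < / s) by (apply Rinv_0_lt_compat; lra).
  assert (B5 : 0 <= (2 + x) * exp (- x)) by (apply Rmult_le_pos; lra).
  set (d := Rpower x s * exp (- x) - (2 + x) * exp (- x)).
  assert (Hd : -3 <= d <= 2) by (unfold d; lra).
  unfold Rdiv; split.
  - replace (- (3 * / s)) with (/ s * -3) by ring; apply Rmult_le_compat_l; lra.
  - rewrite Rmult_comm; apply Rmult_le_compat_r; lra. }
destruct (monotone_limit J (G 1 * -1 + 2 / s)) as [lb Hlb].
{ intros x y H; apply MJ; lra. }
{ intros x Hx; assert (H := MG 1 x ltac:(lra)); assert (H' := BG x ltac:(lra)).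
  assert (J1 : J 1 = 0) by (unfold J; apply (RInt_point (V := R_CompleteNormedModule))); lra. }
(* The end 0 is moved to infinity by x -> 1/x, with a sign that keeps the function increasing. *)
destruct (monotone_limit (fun x => - J (/ x)) (G 1 + 3 / s)) as [la Hla].
{ intros x y H; assert (J (/ y) <= J (/ x)); [|lra].
  apply MJ; split; [apply Rinv_0_lt_compat; lra|apply Rinv_le_contravar; lra]. }
{ intros x Hx.
  assert (Hi : 0 < / x <= 1).
  { split; [apply Rinv_0_lt_compat; lra|rewrite <- Rinv_1; apply Rinv_le_contravar; lra]. }
  assert (H := MG (/ x) 1 ltac:(lra)); assert (H' := BG (/ x) ltac:(lra)).
  assert (J1 : J 1 = 0) by (unfold J; apply (RInt_point (V := R_CompleteNormedModule))); lra. }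
assert (Hla' : filterlim J (at_right 0) (locally (- la))).
{ assert (H2 : filterlim (fun x => - J (/ (/ x))) (at_right 0) (locally la)).
  { apply (filterlim_comp _ _ _ Rinv (fun x => - J (/ x)) _ (Rbar_locally p_infty)); auto.
    apply filterlim_Rinv_0_right. }
  apply (filterlim_comp _ _ _ _ Ropp _ _ (locally (- la))) in H2; [|apply (filterlim_opp (V := R_NormedModule))].
  apply filterlim_ext_loc with (2 := H2).
  apply at_right_0_pos; intros x Hx; rewrite Rinv_inv; ring. }
assert (I := is_RInt_0_infty_derive J (gint s) (- la) lb HJ (continuous_gint s) Hla' Hlb).
split; [exact (gamma_cv_intro _ _ I)|].
rewrite (Gamma_unique _ _ I).
apply Rlt_le_trans with 1; [lra|].
(* Tangent line of the convex function [x ^ (s - 1)] at [1]. *)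
apply (is_RInt_0_infty_le (fun x => (1 + (s - 1) * (x - 1)) * exp (- x)) (gint s)) with (3 := I).
- intros x Hx; unfold gint; apply Rmult_le_compat_r; [apply Rlt_le, exp_pos|].
  unfold Rpower; apply Rle_trans with (2 := exp_ineq1_le _).
  assert (ln x <= x - 1) by (generalize (exp_ineq1_le (ln x)); rewrite exp_ln by auto; lra).
  nra.
- replace 1 with (0 - (-1)) by ring.
  apply is_RInt_0_infty_derive with (fun x => - (1 + (s - 1) * x) * exp (- x)).
  + intros x Hx; auto_derive; auto; ring.
  + intros x Hx; apply (ex_derive_continuous (V := R_NormedModule)); auto_derive; auto.
  + apply (filterlim_filter_le_1 (G := at_right 0) (F := locally 0)).
    * apply filter_le_within.
    * replace (-1) with (- (1 + (s - 1) * 0) * exp (- 0)) by (rewrite Ropp_0, exp_0; ring).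
      apply (ex_derive_continuous (V := R_NormedModule) (fun x => - (1 + (s - 1) * x) * exp (- x)) 0).
      auto_derive; auto.
  + assert (L1 := filterlim_exp_decay 1 (-1) Rlt_0_1).
    assert (L2 := filterlim_comp _ _ _ _ (fun y => (1 - s) * y) _ _ (locally ((1 - s) * 0))
      (filterlim_Rpower_exp_infty 1 Rlt_0_1) (filterlim_scal_r (V := R_NormedModule) (1 - s) 0)).
    assert (L3 := filterlim_comp_2 _ _ _ L1 L2 (filterlim_plus (V := R_NormedModule) 0 ((1 - s) * 0))).
    assert (Z : @plus R_NormedModule 0 ((1 - s) * 0) = 0) by (change (0 + (1 - s) * 0 = 0); ring).
    rewrite Z in L3.
    apply filterlim_ext_loc with (2 := L3).
    exists 0; intros x Hx; change (plus ?u ?v) with (u + v).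
    rewrite Rpower_1 by auto; replace (- (1) * x) with (- x) by ring.
    match goal with |- ?a = ?b => change (@eq R a b) end; ring.
Qed.

(** The inequality 2 sqrt x <= r + x/r under the integral, at r = sqrt s, where Gamma(s + 1) = s
    Gamma(s) makes both halves equal. It does the work of Stirling's formula in the next limit. *)
Lemma Gamma_half_step (s : R) : 0 < s -> gamma_cv s -> gamma_cv (s + 1 / 2) ->
  Gamma (s + 1 / 2) <= sqrt s * Gamma s.
Proof.
intros Hs H1 H2; destruct (Gamma_S s Hs H1) as [H3 E].
set (r := sqrt s); assert (Hr : 0 < r) by (apply sqrt_lt_R0; auto).
assert (Hrs : r * r = s) by (apply sqrt_sqrt; lra).
assert (I := is_RInt_gen_plus (V := R_NormedModule) _ _ _ _
  (is_RInt_gen_scal (V := R_NormedModule) _ (r / 2) _ H1)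
  (is_RInt_gen_scal (V := R_NormedModule) _ (/ (2 * r)) _ H3)).
apply Rle_trans with (r / 2 * Gamma s + / (2 * r) * Gamma (s + 1)).
- refine (is_RInt_0_infty_le _ _ _ _ _ H2 I); intros x Hx.
  change (gint (s + 1 / 2) x <= r / 2 * gint s x + / (2 * r) * gint (s + 1) x).
  unfold gint.
  replace (s + 1 / 2 - 1) with ((s - 1) + / 2) by field.
  replace (s + 1 - 1) with ((s - 1) + 1) by ring.
  rewrite !Rpower_plus, Rpower_sqrt, Rpower_1 by auto.
  set (q := sqrt x); assert (Hq : q * q = x) by (apply sqrt_sqrt; lra).
  assert (HP : 0 < Rpower x (s - 1) * exp (- x)) by (apply Rmult_lt_0_compat; apply exp_pos).
  replace (r / 2 * _ + _) with (Rpower x (s - 1) * exp (- x) * (r / 2 + / (2 * r) * x)) by ring.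
  replace (Rpower x (s - 1) * q * exp (- x)) with (Rpower x (s - 1) * exp (- x) * q) by ring.
  apply Rmult_le_compat_l; [lra|].
  apply Rmult_le_reg_l with (2 * r); [lra|].
  replace (2 * r * (r / 2 + / (2 * r) * x)) with (r * r + q * q) by (rewrite Hq; field; lra).
  generalize (Rle_0_sqr (r - q)); unfold Rsqr; lra.
- rewrite E; apply Req_le; rewrite <- Hrs; field; lra.
Qed.

Lemma Gamma_pochhammer (s : R) (n : nat) : 0 < s <= 1 ->
  gamma_cv (s + INR n) /\ Gamma (s + INR n) = pochhammer s n * Gamma s.
Proof.
intros Hs; induction n as [|n [IH1 IH2]].
- simpl; rewrite Rplus_0_r, Rmult_1_l; split; [apply gamma_cv_le_1; auto|auto].
- rewrite S_INR, <- Rplus_assoc; assert (Hn := pos_INR n).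
  destruct (Gamma_S (s + INR n) ltac:(lra) IH1) as [H1 H2].
  split; auto; rewrite H2, IH2; simpl; ring.
Qed.

(** Half steps from 1/4 + n to 3/4 + n and on to 5/4 + n squeeze the square of Gamma(3/4 +
    n)/Gamma(1/4 + n) between two quantities equivalent to n. The sequence is the ratio of the
    coefficients of the odd and the even solution. *)
Lemma is_lim_seq_pochhammer_Gamma :
  is_lim_seq (fun n => (pochhammer (3 / 4) n / pochhammer (1 / 4) n) ^ 2 / (2 * INR n + 1))
    (1 / 2 * (Gamma (1 / 4) / Gamma (3 / 4)) ^ 2).
Proof.
destruct (gamma_cv_le_1 (1 / 4)) as [_ G1]; [lra|].
destruct (gamma_cv_le_1 (3 / 4)) as [_ G3]; [lra|].
set (q := fun n => Gamma (3 / 4 + INR n) / Gamma (1 / 4 + INR n)).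
assert (Hq : forall n, ((1 / 4 + INR n) / (3 / 4 + INR n)) * (1 / 4 + INR n) <= q n ^ 2 <= 1 / 4 + INR n).
{ intros n; assert (Hn := pos_INR n).
  destruct (Gamma_pochhammer (1 / 4) n) as [C1 E1]; [lra|].
  destruct (Gamma_pochhammer (3 / 4) n) as [C3 E3]; [lra|].
  assert (P1 := pochhammer_pos (1 / 4) n ltac:(lra)); assert (P3 := pochhammer_pos (3 / 4) n ltac:(lra)).
  set (g1 := Gamma (1 / 4 + INR n)) in *; set (g3 := Gamma (3 / 4 + INR n)) in *.
  assert (Hg1 : 0 < g1) by (rewrite E1; now apply Rmult_lt_0_compat).
  assert (Hg3 : 0 < g3) by (rewrite E3; now apply Rmult_lt_0_compat).
  assert (I1 := Gamma_half_step (1 / 4 + INR n) ltac:(lra) C1).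
  replace (1 / 4 + INR n + 1 / 2) with (3 / 4 + INR n) in I1 by field.
  specialize (I1 C3); fold g1 g3 in I1.
  destruct (Gamma_S (1 / 4 + INR n) ltac:(lra) C1) as [C5 E5].
  assert (I3 := Gamma_half_step (3 / 4 + INR n) ltac:(lra) C3).
  replace (3 / 4 + INR n + 1 / 2) with (1 / 4 + INR n + 1) in I3 by field.
  specialize (I3 C5); rewrite E5 in I3; fold g1 g3 in I3.
  assert (Sq : forall a b c, 0 <= a -> 0 < c -> a <= sqrt c * b -> a ^ 2 <= c * b ^ 2).
  { intros a b c Ha Hc H; rewrite <- (pow2_sqrt c) by lra; rewrite <- Rpow_mult_distr.
    apply pow_incr; lra. }
  apply Sq in I1; [|lra|lra]. apply Sq in I3; [|apply Rmult_le_pos; lra|lra].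
  unfold q; fold g1 g3; split.
  - apply Rmult_le_reg_l with ((3 / 4 + INR n) * g1 ^ 2); [apply Rmult_lt_0_compat; [lra|apply pow_lt; lra]|].
    replace (_ * (g3 / g1) ^ 2) with ((3 / 4 + INR n) * g3 ^ 2) by (field; lra).
    apply Rle_trans with (2 := I3); apply Req_le; field; lra.
  - apply Rmult_le_reg_l with (g1 ^ 2); [apply pow_lt; lra|].
    replace (g1 ^ 2 * (g3 / g1) ^ 2) with (g3 ^ 2) by (field; lra); lra. }
assert (Lq : is_lim_seq (fun n => q n ^ 2 / (2 * INR n + 1)) (1 / 2)).
{ assert (A1 := is_lim_seq_ratio (1 / 4) (1 / 2) ltac:(lra)).
  assert (A2 := is_lim_seq_ratio (1 / 4) (3 / 4) ltac:(lra)).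
  apply is_lim_seq_le_le with
   (fun n => / 2 * ((1 / 4 + INR n) / (3 / 4 + INR n) * ((1 / 4 + INR n) / (1 / 2 + INR n))))
   (fun n => / 2 * ((1 / 4 + INR n) / (1 / 2 + INR n))).
  - intros n; assert (Hn := pos_INR n); destruct (Hq n) as [L U].
    assert (Hi : 0 < / (2 * INR n + 1)) by (apply Rinv_0_lt_compat; lra).
    split.
    + replace (/ 2 * _) with ((1 / 4 + INR n) / (3 / 4 + INR n) * (1 / 4 + INR n) * / (2 * INR n + 1))
        by (field; lra).
      apply Rmult_le_compat_r; lra.
    + replace (/ 2 * _) with ((1 / 4 + INR n) * / (2 * INR n + 1)) by (field; lra).
      apply Rmult_le_compat_r; lra.
  - replace (Finite (1 / 2)) with (Finite (/ 2 * (1 * 1))) by (f_equal; field).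
    apply (is_lim_seq_scal_l _ (/ 2) (1 * 1)); now apply is_lim_seq_mult'.
  - replace (Finite (1 / 2)) with (Finite (/ 2 * 1)) by (f_equal; field).
    now apply (is_lim_seq_scal_l _ (/ 2) 1). }
apply is_lim_seq_ext with (fun n => q n ^ 2 / (2 * INR n + 1) * (Gamma (1 / 4) / Gamma (3 / 4)) ^ 2).
- intros n; unfold q.
  destruct (Gamma_pochhammer (1 / 4) n) as [C1 E1]; [lra|].
  destruct (Gamma_pochhammer (3 / 4) n) as [C3 E3]; [lra|].
  assert (P1 := pochhammer_pos (1 / 4) n ltac:(lra)).
  rewrite E1, E3; assert (Hn := pos_INR n); field; repeat split; lra.
- apply is_lim_seq_mult'; [exact Lq|apply is_lim_seq_const].
Qed.

(** * Even and odd solutions at the centre of the disk *)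

Lemma cdiff_eq (f : C -> C) (z l m : C) : l = m -> cdiff f z l -> cdiff f z m.
Proof. now intros ->. Qed.

Lemma cdiff_ext (f g : C -> C) (z l : C) : (forall x, f x = g x) -> cdiff f z l -> cdiff g z l.
Proof. intros E H p u m Hp Hd; apply pd_ext with (fun x => f (p x)); auto. Qed.

Lemma cdiff_id (z : C) : cdiff (fun x => x) z 1.
Proof. intros g u m _ H; apply (pd_eq _ _ m); [ring|exact H]. Qed.

Lemma cdiff_const (c z : C) : cdiff (fun _ => c) z 0.
Proof. intros g u m _ _; apply (pd_eq _ _ 0); [ring|apply pd_const]. Qed.

Lemma cdiff_plus (f g : C -> C) (z l m : C) :
  cdiff f z l -> cdiff g z m -> cdiff (fun x => f x + g x)%C z (l + m)%C.
Proof.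
intros Hf Hg p u k Hp Hd.
eapply pd_eq; [|apply pd_plus; [apply Hf; eassumption|apply Hg; eassumption]]; cbv beta; ring.
Qed.

Lemma cdiff_mult (f g : C -> C) (z l m : C) :
  cdiff f z l -> cdiff g z m -> cdiff (fun x => f x * g x)%C z (l * g z + f z * m)%C.
Proof.
intros Hf Hg p u k Hp Hd.
eapply pd_eq; [|apply pd_mult; [apply Hf; eassumption|apply Hg; eassumption]].
cbv beta; rewrite Hp; cbv beta; ring.
Qed.

Lemma cdiff_comp (f g : C -> C) (z l m : C) :
  cdiff g z l -> cdiff f (g z) m -> cdiff (fun x => f (g x)) z (m * l)%C.
Proof.
intros Hg Hf p u k Hp Hd.
eapply pd_eq; [|apply (Hf (fun x => g (p x))); [now rewrite Hp|apply Hg; eassumption]]; cbv beta; ring.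
Qed.

Lemma cdiff_scal (c : C) (f : C -> C) (z l : C) :
  cdiff f z l -> cdiff (fun x => c * f x)%C z (c * l)%C.
Proof.
intros Hf; eapply cdiff_eq; [|apply cdiff_mult; [apply cdiff_const|exact Hf]]; cbv beta; ring.
Qed.

Lemma cdiff_minus (f g : C -> C) (z l m : C) :
  cdiff f z l -> cdiff g z m -> cdiff (fun x => f x - g x)%C z (l - m)%C.
Proof.
intros Hf Hg p u k Hp Hd.
eapply pd_eq; [|apply pd_plus; [apply Hf; eassumption|apply pd_opp, Hg; eassumption]]; cbv beta; ring.
Qed.

Lemma cdiff_inv (f : C -> C) (z l : C) : f z <> 0 ->
  cdiff f z l -> cdiff (fun x => / f x)%C z (- l / (f z * f z))%C.
Proof.
intros Hn Hf p u k Hp Hd.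
eapply pd_eq; [|apply pd_inv; [now rewrite Hp|apply Hf; eassumption]].
cbv beta; rewrite Hp; field; auto.
Qed.

Lemma cdiff_Cexp (f : C -> C) (z l : C) : 
  cdiff f z l -> cdiff (fun x => Cexp (f x)) z (l * Cexp (f z))%C.
Proof.
intros Hf p u k Hp Hd.
eapply pd_eq; [|apply pd_Cexp, Hf; eassumption]; cbv beta; rewrite Hp; cbv beta; ring.
Qed.

Lemma cdiff_4sq (z : C) : cdiff (fun x => 4 * x ^ 2)%C z (8 * z)%C.
Proof.
apply (cdiff_ext (fun x => 4 * (x * x))%C); [intros x; ring|].
eapply cdiff_eq; [|apply cdiff_scal, cdiff_mult; apply cdiff_id]; cbv beta; ring.
Qed.

Lemma cdiff_1m4sq (z : C) : cdiff (fun x => 1 - 4 * x ^ 2)%C z (- 8 * z)%C.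
Proof.
eapply cdiff_eq; [|apply cdiff_minus; [apply cdiff_const|apply cdiff_4sq]]; cbv beta; ring.
Qed.

Definition f1 : nat -> R := hc (1 / 4) (1 / 4) (1 / 2).
Definition f2 : nat -> R := hc (3 / 4) (3 / 4) (3 / 2).
Definition Y1 (z : C) : C := cps f1 (4 * z ^ 2)%C.
Definition Y2 (z : C) : C := (z * cps f2 (4 * z ^ 2))%C.
Definition D1 (z : C) : C := (8 * z * cps (PS_derive f1) (4 * z ^ 2))%C.
Definition D2 (z : C) : C := (cps f2 (4 * z ^ 2) + 8 * z ^ 2 * cps (PS_derive f2) (4 * z ^ 2))%C.
(** With V = (1 - 4z^2) y' the equation reads V' = y, and y1 V2 - y2 V1 is constant. *)
Definition V1 (z : C) : C := ((1 - 4 * z ^ 2) * D1 z)%C.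
Definition V2 (z : C) : C := ((1 - 4 * z ^ 2) * D2 z)%C.

Lemma Cmod_4sq (z : C) : Cmod z < 1 / 2 -> Cmod (4 * z ^ 2) < 1.
Proof.
intros Hz; rewrite Cmod_mult, Cmod_pow, Cmod_R, Rabs_pos_eq by lra.
assert (H := Cmod_ge_0 z); nra.
Qed.

Lemma in_disk_f1 (z : C) : Cmod z < 1 / 2 -> in_disk f1 (4 * z ^ 2)%C.
Proof. intros Hz; apply in_disk_hc; try lra; now apply Cmod_4sq. Qed.

Lemma in_disk_f2 (z : C) : Cmod z < 1 / 2 -> in_disk f2 (4 * z ^ 2)%C.
Proof. intros Hz; apply in_disk_hc; try lra; now apply Cmod_4sq. Qed.

Lemma cdiff_cps_4sq (a : nat -> R) (z : C) : in_disk a (4 * z ^ 2)%C ->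
  cdiff (fun x => cps a (4 * x ^ 2))%C z (8 * z * cps (PS_derive a) (4 * z ^ 2))%C.
Proof.
intros Ha; eapply cdiff_eq; [|apply (cdiff_comp (cps a) (fun x => 4 * x ^ 2)%C);
  [apply cdiff_4sq|apply cps_cdiff, Ha]]; cbv beta; ring.
Qed.

Lemma cdiff_Y1 (z : C) : Cmod z < 1 / 2 -> cdiff Y1 z (D1 z).
Proof. intros Hz; exact (cdiff_cps_4sq f1 z (in_disk_f1 z Hz)). Qed.

Lemma cdiff_Y2 (z : C) : Cmod z < 1 / 2 -> cdiff Y2 z (D2 z).
Proof.
intros Hz; eapply cdiff_eq; [|apply cdiff_mult; [apply cdiff_id|apply cdiff_cps_4sq; now apply in_disk_f2]].
unfold D2; cbv beta; ring.
Qed.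

Lemma cdiff_V1 (z : C) : Cmod z < 1 / 2 -> cdiff V1 z (Y1 z).
Proof.
intros Hz; assert (Hd := in_disk_derive _ _ (in_disk_f1 z Hz)).
eapply cdiff_eq; [|apply cdiff_mult; [apply cdiff_1m4sq|
  apply cdiff_mult; [apply cdiff_scal, cdiff_id|apply cdiff_cps_4sq; exact Hd]]].
assert (O := hypergeometric_ode (1 / 4) (1 / 4) (1 / 2) (4 * z ^ 2)%C ltac:(lra) ltac:(lra) ltac:(lra) (Cmod_4sq z Hz)).
unfold Y1, D1; cbv zeta in O; fold f1 in O.
rewrite !RtoC_div in O by lra.
(* 16 times the hypergeometric equation at 4z^2. *)
transitivity (16 * (1 / 4 * (1 / 4) * cps f1 (4 * z ^ 2)))%C; [|field].
rewrite <- O; field.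
Qed.

Lemma cdiff_V2 (z : C) : Cmod z < 1 / 2 -> cdiff V2 z (Y2 z).
Proof.
intros Hz; assert (Hd := in_disk_derive _ _ (in_disk_f2 z Hz)).
assert (Hsq : cdiff (fun x => 8 * x ^ 2)%C z (16 * z)%C).
{ apply (cdiff_ext (fun x => 2 * (4 * x ^ 2))%C); [intros x; ring|].
  eapply cdiff_eq; [|apply cdiff_scal, cdiff_4sq]; ring. }
eapply cdiff_eq; [|apply cdiff_mult; [apply cdiff_1m4sq|
  apply cdiff_plus; [apply cdiff_cps_4sq; now apply in_disk_f2|
  apply cdiff_mult; [exact Hsq|apply cdiff_cps_4sq; exact Hd]]]].
assert (O := hypergeometric_ode (3 / 4) (3 / 4) (3 / 2) (4 * z ^ 2)%C ltac:(lra) ltac:(lra) ltac:(lra) (Cmod_4sq z Hz)).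
unfold Y2, D2; cbv zeta in O; fold f2 in O.
rewrite !RtoC_div in O by lra.
set (g := cps f2 (4 * z ^ 2)) in *; set (g1 := cps (PS_derive f2) (4 * z ^ 2)) in *.
set (g2 := cps (PS_derive (PS_derive f2)) (4 * z ^ 2)) in *.
assert (E : (9 * g = 64 * z ^ 2 * (1 - 4 * z ^ 2) * g2 + (24 - 160 * z ^ 2) * g1)%C).
{ transitivity (16 * (3 / 4 * (3 / 4) * g))%C; [field|].
  rewrite <- O; field. }
transitivity (z * (9 * g - 8 * g))%C; [rewrite E; ring|ring].
Qed.

Lemma pd_zero_const (f : R -> C) (a b : R) : a <= b ->
  (forall u, a <= u <= b -> pd f u 0) -> f a = f b.
Proof.
intros Hab H; apply injective_projections.
- apply (constant_of_derive_0 (fun x => Re (f x))); auto.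
  + intros x Hx; apply H; lra.
  + intros x Hx; apply is_derive_continuity with 0; apply H; lra.
- apply (constant_of_derive_0 (fun x => Im (f x))); auto.
  + intros x Hx; apply H; lra.
  + intros x Hx; apply is_derive_continuity with 0; apply H; lra.
Qed.

Lemma Cmod_scal_lt (u : R) (z : C) (r : R) : 0 <= u <= 1 -> Cmod z < r -> Cmod (u * z) < r.
Proof.
intros Hu Hz; rewrite Cmod_mult, Cmod_R, Rabs_pos_eq by lra.
generalize (Cmod_ge_0 z); nra.
Qed.

Lemma cdiff_zero_const (f : C -> C) (z : C) (r : R) : Cmod z < r ->
  (forall w, Cmod w < r -> cdiff f w 0) -> f z = f 0.
Proof.
intros Hz H.
assert (E : f (0 * z)%C = f (1 * z)%C).
{ apply (pd_zero_const (fun u => f (u * z)%C) 0 1); [lra|].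
  intros u Hu; eapply pd_eq.
  2:{ apply (H (u * z)%C (Cmod_scal_lt u z r Hu Hz) (fun u => u * z)%C u z); auto.
      eapply pd_eq; [|apply pd_mult; [apply pd_RtoC, is_derive_id|apply pd_const]].
      change (RtoC one) with (RtoC 1); cbv beta; ring. }
  ring. }
rewrite Cmult_0_l, Cmult_1_l in E; auto.
Qed.

Lemma cps_0 (a : nat -> R) : cps a 0 = a O.
Proof. now rewrite cps_RtoC, PSeries_0. Qed.

Lemma values_0 : Y1 0 = 1 /\ Y2 0 = 0 /\ V1 0 = 0 /\ V2 0 = 1 /\ D1 0 = 0 /\ D2 0 = 1.
Proof.
unfold V1, V2, Y1, Y2, D1, D2.
replace (4 * 0 ^ 2)%C with (RtoC 0) by ring.
rewrite !cps_0; unfold f1, f2; rewrite !hc_0.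
repeat split; ring.
Qed.

Lemma wronskian_Y (z : C) : Cmod z < 1 / 2 -> (Y1 z * V2 z - Y2 z * V1 z = 1)%C.
Proof.
intros Hz.
rewrite (cdiff_zero_const (fun z => Y1 z * V2 z - Y2 z * V1 z)%C z (1 / 2) Hz).
- destruct values_0 as [-> [-> [-> [-> _]]]]; ring.
- intros w Hw.
  eapply cdiff_eq; [|apply cdiff_minus; apply cdiff_mult; auto using cdiff_Y1, cdiff_Y2, cdiff_V1, cdiff_V2].
  unfold V1, V2; ring.
Qed.

(* [y] solves [((1 - 4 u ^ 2) y')' = y], with [v = (1 - 4 u ^ 2) y']. *)
Definition legendre_sol (y v : R -> C) : Prop :=
  forall u, Rabs u < 1 / 2 -> pd y u (v u / (1 - 4 * u ^ 2))%C /\ pd v u (y u).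

Lemma legendre_sol_wronskian (y v y' v' : R -> C) (u : R) : 
  legendre_sol y v -> legendre_sol y' v' -> Rabs u < 1 / 2 ->
  (y u * v' u - y' u * v u = y 0%R * v' 0%R - y' 0%R * v 0%R)%C.
Proof.
intros H H' Hu.
assert (HW : forall x, Rabs x < 1 / 2 -> pd (fun x => y x * v' x - y' x * v x)%C x 0).
{ intros x Hx; destruct (H x Hx) as [A B]; destruct (H' x Hx) as [A' B'].
  eapply pd_eq; [|apply pd_plus; [apply pd_mult; eassumption|apply pd_opp, pd_mult; eassumption]].
  unfold Cdiv; ring. }
apply Rabs_def2 in Hu.
destruct (Rle_lt_dec 0 u).
- symmetry; apply (pd_zero_const (fun x => y x * v' x - y' x * v x)%C); auto.
  intros x Hx; apply HW, Rabs_def1; lra.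
- apply (pd_zero_const (fun x => y x * v' x - y' x * v x)%C); [lra|].
  intros x Hx; apply HW, Rabs_def1; lra.
Qed.

Lemma one_minus_4sq_neq_0 (z : C) : Cmod z < 1 / 2 -> (1 - 4 * z ^ 2 <> 0)%C.
Proof.
intros Hz E; assert (H := Cmod_4sq z Hz).
replace (4 * z ^ 2)%C with (1 - (1 - 4 * z ^ 2))%C in H by ring.
rewrite E in H; replace (1 - 0)%C with (RtoC 1) in H by ring; rewrite Cmod_1 in H; lra.
Qed.

Lemma legendre_sol_Y : legendre_sol Y1 V1 /\ legendre_sol Y2 V2.
Proof.
assert (Hid : forall u, pd (fun x => RtoC x) u 1).
{ intros u; apply (pd_RtoC (fun x => x)); apply (is_derive_id (K := R_AbsRing) u). }
split; intros u Hu; assert (Hz : Cmod u < 1 / 2) by now rewrite Cmod_R.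
- split.
  + eapply pd_eq; [|apply (cdiff_Y1 u Hz (fun x => RtoC x) u 1); auto].
    unfold V1; field; now apply one_minus_4sq_neq_0.
  + eapply pd_eq; [|apply (cdiff_V1 u Hz (fun x => RtoC x) u 1); auto]; ring.
- split.
  + eapply pd_eq; [|apply (cdiff_Y2 u Hz (fun x => RtoC x) u 1); auto].
    unfold V2; field; now apply one_minus_4sq_neq_0.
  + eapply pd_eq; [|apply (cdiff_V2 u Hz (fun x => RtoC x) u 1); auto]; ring.
Qed.

(** For x = (1 - 2u)/2 one has 1 - 4u^2 = 4x(1 - x) and dx/du = -1, hence the conjugate variable -4
    Phi. *)
Lemma legendre_sol_K :
  legendre_sol (fun u => RtoC (K ((1 - 2 * u) / 2))) (fun u => RtoC (- 4 * Phi ((1 - 2 * u) / 2))).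
Proof.
intros u Hu; apply Rabs_def2 in Hu.
set (x := (1 - 2 * u) / 2).
assert (Hx : Rabs x < 1) by (unfold x; apply Rabs_def1; lra).
split.
- assert (D := is_derive_K x Hx).
  assert (Hn : 1 - 4 * u ^ 2 <> 0) by nra.
  replace (RtoC (- 4 * Phi x) / (1 - 4 * u ^ 2))%C with (RtoC (- 4 * Phi x / (1 - 4 * u ^ 2))).
  + apply (pd_RtoC (fun u => K ((1 - 2 * u) / 2))); auto_derive.
    * eexists; exact D.
    * change ((1 + - (2 * u)) * / 2) with x.
      rewrite (is_derive_unique (fun x : R => K x) x _ D); unfold Phi, x; field; exact Hn.
  + rewrite RtoC_div by auto; rewrite RtoC_minus, (RtoC_mult 4), RtoC_pow; reflexivity.
- assert (D := is_derive_Phi x Hx).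
  apply (pd_RtoC (fun u => - 4 * Phi ((1 - 2 * u) / 2))); auto_derive.
  + eexists; exact D.
  + change ((1 + - (2 * u)) * / 2) with x.
    rewrite (is_derive_unique (fun x : R => Phi x) x _ D); field.
Qed.

(** * Complex extension of K and the value of kappa *)

Definition KA : R := K (1 / 2).
Definition KB : R := K1 (1 / 2) / 2.

(** [Kminus] and [Kplus] extend K((1 - 2u)/2) and K((1 + 2u)/2) from real u to the complex disk: the
    value at 0 is [KA], the slope there is minus or plus 2 [KB]. *)
Definition Kminus (z : C) : C := (KA * Y1 z - 2 * KB * Y2 z)%C.
Definition Kplus (z : C) : C := (KA * Y1 z + 2 * KB * Y2 z)%C.

Lemma Kminus_real (u : R) : Rabs u < 1 / 2 -> Kminus u = K ((1 - 2 * u) / 2).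
Proof.
intros Hu; destruct legendre_sol_Y as [S1 S2].
assert (E1 := legendre_sol_wronskian _ _ _ _ u S1 legendre_sol_K Hu).
assert (E2 := legendre_sol_wronskian _ _ _ _ u S2 legendre_sol_K Hu).
assert (E0 := wronskian_Y u ltac:(now rewrite Cmod_R)).
destruct values_0 as [a1 [a2 [a3 [a4 _]]]].
cbv beta in E1, E2; rewrite a1, a3 in E1; rewrite a2, a4 in E2.
replace ((1 - 2 * 0) / 2) with (1 / 2) in E1, E2 by field.
assert (EP : - 4 * Phi (1 / 2) = - (2 * KB)) by (unfold Phi, KB; field).
rewrite EP in E1, E2; fold KA in E1, E2.
set (G := RtoC (K ((1 - 2 * u) / 2))) in *; set (v := RtoC (- 4 * Phi ((1 - 2 * u) / 2))) in *.
rewrite RtoC_opp, RtoC_mult in E1, E2.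
unfold Kminus.
(* Cramer's rule: the Wronskians [E1] and [E2] with the basis Y1, Y2 determine the coefficients of
   [G] in it. *)
transitivity (G * (Y1 u * V2 u - Y2 u * V1 u))%C; [|rewrite E0; ring].
replace (RtoC KA) with (- (Y2 u * v - G * V2 u))%C by (rewrite E2; ring).
replace (2 * KB)%C with (- (Y1 u * v - G * V1 u))%C by (rewrite E1; ring).
ring.
Qed.

Lemma Y1_opp (z : C) : Y1 (- z) = Y1 z.
Proof. unfold Y1; now replace (4 * (- z) ^ 2)%C with (4 * z ^ 2)%C by ring. Qed.

Lemma Y2_opp (z : C) : (Y2 (- z) = - Y2 z)%C.
Proof. unfold Y2; replace (4 * (- z) ^ 2)%C with (4 * z ^ 2)%C by ring; ring. Qed.

Lemma Kplus_opp (z : C) : Kplus z = Kminus (- z).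
Proof. unfold Kminus, Kplus; rewrite Y1_opp, Y2_opp; ring. Qed.

Lemma Kplus_real (u : R) : Rabs u < 1 / 2 -> Kplus u = K ((1 + 2 * u) / 2).
Proof.
intros Hu; rewrite Kplus_opp, <- RtoC_opp, Kminus_real by now rewrite Rabs_Ropp.
do 2 f_equal; field.
Qed.

Lemma KA_KB : KA * KB = / PI.
Proof.
rewrite <- (legendre (1 / 2)) by lra.
replace (1 - 1 / 2) with (1 / 2) by field.
unfold KA, KB, Phi; field.
Qed.

Lemma KA_ge_1 : 1 <= KA.
Proof. apply K_ge_1; lra. Qed.

Lemma KB_pos : 0 < KB.
Proof.
assert (E := KA_KB); assert (P := KA_ge_1).
assert (0 < / PI) by (apply Rinv_0_lt_compat, PI_RGT_0).
apply Rnot_le_lt; intros N; nra.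
Qed.

(** The product k f1(k) increases from its value 1/8 at k = 1. This harmonic size makes the
    coefficient sum diverge, so that Y1 is unbounded near 1/2. *)
Lemma f1_lower_bound (n : nat) : 1 / 8 <= INR (S n) * f1 n.
Proof.
assert (P : forall n, 0 < f1 n) by (intros; apply hc_pos; lra).
assert (Hn : forall n, 1 / 8 <= INR (S n) * f1 (S n)).
{ clear n; induction n as [|n IH].
  - unfold f1, hc; simpl; lra.
  - apply Rle_trans with (1 := IH).
    unfold f1; rewrite (hc_S _ _ _ (S n)) by lra; fold f1.
    assert (Hp := pos_INR n); specialize (P (S n)); fold (f1 (S n)).
    rewrite (S_INR (S n)), (S_INR n).
    replace ((INR n + 1 + 1) * _) with
      ((INR n + 1) * f1 (S n) + f1 (S n) / (16 * (1 / 2 + (INR n + 1)))).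
    + assert (0 < f1 (S n) / (16 * (1 / 2 + (INR n + 1)))) by (apply Rdiv_lt_0_compat; lra); lra.
    + unfold f1; field; lra. }
destruct n as [|n].
- unfold f1; rewrite hc_0; simpl; lra.
- apply Rle_trans with (1 := Hn n); apply Rmult_le_compat_r; [apply Rlt_le, P|apply le_INR; lia].
Qed.

Lemma pochhammer_half (n : nat) :
  pochhammer (1 / 2) n * (2 * INR n + 1) = pochhammer (3 / 2) n.
Proof.
induction n as [|n IH]; [simpl; ring|].
rewrite S_INR; simpl pochhammer; rewrite <- IH; field.
Qed.

Lemma f2_f1 (n : nat) :
  f2 n = (pochhammer (3 / 4) n / pochhammer (1 / 4) n) ^ 2 / (2 * INR n + 1) * f1 n.
Proof.
unfold f1, f2, hc; rewrite <- pochhammer_half.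
assert (P1 := pochhammer_pos (1 / 4) n ltac:(lra)).
assert (P2 := pochhammer_pos (1 / 2) n ltac:(lra)).
assert (P3 := INR_fact_pos n); assert (P4 := pos_INR n).
field; repeat split; lra.
Qed.

Lemma Omega_i_sqr : 2 * PI * Omega_i ^ 2 = (Gamma (1 / 4) / Gamma (3 / 4)) ^ 2 / 4.
Proof.
unfold Omega_i; assert (P := PI_RGT_0).
rewrite Rpow_mult_distr.
replace ((1 / sqrt (8 * PI)) ^ 2) with (/ (8 * PI)).
- field; split; [|lra].
  destruct (gamma_cv_le_1 (3 / 4)) as [_ G3]; lra.
- unfold Rdiv; rewrite Rpow_mult_distr, pow1, pow_inv, pow2_sqrt by lra; ring.
Qed.

Lemma KA_kappa : KA = 2 * KB * (2 * PI * Omega_i ^ 2).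
Proof.
rewrite Omega_i_sqr.
(* The limit of the coefficient ratio f2/f1; the prefactor t of y2 tends to 1/2, so this is twice
   kappa. *)
set (L := 1 / 2 * (Gamma (1 / 4) / Gamma (3 / 4)) ^ 2).
replace (2 * KB * _) with (KB * L) by (unfold L; field; destruct (gamma_cv_le_1 (3 / 4)); lra).
assert (HA := KA_ge_1); assert (HB := KB_pos).
(* A nonzero gap is refuted at a t close to 1/2, where the bounded value of K, the error in t and
   the error in the ratio are each at most d/8 times [P1]. *)
set (d := Rabs (KA - KB * L)).
destruct (Req_dec d 0) as [E|Hd]; [apply Rabs_eq_0 in E; lra|exfalso].
assert (Hd0 : 0 < d) by (generalize (Rabs_pos (KA - KB * L)); fold d; lra).
set (eps := d / (8 * KB)).
assert (Heps : 0 < eps) by (apply Rdiv_lt_0_compat; lra).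
assert (HP1 : forall n, 0 <= f1 n) by (intros; apply Rlt_le, hc_pos; lra).
assert (HP2 : forall n, 0 <= f2 n) by (intros; apply Rlt_le, hc_pos; lra).
assert (C1 : CV_radius f1 = 1) by (apply CV_radius_hc; lra).
assert (C2 : CV_radius f2 = 1) by (apply CV_radius_hc; lra).
assert (HU := sum_unbounded_harmonic f1 (1 / 8) ltac:(lra) f1_lower_bound).
destruct (PSeries_ratio f1 f2 _ L HP1 f2_f1 is_lim_seq_pochhammer_Gamma) with (eps := eps)
  as [d1 [Hd1 R1]]; auto; try (rewrite ?C1, ?C2; apply Rbar_le_refl).
destruct (PSeries_unbounded f1 HP1) with (M := 8 * KA / d) as [d2 [Hd2 R2]]; auto;
  try (rewrite ?C1; apply Rbar_le_refl).
assert (HLe : 0 < Rabs L + eps) by (generalize (Rabs_pos L); lra).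
(* The first two bounds place 4t^2 where [R1] and [R2] apply, as 1 - 4t^2 <= 4 eta; the third
   controls the replacement of t by 1/2. *)
set (eta := Rmin (Rmin (d1 / 8) (d2 / 8)) (d / (16 * KB * (Rabs L + eps)))).
assert (Heta : 0 < eta).
{ repeat apply Rmin_pos; try lra; apply Rdiv_lt_0_compat; auto; apply Rmult_lt_0_compat; lra. }
assert (He1 : eta <= d1 / 8) by (eapply Rle_trans; [apply Rmin_l|apply Rmin_l]).
assert (He2 : eta <= d2 / 8) by (eapply Rle_trans; [apply Rmin_l|apply Rmin_r]).
assert (He3 : eta <= d / (16 * KB * (Rabs L + eps))) by apply Rmin_r.
set (t := 1 / 2 - eta); assert (Ht : 0 < t < 1 / 2) by (unfold t; lra).
assert (Hx : 1 - Rmin d1 d2 < 4 * t ^ 2 < 1).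
{ split; [|nra]. unfold t; apply Rlt_le_trans with (1 - 4 * eta); [|nra].
  apply Rmin_case; lra. }
specialize (R1 (4 * t ^ 2) ltac:(generalize (Rmin_l d1 d2); lra)).
specialize (R2 (4 * t ^ 2) ltac:(generalize (Rmin_r d1 d2); lra)).
set (P1 := PSeries f1 (4 * t ^ 2)) in *; set (P2 := PSeries f2 (4 * t ^ 2)) in *.
assert (E : K ((1 - 2 * t) / 2) = KA * P1 - 2 * KB * (t * P2)).
{ apply RtoC_inj; rewrite <- Kminus_real by (rewrite Rabs_pos_eq; lra).
  unfold Kminus, Y1, Y2; rewrite RtoC_minus, !RtoC_mult; unfold P1, P2; rewrite <- !cps_RtoC.
  now rewrite RtoC_mult, RtoC_pow. }
assert (HK := K_bound ((1 - 2 * t) / 2) ltac:(lra)); fold KA in HK.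
assert (HP1p : 0 < P1) by (apply Rlt_le_trans with (2 := R2), Rdiv_lt_0_compat; lra).
assert (HP2b : Rabs P2 <= (Rabs L + eps) * P1).
{ replace P2 with ((P2 - L * P1) + L * P1) by ring.
  apply Rle_trans with (1 := Rabs_triang _ _); rewrite (Rabs_mult L), (Rabs_pos_eq P1) by lra; lra. }
assert (T : d * P1 <= KA + KB * (2 * eta) * ((Rabs L + eps) * P1) + KB * (eps * P1)).
{ unfold d; rewrite <- (Rabs_pos_eq P1) at 1 by lra; rewrite <- Rabs_mult.
  replace ((KA - KB * L) * P1) with
    (K ((1 - 2 * t) / 2) + (- (KB * (2 * eta)) * P2 + KB * (P2 - L * P1)))
    by (rewrite E; unfold t; field).
  apply Rle_trans with (1 := Rabs_triang _ _); rewrite Rplus_assoc.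
  apply Rplus_le_compat; [rewrite Rabs_pos_eq; lra|].
  apply Rle_trans with (1 := Rabs_triang _ _); rewrite !Rabs_mult, Rabs_Ropp.
  rewrite (Rabs_pos_eq (KB * (2 * eta))) by (apply Rmult_le_pos; lra).
  rewrite (Rabs_pos_eq KB) by lra.
  apply Rplus_le_compat; apply Rmult_le_compat_l; auto; [apply Rmult_le_pos; lra|lra]. }
assert (T1 : KA <= d / 8 * P1).
{ apply Rmult_le_compat_l with (r := d / 8) in R2; [|lra].
  replace (d / 8 * (8 * KA / d)) with KA in R2 by (field; lra); exact R2. }
assert (T2 : KB * (2 * eta) * ((Rabs L + eps) * P1) <= d / 8 * P1).
{ replace (d / 8 * P1) with (KB * (2 * (d / (16 * KB * (Rabs L + eps)))) * ((Rabs L + eps) * P1))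
    by (field; lra).
  apply Rmult_le_compat_r; [apply Rmult_le_pos; lra|]; apply Rmult_le_compat_l; lra. }
assert (T3 : KB * (eps * P1) = d / 8 * P1) by (unfold eps; field; lra).
assert (0 < d * P1) by (apply Rmult_lt_0_compat; lra); lra.
Qed.

(** * Coefficients of the quotient of the two solutions *)

Lemma reciprocal_series (a : nat -> R) : exists v : nat -> R,
  v O = 1 /\ forall n, v (S n) = - rsum (S n) (fun j => v j * a (S n - j)%nat).
Proof.
(* Each coefficient depends on all earlier ones, so [F n] is the whole table up to [n]; the sequence
   is its diagonal. *)
set (F := fix F n := match n with
  | O => fun k => 1
  | S m => fun k => if Nat.eqb k (S m) then - rsum (S m) (fun j => F m j * a (S m - j)%nat) else F m k
  end).
exists (fun n => F n n).
assert (E : forall n k, (k <= n)%nat -> F n k = F k k).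
{ induction n as [|n IH]; intros k Hk; [now replace k with O by lia|].
  destruct (Nat.eq_dec k (S n)) as [->|Hne]; [reflexivity|].
  simpl F at 1; destruct (Nat.eqb_spec k (S n)); [contradiction|]; apply IH; lia. }
split; [reflexivity|].
intros n.
change (F (S n) (S n)) with (if Nat.eqb (S n) (S n)
  then - rsum (S n) (fun j => F n j * a (S n - j)%nat) else F n (S n)).
rewrite Nat.eqb_refl; apply f_equal.
apply rsum_ext; intros j Hj; rewrite E by lia; reflexivity.
Qed.

Lemma rsum_opp (n : nat) (f : nat -> R) : rsum n (fun i => - f i) = - rsum n f.
Proof.
rewrite (rsum_ext _ _ (fun i => (-1) * f i)) by (intros; ring); rewrite rsum_scal; ring.
Qed.

(* Kaluza: the coefficients of the reciprocal of a log-convex series, past the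
   constant one, are nonpositive; dividing a series with larger coefficient
   ratios by it thus leaves nonnegative coefficients. *)
Lemma kaluza_sum (a s v : nat -> R) (n : nat) :
  (forall k, 0 < a k) -> (forall k, s k <= s (S k)) ->
  rsum (S n) (fun j => v j * a (n - j)%nat) = 0 ->
  (forall j, (1 <= j <= n)%nat -> v j <= 0) ->
  0 <= rsum (S n) (fun j => v j * (s (n - j)%nat * a (n - j)%nat)).
Proof.
intros Ha Hs H0 Hv.
assert (Hm : forall k j, (k <= j)%nat -> s k <= s j).
{ intros k j Hkj; induction Hkj as [|j Hkj IH]; [lra|]; apply Rle_trans with (1 := IH), Hs. }
replace (rsum _ _) with (rsum (S n) (fun j => v j * ((s (n - j)%nat - s n) * a (n - j)%nat))).
- apply rsum_nonneg; intros [|j] Hj.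
  + rewrite Nat.sub_0_r; lra.
  + assert (v (S j) <= 0) by (apply Hv; lia).
    assert (s (n - S j)%nat <= s n) by (apply Hm; lia).
    assert (P := Ha (n - S j)%nat).
    replace (v (S j) * _) with ((- v (S j)) * ((s n - s (n - S j)%nat) * a (n - S j)%nat)) by ring.
    apply Rmult_le_pos; [lra|]; apply Rmult_le_pos; lra.
- rewrite (rsum_ext _ _ (fun j => v j * (s (n - j)%nat * a (n - j)%nat)
     + (- s n) * (v j * a (n - j)%nat))) by (intros; ring).
  rewrite rsum_plus, rsum_scal, H0; ring.
Qed.

(** The lower bound is a by-product of the recurrence, where all terms but the one for j = 0 have
    the same sign. It bounds the coefficients of the reciprocal, whose series therefore converges in
    the unit disk. *)
Lemma kaluza (a v : nat -> R) : a O = 1 -> (forall k, 0 < a k) ->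
  (forall k, a (S k) / a k <= a (S (S k)) / a (S k)) -> v O = 1 ->
  (forall n, v (S n) = - rsum (S n) (fun j => v j * a (S n - j)%nat)) ->
  forall n, - a (S n) <= v (S n) <= 0.
Proof.
intros Ha0 Ha Hr Hv0 Hv.
assert (Z : forall n, rsum (S (S n)) (fun j => v j * a (S n - j)%nat) = 0).
{ intros n; rewrite rsum_S, Nat.sub_diag, Ha0, Hv; ring. }
assert (N : forall n j, (1 <= j <= S n)%nat -> v j <= 0).
{ induction n as [|n IH]; intros j Hj.
  - replace j with 1%nat by lia; rewrite Hv; simpl; rewrite Hv0; generalize (Ha 1%nat); lra.
  - destruct (Nat.eq_dec j (S (S n))) as [->|]; [|apply IH; lia].
    rewrite Hv.
    (* Multiplying a by the ratio of successive terms shifts it by one, so the nonnegative sum is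
       minus the next coefficient. *)
    assert (K := kaluza_sum a (fun k => a (S k) / a k) v (S n) Ha Hr (Z n) IH).
    rewrite (rsum_ext _ _ (fun j => v j * a (S (S n) - j)%nat)) in K; [lra|].
    intros i Hi; replace (S (S n) - i)%nat with (S (S n - i)) by lia.
    generalize (Ha (S n - i)%nat); intros; field; lra. }
intros n; split; [|apply (N n); lia].
rewrite Hv; apply Ropp_le_contravar.
change (S n) with (1 + n)%nat at 1; rewrite rsum_add.
simpl (rsum 1 _); rewrite Hv0, Rplus_0_l, Rmult_1_l.
assert (0 <= rsum n (fun i => - (v (1 + i)%nat * a (S n - (1 + i))%nat))).
{ apply rsum_nonneg; intros i Hi.
  assert (v (1 + i)%nat <= 0) by (apply (N n); lia).
  generalize (Ha (S n - (1 + i))%nat); nra. }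
rewrite rsum_opp in H; lra.
Qed.

Lemma hc_le_1 (a b c : R) (n : nat) : 0 < a -> 0 < b -> 0 < c ->
  (forall k, (a + INR k) * (b + INR k) <= (c + INR k) * INR (S k)) -> hc a b c n <= 1.
Proof.
intros Ha Hb Hc H; induction n as [|n IH]; [rewrite hc_0; lra|].
rewrite hc_S by auto.
assert (P := hc_pos a b c n Ha Hb Hc); assert (Hn := pos_INR n).
assert (D : 0 < (c + INR n) * INR (S n)) by (rewrite S_INR; apply Rmult_lt_0_compat; lra).
assert (Q : (a + INR n) * (b + INR n) / ((c + INR n) * INR (S n)) <= 1).
{ apply Rmult_le_reg_r with (1 := D); unfold Rdiv; rewrite Rmult_assoc, Rinv_l by lra.
  generalize (H n); lra. }
assert (0 <= (a + INR n) * (b + INR n) / ((c + INR n) * INR (S n))).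
{ apply Rmult_le_pos; [|now apply Rlt_le, Rinv_0_lt_compat]; apply Rmult_le_pos; lra. }
nra.
Qed.

Lemma f1_le_1 (n : nat) : f1 n <= 1.
Proof. apply hc_le_1; try lra; intros k; rewrite S_INR; generalize (pos_INR k); nra. Qed.

Lemma f2_le_1 (n : nat) : f2 n <= 1.
Proof. apply hc_le_1; try lra; intros k; rewrite S_INR; generalize (pos_INR k); nra. Qed.

Lemma f1_log_convex (k : nat) : f1 (S k) / f1 k <= f1 (S (S k)) / f1 (S k).
Proof.
assert (P : forall n, 0 < f1 n) by (intros; apply hc_pos; lra).
assert (R : forall n, f1 (S n) / f1 n = (1 / 4 + INR n) ^ 2 / ((1 / 2 + INR n) * (1 + INR n))).
{ intros n; specialize (P n); assert (Hn := pos_INR n); unfold f1 in *; rewrite hc_S by lra.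
  rewrite S_INR; field; lra. }
rewrite !R, S_INR; assert (Hn := pos_INR k).
apply Rminus_le_0.
match goal with |- 0 <= ?u => replace u with
  ((INR k ^ 2 + 15 / 8 * INR k + 19 / 32) /
   ((1 / 2 + INR k) * (1 + INR k) * ((1 / 2 + (INR k + 1)) * (1 + (INR k + 1))))) by (field; lra) end.
apply Rmult_le_pos; [nra|apply Rlt_le, Rinv_0_lt_compat].
repeat apply Rmult_lt_0_compat; lra.
Qed.

(** The coefficient ratio f2/f1. *)
Definition f21 (n : nat) : R :=
  (pochhammer (3 / 4) n / pochhammer (1 / 4) n) ^ 2 / (2 * INR n + 1).

Lemma f21_increasing (n : nat) : f21 n <= f21 (S n).
Proof.
assert (P1 := pochhammer_pos (1 / 4) n ltac:(lra)).
assert (P3 := pochhammer_pos (3 / 4) n ltac:(lra)).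
assert (Hn := pos_INR n).
unfold f21; rewrite S_INR; simpl pochhammer.
set (q := pochhammer (3 / 4) n / pochhammer (1 / 4) n).
replace (pochhammer (3 / 4) n * (3 / 4 + INR n) / (pochhammer (1 / 4) n * (1 / 4 + INR n)))
  with (q * ((3 / 4 + INR n) / (1 / 4 + INR n))) by (unfold q; field; lra).
apply Rminus_le_0.
match goal with |- 0 <= ?u => replace u with
  (q ^ 2 * (((3 / 4 + INR n) ^ 2 * (2 * INR n + 1) - (1 / 4 + INR n) ^ 2 * (2 * INR n + 3)) /
   ((1 / 4 + INR n) ^ 2 * (2 * INR n + 1) * (2 * INR n + 3)))) by (field; lra) end.
apply Rmult_le_pos; [apply pow2_ge_0|].
apply Rmult_le_pos; [nra|apply Rlt_le, Rinv_0_lt_compat].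
repeat apply Rmult_lt_0_compat; lra.
Qed.

Lemma in_disk_bounded (a : nat -> R) (z : C) : (forall n, Rabs (a n) <= 1) ->
  Cmod z < 1 -> in_disk a z.
Proof. intros Ha; apply (in_disk_le_pow a 1 0); intros n; simpl; generalize (Ha n); lra. Qed.

Lemma cps_delta (a : nat -> R) (z : C) : a O = 1 -> (forall n, a (S n) = 0) -> cps a z = 1.
Proof.
intros H0 HS; unfold cps.
assert (Hz : summable (fun _ => RtoC 0)).
{ apply (ex_series_ext (V := R_NormedModule) (fun n : nat => 0 * 0 ^ n)).
  - intros n; rewrite Cmod_0; apply Rmult_0_l.
  - apply (ex_series_scal (V := R_NormedModule)), ex_series_geom; rewrite Rabs_R0; lra. }
assert (E : forall n, (RtoC (a (S n)) * z ^ S n = 0 * RtoC 0)%C) by (intros n; rewrite HS; ring).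
rewrite CSeries_incr_1, (CSeries_ext _ _ E), CSeries_scal, H0; auto.
{ change (z ^ 0)%C with (RtoC 1); ring. }
apply summable_incr_1.
apply (ex_series_ext (V := R_NormedModule) (fun _ => Cmod 0)); auto.
intros n; rewrite E; f_equal; ring.
Qed.

Lemma f1_0 : f1 0 = 1.
Proof. apply hc_0. Qed.

Lemma f2_0 : f2 0 = 1.
Proof. apply hc_0. Qed.

(** The reciprocal series of f1 is multiplied by f2; its existence also excludes zeros of f1 in the
    disk. Convergence follows from coefficients in [0, 1]: the terms past j = 0 are nonpositive,
    which leaves f2(n) <= 1 as upper bound. *)
Lemma f_quotient : exists c : nat -> R,
  (forall n, 0 <= c n) /\ (forall z, Cmod z < 1 -> in_disk c z /\
   cps f1 z <> 0 /\ (cps f1 z * cps c z = cps f2 z)%C).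
Proof.
assert (P1 : forall n, 0 < f1 n) by (intros; apply hc_pos; lra).
assert (P2 : forall n, 0 < f2 n) by (intros; apply hc_pos; lra).
destruct (reciprocal_series f1) as [v [Hv0 Hv]].
assert (N := kaluza f1 v (hc_0 _ _ _) P1 f1_log_convex Hv0 Hv).
exists (PS_mult v f2).
assert (Bv : forall n, Rabs (v n) <= 1).
{ intros [|n]; [rewrite Hv0, Rabs_R1; lra|].
  apply Rabs_le; generalize (N n) (f1_le_1 (S n)); lra. }
assert (Z : forall n, PS_mult v f1 (S n) = 0).
{ intros n; unfold PS_mult; rewrite <- rsum_sum_f_R0, rsum_S, Nat.sub_diag, Hv.
  rewrite f1_0; ring. }
assert (Hc : forall n, 0 <= PS_mult v f2 n <= 1).
{ intros [|n].
  - unfold PS_mult; simpl; rewrite Hv0, f2_0; lra.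
  - split.
    + unfold PS_mult; rewrite <- rsum_sum_f_R0.
      rewrite (rsum_ext _ _ (fun j => v j * (f21 (S n - j)%nat * f1 (S n - j)%nat)))
        by (intros; rewrite f2_f1; reflexivity).
      apply kaluza_sum; auto using f21_increasing.
      * rewrite rsum_sum_f_R0; apply Z.
      * intros [|j] Hj; [lia|]; apply N.
    + unfold PS_mult; rewrite <- rsum_sum_f_R0.
      change (S (S n)) with (1 + S n)%nat; rewrite rsum_add.
      assert (0 <= rsum (S n) (fun i => - (v (1 + i)%nat * f2 (S n - (1 + i))%nat))).
      { apply rsum_nonneg; intros i Hi; generalize (N i) (P2 (S n - (1 + i))%nat); simpl; nra. }
      rewrite rsum_opp in H; simpl (rsum 1 _); rewrite Hv0, Rplus_0_l, Rmult_1_l.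
      generalize (f2_le_1 (S n)); lra. }
split; [apply Hc|].
intros z Hz.
assert (I1 : in_disk f1 z) by (apply in_disk_hc; lra).
assert (I2 : in_disk f2 z) by (apply in_disk_hc; lra).
assert (Iv : in_disk v z) by (apply in_disk_bounded; auto).
assert (E1 : (cps v z * cps f1 z = 1)%C).
{ rewrite <- cps_mult by auto; apply cps_delta; auto.
  unfold PS_mult; simpl; rewrite Hv0, f1_0; ring. }
split; [|split].
- apply in_disk_bounded; auto; intros n; rewrite Rabs_pos_eq; apply Hc.
- intros E0; rewrite E0, Cmult_0_r in E1; apply RtoC_inj in E1; lra.
- rewrite cps_mult by auto.
  transitivity ((cps v z * cps f1 z) * cps f2 z)%C; [ring|rewrite E1; ring].
Qed.

Definition kappa : R := 2 * PI * Omega_i ^ 2.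

Lemma kappa_pos : 0 < kappa.
Proof.
assert (E := KA_kappa); fold kappa in E.
assert (A := KA_ge_1); assert (B := KB_pos).
apply Rnot_le_lt; intros N; nra.
Qed.

Lemma Y1_neq_0 (z : C) : Cmod z < 1 / 2 -> Y1 z <> 0.
Proof.
intros Hz; destruct f_quotient as [c [_ H]].
apply (H (4 * z ^ 2)%C (Cmod_4sq z Hz)).
Qed.

Lemma Cmod_Y2_lt (z : C) : Cmod z < 1 / 2 -> Cmod (Y2 z) < kappa * Cmod (Y1 z).
Proof.
intros Hz; destruct f_quotient as [c [Hc H]].
set (r := Cmod z) in *; assert (Hr : 0 <= r) by apply Cmod_ge_0.
destruct (H (4 * z ^ 2)%C (Cmod_4sq z Hz)) as [I [N E]].
assert (Hr' : Cmod r < 1 / 2) by (rewrite Cmod_R, Rabs_pos_eq; lra).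
destruct (H (4 * r ^ 2)%C (Cmod_4sq r Hr')) as [I' [N' E']].
assert (Hn := Y1_neq_0 z Hz); apply Cmod_gt_0 in Hn.
unfold Y2; rewrite <- E; fold (Y1 z).
replace (z * (Y1 z * cps c (4 * z ^ 2)))%C with (z * cps c (4 * z ^ 2) * Y1 z)%C by ring.
rewrite Cmod_mult; apply Rmult_lt_compat_r; auto.
rewrite Cmod_mult; fold r.
set (x := 4 * r ^ 2).
assert (Ex : Cmod (4 * z ^ 2) = x).
{ rewrite Cmod_mult, Cmod_pow, Cmod_R, Rabs_pos_eq by lra; reflexivity. }
apply Rle_lt_trans with (r * PSeries c x).
{ apply Rmult_le_compat_l; auto; rewrite <- Ex; now apply Cmod_cps. }
assert (Hx : (4 * r ^ 2)%C = RtoC x) by (unfold x; now rewrite RtoC_mult, RtoC_pow).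
rewrite Hx, !cps_RtoC, <- RtoC_mult in E'; apply RtoC_inj in E'.
(* On the real axis the claim amounts to K > 0, since 2 KB (kappa Y1 - Y2) equals K((1 - 2r)/2). *)
assert (HK := Kminus_real r ltac:(rewrite Rabs_pos_eq; lra)).
unfold Kminus, Y1, Y2 in HK; rewrite Hx, !cps_RtoC, <- !RtoC_mult, <- RtoC_minus in HK.
apply RtoC_inj in HK.
assert (HK1 := K_ge_1 ((1 - 2 * r) / 2) ltac:(lra)).
assert (Hx01 : 0 <= x < 1) by (unfold x; nra).
assert (P : 1 <= PSeries f1 x).
{ assert (P0 : PSeries f1 0 = 1) by (rewrite PSeries_0; apply hc_0).
  rewrite <- P0; apply PSeries_le; try lra.
  - intros n; apply Rlt_le, hc_pos; lra.
  - unfold f1; rewrite CV_radius_hc by lra; apply Rbar_le_refl. }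
assert (EK := KA_kappa); fold kappa in EK.
assert (B := KB_pos).
rewrite <- E', EK in HK.
apply Rnot_le_lt; intros L.
assert (2 * KB * PSeries f1 x * (kappa - r * PSeries c x) <= 0); [|lra].
assert (0 <= 2 * KB * PSeries f1 x) by (apply Rmult_le_pos; lra); nra.
Qed.

(** * Ramanujan's system in the variable t *)

(** The real part is (|a|^2 - |b|^2)/|a - b|^2. With a = KA Y1 and b = 2 KB Y2 the quotient is
    Kplus/Kminus. *)
Lemma Re_cayley_pos (a b : C) : Cmod b < Cmod a ->
  (a - b <> 0)%C /\ 0 < Re ((a + b) / (a - b)).
Proof.
intros Hab.
assert (Hn : (a - b <> 0)%C).
{ intros E; replace b with (a - (a - b))%C in Hab by ring; rewrite E in Hab.
  replace (a - 0)%C with a in Hab by ring; lra. }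
split; auto.
assert (Hp : 0 < Cmod (a - b) ^ 2) by (apply pow_lt; now apply Cmod_gt_0).
assert (Ha := Cmod2_alt a); assert (Hb := Cmod2_alt b).
assert (H2 : Cmod b ^ 2 < Cmod a ^ 2) by (generalize (Cmod_ge_0 b); nra).
rewrite Cmod2_alt in Hp.
replace (Re ((a + b) / (a - b))) with ((Cmod a ^ 2 - Cmod b ^ 2) / (Re (a - b)%C ^ 2 + Im (a - b)%C ^ 2)).
- apply Rdiv_lt_0_compat; auto; lra.
- rewrite Ha, Hb; destruct a as [a1 a2], b as [b1 b2]; simpl in *; field.
  unfold Re, Im in Hp; simpl in Hp; lra.
Qed.

Lemma KA_Y1_Y2 (z : C) : Cmod z < 1 / 2 -> Cmod (2 * KB * Y2 z) < Cmod (KA * Y1 z).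
Proof.
intros Hz; assert (L := Cmod_Y2_lt z Hz).
assert (EK := KA_kappa); fold kappa in EK.
assert (B := KB_pos); assert (A := KA_ge_1).
rewrite !Cmod_mult, !Cmod_R, !Rabs_pos_eq by lra.
rewrite EK, (Rmult_assoc (2 * KB)); apply Rmult_lt_compat_l; lra.
Qed.

Lemma Kminus_neq_0 (z : C) : Cmod z < 1 / 2 -> Kminus z <> 0.
Proof. intros Hz; apply Re_cayley_pos; now apply KA_Y1_Y2. Qed.

Definition nm (z : C) : C := (- Cexp (- PI * (Kplus z / Kminus z)))%C.

Lemma Cmod_Cexp (z : C) : Cmod (Cexp z) = exp (Re z).
Proof.
unfold Cexp, Cmod; simpl fst; simpl snd.
replace (_ + _) with (exp (Re z) ^ 2 * (Rsqr (sin (Im z)) + Rsqr (cos (Im z)))) by (unfold Rsqr; ring).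
rewrite sin2_cos2, Rmult_1_r; apply sqrt_pow2, Rlt_le, exp_pos.
Qed.

Lemma Cmod_nm (z : C) : Cmod z < 1 / 2 -> Cmod (nm z) < 1.
Proof.
intros Hz; unfold nm; rewrite Cmod_opp, Cmod_Cexp, <- exp_0; apply exp_increasing.
rewrite <- RtoC_opp, re_scal_l.
assert (H := proj2 (Re_cayley_pos _ _ (KA_Y1_Y2 z Hz))); fold (Kplus z) (Kminus z) in H.
generalize PI_RGT_0; nra.
Qed.

Definition VKminus (z : C) : C := (KA * V1 z - 2 * KB * V2 z)%C.

Lemma cdiff_Kminus (z : C) : Cmod z < 1 / 2 -> cdiff Kminus z (VKminus z / (1 - 4 * z ^ 2))%C.
Proof.
intros Hz; eapply cdiff_eq; [|apply cdiff_minus; apply cdiff_scal; [now apply cdiff_Y1|now apply cdiff_Y2]].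
unfold VKminus, V1, V2; field; now apply one_minus_4sq_neq_0.
Qed.

Lemma cdiff_Kplus (z : C) : Cmod z < 1 / 2 ->
  cdiff Kplus z ((KA * V1 z + 2 * KB * V2 z) / (1 - 4 * z ^ 2))%C.
Proof.
intros Hz; eapply cdiff_eq; [|apply cdiff_plus; apply cdiff_scal; [now apply cdiff_Y1|now apply cdiff_Y2]].
unfold V1, V2; field; now apply one_minus_4sq_neq_0.
Qed.

Lemma cdiff_VKminus (z : C) : Cmod z < 1 / 2 -> cdiff VKminus z (Kminus z).
Proof.
intros Hz; apply cdiff_minus; apply cdiff_scal; [now apply cdiff_V1|now apply cdiff_V2].
Qed.

(** This is - x(1 - x) K(x)^2 at x = (1 - 2z)/2; the sign is that of dx/dz. *)
Definition wt (z : C) : C := (- ((1 - 4 * z ^ 2) * Kminus z ^ 2) / 4)%C.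

Lemma wt_neq_0 (z : C) : Cmod z < 1 / 2 -> wt z <> 0.
Proof.
intros Hz; unfold wt.
assert (A := one_minus_4sq_neq_0 z Hz); assert (B := Kminus_neq_0 z Hz).
assert (B2 := Cpow_nz _ 2 B).
intros E; apply (Cmult_neq_0 _ _ A B2).
replace (_ * _)%C with (- 4 * (- ((1 - 4 * z ^ 2) * Kminus z ^ 2) / 4))%C by (field).
rewrite E; ring.
Qed.

Lemma cdiff_nm (z : C) : Cmod z < 1 / 2 -> cdiff nm z (nm z / wt z)%C.
Proof.
intros Hz.
assert (A := one_minus_4sq_neq_0 z Hz); assert (B := Kminus_neq_0 z Hz).
assert (W := wronskian_Y z Hz).
(* Legendre's relation at x = 1/2 normalises the Wronskian of [Kplus] and [Kminus]. *)
assert (E : (4 * PI * KA * KB = 4)%C).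
{ rewrite <- !RtoC_mult; f_equal; rewrite Rmult_assoc, KA_KB; field; apply PI_neq0. }
apply (cdiff_ext (fun x => (- (1)) * Cexp (- PI * (Kplus x * / Kminus x)))%C).
{ intros x; unfold nm, Cdiv; ring. }
eapply cdiff_eq; [|apply cdiff_scal, cdiff_Cexp, cdiff_scal, cdiff_mult;
  [now apply cdiff_Kplus|apply cdiff_inv; [exact B|now apply cdiff_Kminus]]].
unfold nm; change (Kplus z / Kminus z)%C with (Kplus z * / Kminus z)%C.
set (e := Cexp _).
unfold wt.
transitivity (e * (4 * PI * KA * KB) * (Y1 z * V2 z - Y2 z * V1 z) / ((1 - 4 * z ^ 2) * Kminus z ^ 2))%C.
- assert (E2 : (Kplus z = 2 * KA * Y1 z - Kminus z)%C) by (unfold Kplus, Kminus; ring).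
  unfold VKminus; rewrite E2.
  assert (E3 : (2 * KB * Y2 z = KA * Y1 z - Kminus z)%C) by (unfold Kminus; ring).
  transitivity (e * (PI * (2 * KA * Y1 z * (2 * KB * V2 z) - 2 * KA * V1 z * (2 * KB * Y2 z))) / ((1 - 4 * z ^ 2) * Kminus z ^ 2))%C.
  + rewrite E3; field; split; auto.
  + field; split; auto.
- rewrite E, W; field; repeat split; auto.
Qed.

(** With x = (1 - 2z)/2: 2z = 1 - 2x, 16z^2 - 3 = 1 - 16x(1 - x), and [VKminus] corresponds to -4
    Phi. [Pt] is the logarithmic derivative, along N d/dN, of x(1 - x) K^12, which is the
    discriminant up to a constant. *)
Definition Pt (z : C) : C := (2 * z * Kminus z ^ 2 - 3 * Kminus z * VKminus z)%C.
Definition Qt (z : C) : C := (Kminus z ^ 4 * (16 * z ^ 2 - 3))%C.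
Definition Rt (z : C) : C := (Kminus z ^ 6 * (2 * z * (9 - 32 * z ^ 2)))%C.

(* Ramanujan's system with respect to [z], where [nm z] moves at speed [nm z / wt z]. *)
Definition ramanujan_sys (P Q U : C -> C) : Prop := forall z, Cmod z < 1 / 2 ->
  cdiff P z ((P z * P z - Q z) / (12 * wt z))%C /\
  cdiff Q z ((P z * Q z - U z) / (3 * wt z))%C /\
  cdiff U z ((P z * U z - Q z * Q z) / (2 * wt z))%C.

Lemma ramanujan_sys_eisenstein :
  ramanujan_sys (fun z => cE2 (nm z)) (fun z => cE4 (nm z)) (fun z => cE6 (nm z)).
Proof.
intros z Hz; assert (Hn := Cmod_nm z Hz); assert (W := wt_neq_0 z Hz).
destruct (ramanujan (nm z) Hn) as [R1 [R2 R3]].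
assert (N := cdiff_nm z Hz).
split; [|split].
- eapply cdiff_eq; [|apply (cdiff_comp cE2 nm); [exact N|apply cps_cdiff; now apply in_disk_eis]].
  rewrite <- R1; field; repeat split; auto.
- eapply cdiff_eq; [|apply (cdiff_comp cE4 nm); [exact N|apply cps_cdiff; now apply in_disk_eis]].
  rewrite <- R2; field; repeat split; auto.
- eapply cdiff_eq; [|apply (cdiff_comp cE6 nm); [exact N|apply cps_cdiff; now apply in_disk_eis]].
  rewrite <- R3; field; repeat split; auto.
Qed.

Lemma cdiff_sq (f : C -> C) (z l : C) : cdiff f z l -> cdiff (fun x => f x ^ 2)%C z (2 * f z * l)%C.
Proof.
intros Hf; apply (cdiff_ext (fun x => f x * f x)%C); [intros x; ring|].
eapply cdiff_eq; [|apply cdiff_mult; exact Hf]; ring.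
Qed.

Lemma ramanujan_sys_hypergeometric : ramanujan_sys Pt Qt Rt.
Proof.
intros z Hz.
assert (A := one_minus_4sq_neq_0 z Hz); assert (B := Kminus_neq_0 z Hz).
assert (DK := cdiff_Kminus z Hz); assert (DV := cdiff_VKminus z Hz).
assert (DK2 := cdiff_sq _ _ _ DK); assert (DK4 := cdiff_sq _ _ _ DK2).
assert (Dz2 := cdiff_sq _ _ _ (cdiff_id z)).
split; [|split].
- apply (cdiff_ext (fun z => 2 * z * Kminus z ^ 2 - 3 * (Kminus z * VKminus z))%C).
  { intros x; unfold Pt; ring. }
  eapply cdiff_eq; [|apply cdiff_minus; [apply cdiff_mult; [apply cdiff_scal, cdiff_id|exact DK2]|
    apply cdiff_scal, cdiff_mult; [exact DK|exact DV]]].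
  unfold Pt, Qt, wt; cbv beta; field; repeat split; auto.
- apply (cdiff_ext (fun z => (Kminus z ^ 2) ^ 2 * (16 * z ^ 2 - 3))%C).
  { intros x; unfold Qt; ring. }
  eapply cdiff_eq; [|apply cdiff_mult; [exact DK4|
     apply cdiff_minus; [apply cdiff_scal, Dz2|apply cdiff_const]]].
  unfold Pt, Qt, Rt, wt; cbv beta; field; repeat split; auto.
- apply (cdiff_ext (fun z => (Kminus z ^ 2) ^ 2 * Kminus z ^ 2 * (2 * z * (9 - 32 * z ^ 2)))%C).
  { intros x; unfold Rt; ring. }
  eapply cdiff_eq; [|apply cdiff_mult; [apply cdiff_mult; [exact DK4|exact DK2]|
     apply cdiff_mult; [apply cdiff_scal, cdiff_id|
     apply cdiff_minus; [apply cdiff_const|apply cdiff_scal, Dz2]]]].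
  unfold Pt, Qt, Rt, wt; cbv beta; field; repeat split; auto.
Qed.

(** * Gronwall's inequality and uniqueness for Ramanujan's system *)

Lemma nonincreasing_of_derive (f df : R -> R) (a b : R) : a <= b ->
  (forall x, a <= x <= b -> is_derive f x (df x)) -> (forall x, a <= x <= b -> df x <= 0) ->
  f b <= f a.
Proof.
intros Hab Hd Hn.
destruct (MVT_gen f a b df) as [c [Hc E]].
- rewrite Rmin_left, Rmax_right by auto; intros x Hx; apply Hd; lra.
- rewrite Rmin_left, Rmax_right by auto; intros x Hx; now apply is_derive_continuity with (df x), Hd.
- rewrite Rmin_left, Rmax_right in Hc by auto; specialize (Hn c Hc); nra.
Qed.

Lemma gronwall_zero (E dE : R -> R) (M : R) :
  (forall u, 0 <= u <= 1 -> is_derive E u (dE u)) ->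
  (forall u, 0 <= u <= 1 -> dE u <= M * E u) -> E 0 = 0 -> E 1 <= 0.
Proof.
intros Hd Hle H0.
assert (D : E 1 * exp (- M * 1) <= E 0 * exp (- M * 0)).
{ apply (nonincreasing_of_derive (fun u => E u * exp (- M * u))
    (fun u => (dE u - M * E u) * exp (- M * u))); [lra| |].
  - intros u Hu; assert (A := Hd u Hu); auto_derive; [eexists; exact A|].
    rewrite (is_derive_unique (fun x : R => E x) u _ A); ring.
  - intros u Hu; specialize (Hle u Hu); assert (P := exp_pos (- M * u)); nra. }
rewrite H0 in D; assert (P := exp_pos (- M * 1)); nra.
Qed.

Lemma pd_continuity_Cmod (f : R -> C) (u : R) (l : C) :
  pd f u l -> continuity_pt (fun x => Cmod (f x)) u.
Proof.
intros [F1 F2].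
assert (E : forall x, sqrt (Re (f x) * Re (f x) + Im (f x) * Im (f x)) = Cmod (f x)).
{ intros x; unfold Cmod, Re, Im; simpl; f_equal; ring. }
intros eps Heps.
destruct (continuity_pt_comp (fun x => Re (f x) * Re (f x) + Im (f x) * Im (f x)) sqrt u) with (eps := eps)
  as [d [Hd H]]; auto.
- assert (C1 := is_derive_continuity _ _ _ F1); assert (C2 := is_derive_continuity _ _ _ F2).
  apply (continuity_pt_plus (fun x => Re (f x) * Re (f x)) (fun x => Im (f x) * Im (f x)));
   apply (continuity_pt_mult (fun x => _ (f x))); auto.
- apply continuity_pt_sqrt; nra.
- exists d; split; auto; intros x Hx; specialize (H x Hx); unfold comp in H; now rewrite !E in H.
Qed.

Lemma pd_bounded (f : R -> C) : (forall u, 0 <= u <= 1 -> exists l, pd f u l) ->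
  exists M, 0 <= M /\ forall u, 0 <= u <= 1 -> Cmod (f u) <= M.
Proof.
intros H.
destruct (continuity_ab_maj (fun x => Cmod (f x)) 0 1) as [m [Hm _]]; [lra| |].
- intros c Hc; destruct (H c Hc) as [l Hl]; now apply (pd_continuity_Cmod f c l).
- exists (Cmod (f m)); split; [apply Cmod_ge_0|exact Hm].
Qed.

Lemma pd_Cmod2 (f : R -> C) (u : R) (l : C) : pd f u l ->
  is_derive (fun x => Re (f x) * Re (f x) + Im (f x) * Im (f x)) u
    (2 * (Re (f u) * Re l + Im (f u) * Im l)).
Proof.
intros [F1 F2].
assert (D : forall g h : R -> R, forall k l, is_derive (fun x : R => g x) u k -> is_derive (fun x : R => h x) u l ->
  is_derive (fun x => g x * g x + h x * h x) u (2 * (g u * k + h u * l))).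
{ intros g h k m A B; auto_derive; [repeat split; now eexists; eassumption|].
  rewrite (is_derive_unique _ _ _ A), (is_derive_unique _ _ _ B); ring. }
exact (D _ _ _ _ F1 F2).
Qed.

Lemma Cauchy_Schwarz_C (a b : C) : Re a * Re b + Im a * Im b <= Cmod a * Cmod b.
Proof.
rewrite <- Cmod_conj, <- Cmod_mult.
apply Rle_trans with (2 := re_le_Cmod _), Rle_trans with (2 := Rle_abs _).
destruct a as [a1 a2], b as [b1 b2]; simpl; lra.
Qed.

Lemma linear_system_zero (d1 d2 d3 e1 e2 e3 : R -> C) (M : R) : 0 <= M ->
  (forall u, 0 <= u <= 1 -> pd d1 u (e1 u) /\ pd d2 u (e2 u) /\ pd d3 u (e3 u)) ->
  (forall u, 0 <= u <= 1 -> let s := M * (Cmod (d1 u) + Cmod (d2 u) + Cmod (d3 u)) in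
    Cmod (e1 u) <= s /\ Cmod (e2 u) <= s /\ Cmod (e3 u) <= s) ->
  d1 0%R = 0 -> d2 0%R = 0 -> d3 0%R = 0 -> d1 1%R = 0 /\ d2 1%R = 0 /\ d3 1%R = 0.
Proof.
intros HM Hd Hb H1 H2 H3.
set (E := fun u => (Re (d1 u) * Re (d1 u) + Im (d1 u) * Im (d1 u)) +
  ((Re (d2 u) * Re (d2 u) + Im (d2 u) * Im (d2 u)) + (Re (d3 u) * Re (d3 u) + Im (d3 u) * Im (d3 u)))).
assert (HE : E 1 <= 0).
(* Cauchy-Schwarz bounds the derivative by 2M (x + y + z)^2 with x, y, z the three moduli, and (x +
   y + z)^2 <= 3 (x^2 + y^2 + z^2) gives the rate 6M. *)
{ apply gronwall_zero with (dE := fun u => 2 * (Re (d1 u) * Re (e1 u) + Im (d1 u) * Im (e1 u)) +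
    (2 * (Re (d2 u) * Re (e2 u) + Im (d2 u) * Im (e2 u)) + 2 * (Re (d3 u) * Re (e3 u) + Im (d3 u) * Im (e3 u))))
    (M := 6 * M).
  - intros u Hu; destruct (Hd u Hu) as [A1 [A2 A3]].
    apply (is_derive_plus (V := R_NormedModule)); [now apply pd_Cmod2|].
    apply (is_derive_plus (V := R_NormedModule)); now apply pd_Cmod2.
  - intros u Hu; destruct (Hb u Hu) as [B1 [B2 B3]]; unfold E.
    assert (Q : forall z, Re z * Re z + Im z * Im z = Cmod z ^ 2) by (intros z; rewrite Cmod2_alt; ring).
    rewrite !Q.
    assert (S1 := Cauchy_Schwarz_C (d1 u) (e1 u)); assert (S2 := Cauchy_Schwarz_C (d2 u) (e2 u));
     assert (S3 := Cauchy_Schwarz_C (d3 u) (e3 u)).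
    assert (P1 := Cmod_ge_0 (d1 u)); assert (P2 := Cmod_ge_0 (d2 u)); assert (P3 := Cmod_ge_0 (d3 u)).
    apply (Rmult_le_compat_l _ _ _ P1) in B1; apply (Rmult_le_compat_l _ _ _ P2) in B2;
     apply (Rmult_le_compat_l _ _ _ P3) in B3.
    set (x := Cmod (d1 u)) in *; set (y := Cmod (d2 u)) in *; set (z := Cmod (d3 u)) in *.
    apply Rle_trans with (2 * (M * (x + y + z) ^ 2)); [lra|].
    assert ((x + y + z) ^ 2 <= 3 * (x ^ 2 + (y ^ 2 + z ^ 2))).
    { generalize (pow2_ge_0 (x - y)) (pow2_ge_0 (y - z)) (pow2_ge_0 (x - z)); lra. }
    assert (M * (x + y + z) ^ 2 <= M * (3 * (x ^ 2 + (y ^ 2 + z ^ 2)))) by now apply Rmult_le_compat_l.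
    lra.
  - unfold E; rewrite H1, H2, H3; simpl; ring. }
unfold E in HE.
assert (Z : forall z : C, Re z * Re z + Im z * Im z <= 0 -> z = 0).
{ intros z Hz; apply Cmod_eq_0.
  assert (Q : Cmod z ^ 2 <= 0) by (rewrite Cmod2_alt; lra).
  generalize (Cmod_ge_0 z); nra. }
assert (N : forall z : C, 0 <= Re z * Re z + Im z * Im z) by (intros z; nra).
generalize (N (d1 1)) (N (d2 1)) (N (d3 1)); intros N1 N2 N3.
repeat split; apply Z; lra.
Qed.

(** Along the segment from z0 to z1 the differences solve a linear system, because P^2 - P'^2 = (P +
    P')(P - P') and likewise for the other products; its coefficients are bounded there. *)
Lemma ramanujan_sys_unique (P Q U P' Q' U' : C -> C) (z0 z1 : C) :
  ramanujan_sys P Q U -> ramanujan_sys P' Q' U' -> Cmod z0 < 1 / 2 -> Cmod z1 < 1 / 2 ->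
  P z0 = P' z0 -> Q z0 = Q' z0 -> U z0 = U' z0 ->
  P z1 = P' z1 /\ Q z1 = Q' z1 /\ U z1 = U' z1.
Proof.
intros S S' Hz0 Hz1 EP EQ ER.
set (g := fun u : R => (z0 + u * (z1 - z0))%C).
assert (Hg : forall u, 0 <= u <= 1 -> Cmod (g u) < 1 / 2).
{ intros u Hu; unfold g; replace (z0 + u * (z1 - z0))%C with ((1 - u)%R * z0 + u * z1)%C
    by (rewrite RtoC_minus; ring).
  apply Rle_lt_trans with (1 := Cmod_triangle _ _).
  rewrite !Cmod_mult, !Cmod_R, !Rabs_pos_eq by lra.
  destruct (Req_dec u 0) as [->|]; [lra|].
  assert (0 < u) by lra.
  assert ((1 - u) * Cmod z0 <= (1 - u) * (1 / 2)) by (apply Rmult_le_compat_l; lra).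
  assert (u * Cmod z1 < u * (1 / 2)) by (apply Rmult_lt_compat_l; lra).
  lra. }
assert (Dg : forall u, pd g u (z1 - z0)%C).
{ intros u; eapply pd_eq; [|apply pd_plus; [apply pd_const|
    apply pd_mult; [apply pd_RtoC, (is_derive_id (K := R_AbsRing) u)|apply pd_const]]].
  change (RtoC one) with (RtoC 1); cbv beta; ring. }
assert (Dc : forall f z l u, cdiff f z l -> g u = z -> pd (fun u => f (g u)) u (l * (z1 - z0))%C).
{ intros f z l u Hf Hz; apply Hf; auto. }
assert (Bd : forall f, (forall z, Cmod z < 1 / 2 -> exists l, cdiff f z l) ->
  exists M, 0 <= M /\ forall u, 0 <= u <= 1 -> Cmod (f (g u)) <= M).
{ intros f Hf; apply (pd_bounded (fun u => f (g u))); intros u Hu.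
  destruct (Hf (g u) (Hg u Hu)) as [l Hl]; eexists; apply (Dc f (g u) l u Hl); auto. }
assert (Bi : exists M, 0 <= M /\ forall u, 0 <= u <= 1 -> Cmod (/ wt (g u)) <= M).
{ apply (Bd (fun z => / wt z)%C); intros z Hz; eexists.
  apply cdiff_inv; [now apply wt_neq_0|].
  apply (cdiff_ext (fun z => (- / 4) * ((1 - 4 * z ^ 2) * Kminus z ^ 2))%C).
  { intros x; unfold wt; field. }
  apply cdiff_scal, cdiff_mult; [apply cdiff_1m4sq|apply cdiff_sq; now apply cdiff_Kminus]. }
assert (BS : forall A B D, ramanujan_sys A B D -> exists M, 0 <= M /\ forall u, 0 <= u <= 1 ->
  Cmod (A (g u)) <= M /\ Cmod (B (g u)) <= M /\ Cmod (D (g u)) <= M).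
{ intros A B D HS.
  destruct (Bd A) as [MA [HA BA]]; [intros z Hz; destruct (HS z Hz) as [X _]; eexists; exact X|].
  destruct (Bd B) as [MB [HB BB]]; [intros z Hz; destruct (HS z Hz) as [_ [X _]]; eexists; exact X|].
  destruct (Bd D) as [MD [HD BD]]; [intros z Hz; destruct (HS z Hz) as [_ [_ X]]; eexists; exact X|].
  exists (MA + MB + MD); split; [lra|]; intros u Hu.
  generalize (BA u Hu) (BB u Hu) (BD u Hu); lra. }
destruct Bi as [Mi [Mi0 Bi]], (BS _ _ _ S) as [MS [MS0 BS1]], (BS _ _ _ S') as [MS' [MS0' BS2]].
set (c := Cmod (z1 - z0)); assert (Hc : 0 <= c) by apply Cmod_ge_0.
(* Dominates every coefficient of the linear system: sums of two components, single components and
   the constant 1. *)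
set (T := 1 + MS + MS').
destruct (linear_system_zero
  (fun u => P (g u) - P' (g u))%C (fun u => Q (g u) - Q' (g u))%C (fun u => U (g u) - U' (g u))%C
  (fun u => / wt (g u) * (z1 - z0) * (/ 12 * ((P (g u) + P' (g u)) * (P (g u) - P' (g u)) + (- (1)) * (Q (g u) - Q' (g u)))))%C
  (fun u => / wt (g u) * (z1 - z0) * (/ 3 * (Q' (g u) * (P (g u) - P' (g u))
     + P (g u) * (Q (g u) - Q' (g u)) + (- (1)) * (U (g u) - U' (g u)))))%C
  (fun u => / wt (g u) * (z1 - z0) * (/ 2 * (U' (g u) * (P (g u) - P' (g u))
     + - (Q (g u) + Q' (g u)) * (Q (g u) - Q' (g u)) + P (g u) * (U (g u) - U' (g u)))))%C
  (Mi * c * T)) as [Z1 [Z2 Z3]].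
- repeat apply Rmult_le_pos; unfold T; lra.
- intros u Hu; assert (Hw := wt_neq_0 _ (Hg u Hu)).
  destruct (S _ (Hg u Hu)) as [A1 [A2 A3]]; destruct (S' _ (Hg u Hu)) as [A1' [A2' A3']].
  split; [|split].
  + eapply pd_eq; [|apply pd_plus; [apply (Dc P _ _ u A1 eq_refl)|apply pd_opp, (Dc P' _ _ u A1' eq_refl)]].
    field; auto.
  + eapply pd_eq; [|apply pd_plus; [apply (Dc Q _ _ u A2 eq_refl)|apply pd_opp, (Dc Q' _ _ u A2' eq_refl)]].
    field; auto.
  + eapply pd_eq; [|apply pd_plus; [apply (Dc U _ _ u A3 eq_refl)|apply pd_opp, (Dc U' _ _ u A3' eq_refl)]].
    field; auto.
- intros u Hu; cbv zeta.
  specialize (Bi u Hu); destruct (BS1 u Hu) as [BP [BQ _]]; destruct (BS2 u Hu) as [BP' [BQ' BU']].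
  set (x := (P (g u) - P' (g u))%C); set (y := (Q (g u) - Q' (g u))%C); set (z := (U (g u) - U' (g u))%C).
  assert (Px := Cmod_ge_0 x); assert (Py := Cmod_ge_0 y); assert (Pz := Cmod_ge_0 z).
  assert (G : forall k a1 a2 a3 : C, Cmod k <= 1 -> Cmod a1 <= T -> Cmod a2 <= T -> Cmod a3 <= T ->
    Cmod (/ wt (g u) * (z1 - z0) * (k * (a1 * x + a2 * y + a3 * z))) <=
    Mi * c * T * (Cmod x + Cmod y + Cmod z)).
  { intros k a1 a2 a3 Hk H1 H2 H3.
    rewrite !Cmod_mult; fold c; rewrite (Rmult_assoc (Mi * c)).
    apply Rmult_le_compat; [apply Rmult_le_pos; [apply Cmod_ge_0|auto]|
      apply Rmult_le_pos; apply Cmod_ge_0|apply Rmult_le_compat_r; auto|].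
    rewrite <- (Rmult_1_l (T * _)); apply Rmult_le_compat; auto; try apply Cmod_ge_0.
    apply Rle_trans with (1 := Cmod_triangle _ _).
    apply Rle_trans with (Cmod (a1 * x) + Cmod (a2 * y) + Cmod (a3 * z)).
    { apply Rplus_le_compat_r, Cmod_triangle. }
    rewrite !Cmod_mult, !Rmult_plus_distr_l.
    repeat apply Rplus_le_compat; apply Rmult_le_compat_r; auto. }
  assert (K : forall r : R, 1 < r -> Cmod (/ r) <= 1).
  { intros r Hr; rewrite <- RtoC_inv, Cmod_R by lra.
    rewrite Rabs_pos_eq by (apply Rlt_le, Rinv_0_lt_compat; lra).
    rewrite <- Rinv_1; apply Rinv_le_contravar; lra. }
  assert (C0 : Cmod 0 <= T) by (rewrite Cmod_0; unfold T; lra).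
  assert (C1 : Cmod (- (1)) <= T) by (rewrite Cmod_opp, Cmod_1; unfold T; lra).
  split; [|split].
  (* The zero term gives this equation the three-term shape of [G]. *)
  + replace (_ + _)%C with ((P (g u) + P' (g u)) * x + (- (1)) * y + 0 * z)%C by ring.
    apply G; auto; [apply K; lra|].
    apply Rle_trans with (1 := Cmod_triangle _ _); unfold T; lra.
  + apply G; auto; [apply K; lra|unfold T; lra|unfold T; lra].
  + apply G; [apply K; lra|unfold T; lra| |unfold T; lra].
    rewrite Cmod_opp; apply Rle_trans with (1 := Cmod_triangle _ _); unfold T; lra.
- unfold g; rewrite Cmult_0_l, Cplus_0_r, EP; ring.
- unfold g; rewrite Cmult_0_l, Cplus_0_r, EQ; ring.
- unfold g; rewrite Cmult_0_l, Cplus_0_r, ER; ring.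
- unfold g in Z1, Z2, Z3; replace (z0 + 1 * (z1 - z0))%C with z1 in Z1, Z2, Z3 by ring.
  apply Ceq_minus in Z1; apply Ceq_minus in Z2; apply Ceq_minus in Z3; auto.
Qed.

(** * Behaviour at the cusp *)

Lemma near_lt (d : R) : 0 < d -> at_right 0 (fun x => 0 < x < d).
Proof.
intros Hd; exists (mkposreal d Hd); intros x Hx Hx0.
change (Rabs (x - 0) < d) in Hx; rewrite Rminus_0_r, Rabs_pos_eq in Hx; lra.
Qed.

Lemma at_right_0_elim (P : R -> Prop) : at_right 0 P ->
  exists e, 0 < e /\ forall x, 0 < x < e -> P x.
Proof.
intros [e He]; exists e; split; [apply cond_pos|]; intros x Hx; apply He; [|lra].
change (Rabs (x - 0) < e); rewrite Rminus_0_r, Rabs_pos_eq; lra.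
Qed.

Definition O2 (f : R -> R) (a b : R) : Prop :=
  exists M, 0 <= M /\ at_right 0 (fun x => Rabs (f x - (a + b * x)) <= M * x ^ 2).

Lemma O2_affine (a b : R) : O2 (fun x => a + b * x) a b.
Proof.
exists 0; split; [lra|]; apply filter_forall; intros x.
rewrite Rminus_diag, Rabs_R0; lra.
Qed.

Lemma O2_plus (f g : R -> R) (a b c d : R) :
  O2 f a b -> O2 g c d -> O2 (fun x => f x + g x) (a + c) (b + d).
Proof.
intros [M [HM Hf]] [M' [HM' Hg]]; exists (M + M'); split; [lra|].
generalize (filter_and _ _ Hf Hg); apply filter_imp; intros x [A B].
replace (f x + g x - _) with ((f x - (a + b * x)) + (g x - (c + d * x))) by ring.
apply Rle_trans with (1 := Rabs_triang _ _); lra.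
Qed.

Lemma O2_mult (f g : R -> R) (a b c d : R) :
  O2 f a b -> O2 g c d -> O2 (fun x => f x * g x) (a * c) (a * d + b * c).
Proof.
intros [M [HM Hf]] [M' [HM' Hg]].
assert (Pa := Rabs_pos a); assert (Pb := Rabs_pos b); assert (Pc := Rabs_pos c); assert (Pd := Rabs_pos d).
exists (Rabs b * Rabs d + (Rabs a + Rabs b) * M' + M * (Rabs c + Rabs d) + M * M'); split.
{ repeat apply Rplus_le_le_0_compat; apply Rmult_le_pos; lra. }
generalize (filter_and _ _ (near_lt 1 Rlt_0_1) (filter_and _ _ Hf Hg)).
apply filter_imp; clear Hf Hg; intros x [Hx [Hf Hg]].
set (r := f x - (a + b * x)) in *; set (s := g x - (c + d * x)) in *.
assert (L : forall p q, Rabs (p + q * x) <= Rabs p + Rabs q).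
{ intros p q; apply Rle_trans with (1 := Rabs_triang _ _); rewrite Rabs_mult, (Rabs_pos_eq x) by lra.
  generalize (Rabs_pos q); nra. }
replace (f x * g x - _) with (b * d * x ^ 2 + (a + b * x) * s + r * (c + d * x) + r * s)
  by (unfold r, s; ring).
assert (Hx4 : 0 <= x ^ 2 <= 1) by nra.
assert (T1 : Rabs (b * d * x ^ 2) = Rabs b * Rabs d * x ^ 2)
  by (rewrite !Rabs_mult, (Rabs_pos_eq (x ^ 2)) by lra; ring).
assert (T2 : Rabs ((a + b * x) * s) <= (Rabs a + Rabs b) * (M' * x ^ 2))
  by (rewrite Rabs_mult; apply Rmult_le_compat; auto using Rabs_pos).
assert (T3 : Rabs (r * (c + d * x)) <= M * x ^ 2 * (Rabs c + Rabs d))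
  by (rewrite Rabs_mult; apply Rmult_le_compat; auto using Rabs_pos).
assert (T4 : Rabs (r * s) <= M * (M' * x ^ 2)).
{ rewrite Rabs_mult; apply Rmult_le_compat; auto using Rabs_pos.
  apply Rle_trans with (1 := Hf); nra. }
apply Rle_trans with (1 := Rabs_triang _ _).
apply Rle_trans with (Rabs (b * d * x ^ 2) + Rabs ((a + b * x) * s) + Rabs (r * (c + d * x)) + Rabs (r * s)).
- apply Rplus_le_compat_r, Rle_trans with (1 := Rabs_triang _ _), Rplus_le_compat_r, Rabs_triang.
- rewrite T1; lra.
Qed.

Lemma O2_lipschitz (f : R -> R) (a b : R) : O2 f a b ->
  exists B, 1 <= B /\ at_right 0 (fun x => Rabs (f x - a) <= B * x).
Proof.
intros [M [HM Hf]]; exists (Rabs b + M + 1); split; [generalize (Rabs_pos b); lra|].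
generalize (filter_and _ _ (near_lt 1 Rlt_0_1) Hf); apply filter_imp; intros x [Hx A].
replace (f x - a) with ((f x - (a + b * x)) + b * x) by ring.
apply Rle_trans with (1 := Rabs_triang _ _); rewrite (Rabs_mult b), (Rabs_pos_eq x) by lra.
assert (M * x ^ 2 <= M * x) by (apply Rmult_le_compat_l; nra); lra.
Qed.

Lemma O2_near (f : R -> R) (a b eta : R) : O2 f a b -> 0 < eta ->
  at_right 0 (fun x => Rabs (f x - a) <= eta).
Proof.
intros Hf Heta; destruct (O2_lipschitz f a b Hf) as [B [HB L]].
assert (Hd : 0 < eta / B) by (apply Rdiv_lt_0_compat; lra).
generalize (filter_and _ _ (near_lt _ Hd) L).
apply filter_imp; intros x [Hx A]; apply Rle_trans with (1 := A).
replace eta with (B * (eta / B)) by (field; lra); apply Rmult_le_compat_l; lra.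
Qed.

Lemma O2_PSeries (a : nat -> R) (f : R -> R) (b : R) : Rbar_le 1 (CV_radius a) ->
  O2 f 0 b -> O2 (fun x => PSeries a (f x)) (a O) (a 1%nat * b).
Proof.
intros Ha Hf.
assert (D0 : in_disk a 0).
{ unfold in_disk; rewrite Cmod_0; apply Rbar_lt_le_trans with (2 := Ha); simpl; lra. }
destruct (cps_taylor2 a 0 D0) as [M' [d [HM' [Hd HT]]]].
destruct (O2_lipschitz f 0 b Hf) as [B [HB L]].
assert (Nr := O2_near f 0 b (d / 2) Hf ltac:(lra)).
destruct Hf as [M [HM Hf]].
exists (M' * B ^ 2 + Rabs (a 1%nat) * M); split.
{ apply Rplus_le_le_0_compat; apply Rmult_le_pos; auto; [nra|apply Rabs_pos]. }
generalize (filter_and _ _ Hf (filter_and _ _ L Nr)); apply filter_imp.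
clear Hf L Nr; intros x [Hf [Hfx Hfd]]; rewrite Rminus_0_r in Hfx, Hfd.
specialize (HT (f x)).
rewrite Cmod_R in HT; rewrite Cplus_0_l, !cps_RtoC, !PSeries_0 in HT.
specialize (HT ltac:(lra)).
rewrite <- RtoC_mult, <- !RtoC_minus, Cmod_R in HT.
change (PS_derive a 0) with (1 * a 1%nat) in HT.
replace (PSeries a (f x) - _) with
  ((PSeries a (f x) - a O - f x * (1 * a 1%nat)) + a 1%nat * (f x - (0 + b * x))) by ring.
apply Rle_trans with (1 := Rabs_triang _ _); rewrite Rmult_plus_distr_r; apply Rplus_le_compat.
- apply Rle_trans with (1 := HT); rewrite Rmult_assoc; apply Rmult_le_compat_l; auto.
  rewrite <- Rpow_mult_distr; apply pow_incr; split; [apply Rabs_pos|auto].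
- rewrite Rabs_mult, Rmult_assoc; apply Rmult_le_compat_l; [apply Rabs_pos|auto].
Qed.

Lemma O2_minus_sqr (f g : R -> R) (a b : R) : O2 f a b -> O2 g a b ->
  exists M, 0 <= M /\ at_right 0 (fun x => (f x - g x) ^ 2 <= M * x ^ 4).
Proof.
intros [M [HM Hf]] [M' [HM' Hg]].
exists ((M + M') ^ 2); split; [apply pow2_ge_0|].
generalize (filter_and _ _ Hf Hg); apply filter_imp; intros x [A B].
replace ((M + M') ^ 2 * x ^ 4) with (((M + M') * x ^ 2) ^ 2) by ring.
rewrite <- (pow2_abs (f x - g x)); apply pow_incr; split; [apply Rabs_pos|].
replace (f x - g x) with ((f x - (a + b * x)) + - (g x - (a + b * x))) by ring.
apply Rle_trans with (1 := Rabs_triang _ _); rewrite Rabs_Ropp; lra.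
Qed.

(** The condition x E' <= 3E makes E/x^3 nonincreasing, while E = O(x^4) makes it tend to 0 or below
    as x -> 0; a positive value is thus impossible. *)
Lemma singular_gronwall (E dE : R -> R) (M e : R) : 0 <= M ->
  (forall x, 0 < x < e -> is_derive E x (dE x)) ->
  (forall x, 0 < x < e -> x * dE x <= 3 * E x) ->
  (forall x, 0 < x < e -> E x <= M * x ^ 4) -> forall x, 0 < x < e -> E x <= 0.
Proof.
intros HM Hd Hle Hb x Hx.
apply Rnot_lt_le; intros HE.
assert (Hx3 : 0 < x ^ 3) by (apply pow_lt; lra).
set (k := E x / x ^ 3); assert (Hk : 0 < k) by now apply Rdiv_lt_0_compat.
(* Chosen so that M y <= k/2, in contradiction with k <= E(y)/y^3 <= M y. *)
set (y := Rmin (x / 2) (k / (2 * (M + 1)))).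
assert (Hy : 0 < y) by (apply Rmin_pos; [lra|apply Rdiv_lt_0_compat; lra]).
assert (Hyx : y <= x / 2) by apply Rmin_l.
assert (Hyk : y <= k / (2 * (M + 1))) by apply Rmin_r.
assert (D : E x / x ^ 3 <= E y / y ^ 3).
{ apply (nonincreasing_of_derive (fun x => E x / x ^ 3) (fun x => (x * dE x - 3 * E x) / x ^ 4)); [lra| |].
  - intros z Hz; assert (A := Hd z ltac:(lra)); auto_derive.
    + split; [eexists; exact A|split; auto]; apply Rgt_not_eq; change (0 < z ^ 3); apply pow_lt; lra.
    + rewrite (is_derive_unique (fun x : R => E x) z _ A); field; lra.
  - intros z Hz; specialize (Hle z ltac:(lra)).
    apply Ropp_le_cancel; rewrite Ropp_0; unfold Rdiv; rewrite Ropp_mult_distr_l.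
    apply Rmult_le_pos; [lra|apply Rlt_le, Rinv_0_lt_compat, pow_lt; lra]. }
fold k in D; specialize (Hb y ltac:(lra)).
assert (E y / y ^ 3 <= M * y).
{ apply Rmult_le_reg_r with (y ^ 3); [apply pow_lt; lra|].
  replace (E y / y ^ 3 * y ^ 3) with (E y) by (field; lra).
  replace (M * y * y ^ 3) with (M * y ^ 4) by ring; exact Hb. }
assert (M * y <= (M + 1) * (k / (2 * (M + 1)))) by (apply Rmult_le_compat; lra).
replace ((M + 1) * (k / (2 * (M + 1)))) with (k / 2) in H0 by (field; lra); lra.
Qed.

(** * Comparison of the two solutions on the real axis *)

Definition nr (x : R) : R := - exp (- PI * rho x).
Definition pE (x : R) : R := PSeries (eis (-24) 1) (nr x).
Definition qE (x : R) : R := PSeries (eis 240 3) (nr x).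
Definition rE (x : R) : R := PSeries (eis (-504) 5) (nr x).
(** [pH], [qH], [rH] are [Pt], [Qt], [Rt] in the variable x = (1 - 2z)/2. *)
Definition pH (x : R) : R := (1 - 2 * x) * K x ^ 2 + 12 * K x * Phi x.
Definition qH (x : R) : R := K x ^ 4 * (1 - 16 * x + 16 * x ^ 2).
Definition rH (x : R) : R := K x ^ 6 * ((1 - 2 * x) * (1 + 32 * x - 32 * x ^ 2)).

(** A radius r in [0, 1) would itself be a point of the open unit disk, giving r < r; a negative
    radius is excluded at the point 0. *)
Lemma CV_radius_eis (c : R) (k : nat) : Rbar_le 1 (CV_radius (eis c k)).
Proof.
apply Rbar_not_lt_le; intros H.
assert (H0 : 0 <= 1) by lra.
destruct (CV_radius (eis c k)) as [r| |] eqn:Er; simpl in H; try easy.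
- destruct (Rle_lt_dec 0 r) as [Hr|Hr].
  + assert (D := in_disk_eis c k r); unfold in_disk in D; rewrite Er, Cmod_R, Rabs_pos_eq in D by auto.
    simpl in D; specialize (D H); lra.
  + assert (D := in_disk_eis c k 0); unfold in_disk in D; rewrite Er, Cmod_0 in D.
    simpl in D; specialize (D Rlt_0_1); lra.
- assert (D := in_disk_eis c k 0); unfold in_disk in D; rewrite Er, Cmod_0 in D.
  simpl in D; exact (D Rlt_0_1).
Qed.

Lemma O2_eq (f g : R -> R) (a b c d : R) : (forall x, f x = g x) -> a = c -> b = d ->
  O2 f a b -> O2 g c d.
Proof.
intros E -> -> [M [HM H]]; exists M; split; auto.
apply filter_imp with (2 := H); intros x; now rewrite E.
Qed.

Lemma O2_nr : O2 nr 0 (- 1 / 16).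
Proof.
destruct nome_asymptotic as [M [HM H]]; exists M; split; auto.
apply filter_imp with (2 := near_lt (1 / 2) ltac:(lra)); intros x Hx; unfold nr.
replace (- exp (- PI * rho x) - _) with (- (exp (- PI * rho x) - x / 16)) by field.
rewrite Rabs_Ropp; apply H; lra.
Qed.

Lemma eis_1 (c : R) (k : nat) : eis c k 1 = c.
Proof. simpl; unfold sg, dsum; simpl; rewrite pow1; ring. Qed.

Lemma O2_pE : O2 pE 1 (3 / 2).
Proof.
eapply O2_eq; [| | |apply (O2_PSeries (eis (-24) 1) nr _ (CV_radius_eis _ _) O2_nr)]; auto.
rewrite eis_1; field.
Qed.

Lemma O2_qE : O2 qE 1 (- 15).
Proof.
eapply O2_eq; [| | |apply (O2_PSeries (eis 240 3) nr _ (CV_radius_eis _ _) O2_nr)]; auto.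
rewrite eis_1; field.
Qed.

Lemma O2_rE : O2 rE 1 (63 / 2).
Proof.
eapply O2_eq; [| | |apply (O2_PSeries (eis (-504) 5) nr _ (CV_radius_eis _ _) O2_nr)]; auto.
rewrite eis_1; field.
Qed.

Lemma O2_id : O2 (fun x => x) 0 1.
Proof. apply (O2_eq (fun x => 0 + 1 * x) _ 0 1); auto using O2_affine; intros; ring. Qed.

Lemma kc_1 : kc 1 = 1 / 4.
Proof. unfold kc, hc; simpl; field. Qed.

Lemma O2_K : O2 K 1 (1 / 4).
Proof.
eapply O2_eq; [| | |apply (O2_PSeries kc (fun x => x) 1); [|exact O2_id]]; auto.
- apply hc_0.
- rewrite kc_1; field.
- rewrite CV_radius_kc; apply Rbar_le_refl.
Qed.

Lemma O2_Phi : O2 Phi 0 (1 / 4).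
Proof.
assert (O1 : O2 K1 (1 / 4) (PS_derive kc 1)).
{ eapply O2_eq; [| | |apply (O2_PSeries (PS_derive kc) (fun x => x) 1); [|exact O2_id]]; auto.
  - unfold PS_derive; rewrite kc_1; simpl; field.
  - ring.
  - rewrite CV_radius_derive, CV_radius_kc; apply Rbar_le_refl. }
eapply O2_eq; [| | |apply O2_mult; [apply O2_mult; [exact O2_id|apply (O2_affine 1 (-1))]|exact O1]].
- intros x; unfold Phi; ring.
- ring.
- ring.
Qed.

Lemma O2_sqr (f : R -> R) (b : R) : O2 f 1 b -> O2 (fun x => f x ^ 2) 1 (2 * b).
Proof. intros H; eapply O2_eq; [| | |apply O2_mult; exact H]; intros; cbv beta; ring. Qed.

Lemma O2_pH : O2 pH 1 (3 / 2).
Proof.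
eapply O2_eq; [| | |apply O2_plus; [apply O2_mult; [apply (O2_affine 1 (-2))|apply O2_sqr, O2_K]|
  apply O2_mult; [apply (O2_affine 12 0)|apply O2_mult; [exact O2_K|exact O2_Phi]]]].
- intros x; unfold pH; cbv beta; ring.
- ring.
- field.
Qed.

Lemma O2_K4 : O2 (fun x => (K x ^ 2) ^ 2) 1 1.
Proof. eapply O2_eq; [| | |apply O2_sqr, O2_sqr, O2_K]; auto; field. Qed.

Lemma O2_qH : O2 qH 1 (- 15).
Proof.
eapply O2_eq; [| | |apply O2_mult; [exact O2_K4|apply O2_plus; [apply (O2_affine 1 (-16))|
  apply O2_mult; [apply (O2_affine 0 16)|exact O2_id]]]].
- intros x; unfold qH; cbv beta; ring.
- ring.
- ring.
Qed.

Lemma O2_rH : O2 rH 1 (63 / 2).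
Proof.
eapply O2_eq; [| | |apply O2_mult; [apply O2_mult; [exact O2_K4|apply O2_sqr, O2_K]|
  apply O2_mult; [apply (O2_affine 1 (-2))|apply O2_plus; [apply (O2_affine 1 32)|
  apply O2_mult; [apply (O2_affine 0 (-32))|exact O2_id]]]]].
- intros x; unfold rH; cbv beta; ring.
- ring.
- field.
Qed.

Definition wr (x : R) : R := x * (1 - x) * K x ^ 2.

Lemma wr_pos (x : R) : 0 < x < 1 -> 0 < wr x.
Proof.
intros Hx; assert (P := K_ge_1 x ltac:(lra)).
unfold wr; repeat apply Rmult_lt_0_compat; try lra; simpl; nra.
Qed.

Lemma rho_pos (x : R) : 0 < x < 1 -> 0 < rho x.
Proof.
intros Hx; unfold rho; apply Rdiv_lt_0_compat.
- assert (P := K_ge_1 (1 - x) ltac:(lra)); lra.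
- assert (P := K_ge_1 x ltac:(lra)); lra.
Qed.

Lemma Rabs_nr (x : R) : 0 < x < 1 -> Rabs (nr x) < 1.
Proof.
intros Hx; unfold nr; rewrite Rabs_Ropp, Rabs_pos_eq by apply Rlt_le, exp_pos.
rewrite <- exp_0; apply exp_increasing.
generalize PI_RGT_0 (rho_pos x Hx); nra.
Qed.

Lemma is_derive_nr (x : R) : 0 < x < 1 -> is_derive nr x (nr x / wr x).
Proof.
intros Hx; assert (D := is_derive_rho x Hx).
unfold nr; auto_derive; [eexists; exact D|].
rewrite (is_derive_unique (fun x : R => rho x) x _ D); unfold wr.
assert (P := K_ge_1 x ltac:(lra)); field; repeat split; try lra; apply PI_neq0.
Qed.

Lemma real_ramanujan (y : R) : Rabs y < 1 ->
  let P := PSeries (eis (-24) 1) y in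
  let Q := PSeries (eis 240 3) y in
  let U := PSeries (eis (-504) 5) y in
  12 * (y * PSeries (PS_derive (eis (-24) 1)) y) = P * P - Q /\
  3 * (y * PSeries (PS_derive (eis 240 3)) y) = P * Q - U /\
  2 * (y * PSeries (PS_derive (eis (-504) 5)) y) = P * U - Q * Q.
Proof.
intros Hy P Q U; destruct (ramanujan y) as [R1 [R2 R3]]; [now rewrite Cmod_R|].
unfold cE2, cE4, cE6 in *; rewrite !cps_RtoC in *.
rewrite <- !RtoC_mult, <- RtoC_minus in R1; rewrite <- !RtoC_mult, <- RtoC_minus in R2;
  rewrite <- !RtoC_mult, <- RtoC_minus in R3.
repeat split; apply RtoC_inj; assumption.
Qed.

Lemma is_derive_PSeries_nr (a : nat -> R) (x : R) : Rbar_le 1 (CV_radius a) -> 0 < x < 1 ->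
  is_derive (fun x => PSeries a (nr x)) x (nr x * PSeries (PS_derive a) (nr x) / wr x).
Proof.
intros Ha Hx; assert (Hn := Rabs_nr x Hx).
assert (D := is_derive_PSeries a (nr x) (Rbar_lt_le_trans (Rabs (nr x)) 1 _ Hn Ha)).
assert (E := is_derive_comp (PSeries a) nr x _ _ D (is_derive_nr x Hx)).
apply (is_derive_eq _ _ _ _ E); change (scal ?u ?v) with (u * v); field.
generalize (wr_pos x Hx); lra.
Qed.

Definition real_ramanujan_sys (p q r : R -> R) : Prop := forall x, 0 < x < 1 ->
  is_derive p x ((p x * p x - q x) / (12 * wr x)) /\
  is_derive q x ((p x * q x - r x) / (3 * wr x)) /\
  is_derive r x ((p x * r x - q x * q x) / (2 * wr x)).

Lemma real_sys_eisenstein : real_ramanujan_sys pE qE rE.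
Proof.
intros x Hx; destruct (real_ramanujan (nr x) (Rabs_nr x Hx)) as [R1 [R2 R3]].
fold (pE x) (qE x) (rE x) in R1, R2, R3; assert (W := wr_pos x Hx).
split; [|split].
- apply (is_derive_eq _ _ _ _ (is_derive_PSeries_nr _ x (CV_radius_eis (-24) 1) Hx)).
  rewrite <- R1; field; lra.
- apply (is_derive_eq _ _ _ _ (is_derive_PSeries_nr _ x (CV_radius_eis 240 3) Hx)).
  rewrite <- R2; field; lra.
- apply (is_derive_eq _ _ _ _ (is_derive_PSeries_nr _ x (CV_radius_eis (-504) 5) Hx)).
  rewrite <- R3; field; lra.
Qed.

Lemma real_sys_hypergeometric : real_ramanujan_sys pH qH rH.
Proof.
intros x Hx; assert (P := K_ge_1 x ltac:(lra)).
assert (Hx1 : Rabs x < 1) by (rewrite Rabs_pos_eq; lra).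
assert (A := is_derive_K x Hx1); assert (B := is_derive_Phi x Hx1).
assert (EA := is_derive_unique (fun x : R => K x) x _ A).
assert (EB := is_derive_unique (fun x : R => Phi x) x _ B).
split; [|split].
- unfold pH at 1; auto_derive; [repeat split; eexists; eassumption|].
  rewrite EA, EB; unfold pH, qH, wr, Phi; field; lra.
- unfold qH at 1; auto_derive; [repeat split; eexists; eassumption|].
  rewrite EA; unfold pH, qH, rH, wr, Phi; field; lra.
- unfold rH at 1; auto_derive; [repeat split; eexists; eassumption|].
  rewrite EA; unfold pH, qH, rH, wr, Phi; field; lra.
Qed.

Lemma near_product_bound (c eta a b : R) : Rabs c <= eta -> c * (a * b) <= eta * ((a ^ 2 + b ^ 2) / 2).
Proof.
intros Hc; apply Rle_trans with (1 := Rle_abs _); rewrite Rabs_mult.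
apply Rmult_le_compat; auto using Rabs_pos.
apply Rabs_le; generalize (pow2_ge_0 (a - b)) (pow2_ge_0 (a + b)); lra.
Qed.

(* The linearisation of Ramanujan's system at [(1, 1, 1)] has eigenvalues 0, 0, 1;
   the weights 1, 1/4, 1/9 keep its quadratic form close to that bound.  All that
   matters is 3 < 4: the squared difference of the two solutions is [O(x^4)]. *)
Lemma quadratic_form_bound (p p' q q' r' k a b c : R) :
  Rabs (p - 1) <= / 10 -> Rabs (p' - 1) <= / 10 -> Rabs (q - 1) <= / 10 ->
  Rabs (q' - 1) <= / 10 -> Rabs (r' - 1) <= / 10 -> 0 <= k <= 11 / 10 ->
  k * (2 * a * (((p + p') * a - b) / 12) + / 4 * (2 * b * ((p * b + q' * a - c) / 3))
    + / 9 * (2 * c * ((p * c + r' * a - (q + q') * b) / 2)))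
  <= 3 * (a ^ 2 + / 4 * b ^ 2 + / 9 * c ^ 2).
Proof.
intros Hp Hp' Hq Hq' Hr' Hk.
set (S := 2 * a * (((p + p') * a - b) / 12) + / 4 * (2 * b * ((p * b + q' * a - c) / 3))
    + / 9 * (2 * c * ((p * c + r' * a - (q + q') * b) / 2))).
set (E := a ^ 2 + / 4 * b ^ 2 + / 9 * c ^ 2).
assert (HE : 0 <= E) by (unfold E; generalize (pow2_ge_0 a) (pow2_ge_0 b) (pow2_ge_0 c); lra).
(* The linearised part needs 22/10, and the perturbations of size 1/10 raise this to 27/10; times k
   <= 11/10 it becomes 2.97, still below 3. *)
assert (HS : S <= 27 / 10 * E).
{ assert (B1 := near_product_bound _ _ a a Hp); assert (B2 := near_product_bound _ _ a a Hp').
  assert (B3 := near_product_bound _ _ (b / 2) (b / 2) Hp).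
  assert (B4 := near_product_bound _ _ a (b / 2) Hq').
  assert (B5 := near_product_bound _ _ (c / 3) (c / 3) Hp).
  assert (B6 := near_product_bound _ _ a (c / 3) Hr').
  assert (B7 : - (q - 1) * (b / 2 * (c / 3)) <= / 10 * (((b / 2) ^ 2 + (c / 3) ^ 2) / 2))
    by (apply near_product_bound; now rewrite Rabs_Ropp).
  assert (B8 : - (q' - 1) * (b / 2 * (c / 3)) <= / 10 * (((b / 2) ^ 2 + (c / 3) ^ 2) / 2))
    by (apply near_product_bound; now rewrite Rabs_Ropp).
  assert (S0 : a ^ 2 / 3 + b ^ 2 / 6 + c ^ 2 / 9 - 7 / 18 * (b * c) + a * c / 9 <= 22 / 10 * E).
  { unfold E; generalize (pow2_ge_0 (b / 2 + c / 3)) (pow2_ge_0 (a - c / 3)); intros.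
    generalize (pow2_ge_0 a) (pow2_ge_0 b) (pow2_ge_0 c); nra. }
  unfold S, E in *; nra. }
unfold E in *; nra.
Qed.

(** A single point suffices, as initial value for the complex system. The threshold 1/11 on x makes
    x/wr = 1/((1 - x) K^2) at most 11/10, the range of k in the quadratic form estimate. *)
Lemma real_sys_agree : exists x, 0 < x < 1 / 2 /\ pE x = pH x /\ qE x = qH x /\ rE x = rH x.
Proof.
assert (Heta : 0 < / 10) by lra; assert (H11 : 0 < / 11) by lra.
destruct (O2_minus_sqr _ _ _ _ O2_pE O2_pH) as [M1 [HM1 Q1]].
destruct (O2_minus_sqr _ _ _ _ O2_qE O2_qH) as [M2 [HM2 Q2]].
destruct (O2_minus_sqr _ _ _ _ O2_rE O2_rH) as [M3 [HM3 Q3]].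
destruct (at_right_0_elim _ (filter_and _ _ (near_lt _ H11)
  (filter_and _ _ (O2_near _ _ _ _ O2_pE Heta) (filter_and _ _ (O2_near _ _ _ _ O2_pH Heta)
  (filter_and _ _ (O2_near _ _ _ _ O2_qE Heta) (filter_and _ _ (O2_near _ _ _ _ O2_qH Heta)
  (filter_and _ _ (O2_near _ _ _ _ O2_rH Heta) (filter_and _ _ Q1 (filter_and _ _ Q2 Q3)))))))))
  as [e [He Near]]; clear Q1 Q2 Q3.
set (E := fun x => (pE x - pH x) ^ 2 + / 4 * (qE x - qH x) ^ 2 + / 9 * (rE x - rH x) ^ 2).
assert (HE : forall x, 0 < x < e -> E x <= 0).
{ apply (singular_gronwall E (fun x => / wr x * (
     2 * (pE x - pH x) * (((pE x + pH x) * (pE x - pH x) - (qE x - qH x)) / 12) +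
     / 4 * (2 * (qE x - qH x) * ((pE x * (qE x - qH x) + qH x * (pE x - pH x) - (rE x - rH x)) / 3)) +
     / 9 * (2 * (rE x - rH x) * ((pE x * (rE x - rH x) + rH x * (pE x - pH x) - (qE x + qH x) * (qE x - qH x)) / 2))))
     (M1 + / 4 * M2 + / 9 * M3)).
  - lra.
  - intros x Hx; destruct (Near x Hx) as [Hx1 _].
    destruct (real_sys_eisenstein x) as [A1 [A2 A3]]; [lra|].
    destruct (real_sys_hypergeometric x) as [B1 [B2 B3]]; [lra|].
    assert (W := wr_pos x ltac:(lra)).
    unfold E; auto_derive; [repeat split; eexists; eassumption|].
    rewrite (is_derive_unique (fun x : R => pE x) x _ A1), (is_derive_unique (fun x : R => qE x) x _ A2),
      (is_derive_unique (fun x : R => rE x) x _ A3), (is_derive_unique (fun x : R => pH x) x _ B1),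
      (is_derive_unique (fun x : R => qH x) x _ B2), (is_derive_unique (fun x : R => rH x) x _ B3).
    field; lra.
  - intros x Hx; destruct (Near x Hx) as [Hx1 [N1 [N2 [N3 [N4 [N5 _]]]]]]; rewrite <- Rmult_assoc.
    apply quadratic_form_bound; auto.
    assert (W := wr_pos x ltac:(lra)); assert (P := K_ge_1 x ltac:(lra)).
    assert (P2 : 1 <= K x ^ 2) by (rewrite <- (pow1 2); apply pow_incr; lra).
    split; [apply Rmult_le_pos; [lra|apply Rlt_le, Rinv_0_lt_compat; lra]|].
    apply Rmult_le_reg_r with (wr x); auto.
    rewrite Rmult_assoc, Rinv_l by lra; unfold wr.
    assert (x * (10 / 11) <= x * ((1 - x) * K x ^ 2)) by (apply Rmult_le_compat_l; [lra|nra]).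
    lra.
  - intros x Hx; destruct (Near x Hx) as [_ [_ [_ [_ [_ [_ [Q1 [Q2 Q3]]]]]]]]; unfold E; lra. }
exists (e / 2); destruct (Near (e / 2) ltac:(lra)) as [Hx1 _]; split; [lra|].
specialize (HE (e / 2) ltac:(lra)); unfold E in HE.
generalize (pow2_ge_0 (pE (e / 2) - pH (e / 2))) (pow2_ge_0 (qE (e / 2) - qH (e / 2)))
  (pow2_ge_0 (rE (e / 2) - rH (e / 2))); intros.
repeat split; apply Rminus_diag_uniq; nra.
Qed.

(** * Comparison and conclusion *)

Lemma pd_unique (f : R -> C) (u : R) (l m : C) : pd f u l -> pd f u m -> l = m.
Proof.
intros [A1 A2] [B1 B2]; apply injective_projections.
- change (Re l = Re m); now rewrite <- (is_derive_unique _ _ _ A1), (is_derive_unique _ _ _ B1).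
- change (Im l = Im m); now rewrite <- (is_derive_unique _ _ _ A2), (is_derive_unique _ _ _ B2).
Qed.

(** The derivative of [Kminus] along the real axis is computed in two ways, from the complex
    extension and from K. *)
Lemma VKminus_real (u : R) : Rabs u < 1 / 2 -> VKminus u = - 4 * Phi ((1 - 2 * u) / 2).
Proof.
intros Hu; assert (Hz : Cmod u < 1 / 2) by now rewrite Cmod_R.
destruct (legendre_sol_K u Hu) as [A _].
assert (B : pd (fun u => Kminus (RtoC u)) u (VKminus u / (1 - 4 * u ^ 2) * 1)%C).
{ apply (cdiff_Kminus u Hz (fun x => RtoC x) u 1); auto.
  apply (pd_RtoC (fun x => x)), (is_derive_id (K := R_AbsRing) u). }
assert (E : (VKminus u / (1 - 4 * u ^ 2) * 1 = RtoC (- 4 * Phi ((1 - 2 * u) / 2)) / (1 - 4 * u ^ 2))%C).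
{ apply (pd_unique _ _ _ _ B), pd_ext_loc with (2 := A).
  assert (Hd : 0 < 1 / 2 - Rabs u) by lra.
  exists (mkposreal _ Hd); intros y Hy; symmetry; apply Kminus_real.
  change (Rabs (y - u) < 1 / 2 - Rabs u) in Hy.
  replace y with ((y - u) + u) by ring; apply Rle_lt_trans with (1 := Rabs_triang _ _); lra. }
assert (Hn := one_minus_4sq_neq_0 u Hz).
transitivity ((VKminus u / (1 - 4 * u ^ 2) * 1) * (1 - 4 * u ^ 2))%C; [field; auto|].
rewrite E; field; auto.
Qed.

Lemma Cexp_RtoC (x : R) : Cexp x = exp x.
Proof. unfold Cexp, RtoC; simpl; rewrite cos_0, sin_0; f_equal; ring. Qed.

Lemma eisenstein_nm (t : C) : Cmod t < 1 / 2 ->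
  cE4 (nm t) = Qt t /\ cE6 (nm t) = Rt t.
Proof.
intros Ht; destruct real_sys_agree as [x [Hx [E1 [E2 E3]]]].
set (u := (1 - 2 * x) / 2).
assert (Hu : Rabs u < 1 / 2) by (unfold u; apply Rabs_def1; lra).
assert (Hz : Cmod u < 1 / 2) by now rewrite Cmod_R.
assert (Hx1 : (1 - 2 * u) / 2 = x) by (unfold u; field).
assert (Hx2 : (1 + 2 * u) / 2 = 1 - x) by (unfold u; field).
assert (Km := Kminus_real u Hu); rewrite Hx1 in Km.
assert (Kp := Kplus_real u Hu); rewrite Hx2 in Kp.
assert (Vm := VKminus_real u Hu); rewrite Hx1 in Vm.
assert (P := K_ge_1 x ltac:(lra)).
assert (Hnm : nm u = nr x).
{ unfold nm, nr; rewrite Km, Kp, <- RtoC_div by lra.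
  rewrite <- RtoC_opp, <- RtoC_mult, Cexp_RtoC, <- RtoC_opp; reflexivity. }
assert (Uq := ramanujan_sys_unique _ _ _ _ _ _ u t ramanujan_sys_eisenstein
  ramanujan_sys_hypergeometric Hz Ht).
cbv beta in Uq; apply Uq; rewrite ?Hnm.
- unfold cE2, Pt; rewrite cps_RtoC, Km, Vm; change (PSeries (eis (-24) 1) (nr x)) with (pE x).
  rewrite E1; unfold pH.
  rewrite <- !RtoC_pow, <- !RtoC_mult, <- RtoC_minus; f_equal; unfold u; field.
- unfold cE4, Qt; rewrite cps_RtoC, Km; change (PSeries (eis 240 3) (nr x)) with (qE x).
  rewrite E2; unfold qH.
  rewrite <- !RtoC_pow, <- !RtoC_mult, <- RtoC_minus, <- RtoC_mult; f_equal; unfold u; field.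
- unfold cE6, Rt; rewrite cps_RtoC, Km; change (PSeries (eis (-504) 5) (nr x)) with (rE x).
  rewrite E3; unfold rH.
  rewrite <- !RtoC_pow, <- !RtoC_mult, <- RtoC_minus, <- !RtoC_mult; f_equal; unfold u; field.
Qed.

Lemma CSeries_sigma (c : R) (k : nat) (z : C) : Cmod z < 1 ->
  (1 + c * CSeries (fun n => INR (Defs.sigma k n) * z ^ n))%C = cps (eis c k) z.
Proof.
intros Hz.
assert (D : in_disk (sg k) z).
{ apply (in_disk_le_pow _ 1 (k + 2)); auto.
  intros n; rewrite Rabs_pos_eq; generalize (sg_bound k n); lra. }
assert (D0 : in_disk (fun n => if Nat.eqb n 0 then 1 else 0) z).
{ apply (in_disk_le_pow _ 1 0); auto; intros n; simpl; destruct Nat.eqb;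
   rewrite ?Rabs_R1, ?Rabs_R0; lra. }
rewrite (CSeries_ext _ (fun n => RtoC (sg k n) * z ^ n)%C) by (intros n; now rewrite INR_sigma).
fold (cps (sg k) z); rewrite <- cps_scal by auto.
rewrite <- (cps_delta (fun n => if Nat.eqb n 0 then 1 else 0) z) by auto.
rewrite <- cps_plus by auto using in_disk_scal.
apply cps_ext; intros n; rewrite eis_delta; reflexivity.
Qed.

Lemma Cexp_plus_Ci_PI (z : C) : Cexp (z + PI * Ci) = (- Cexp z)%C.
Proof.
unfold Cexp; destruct z as [x y]; apply injective_projections; simpl.
- replace (x + (PI * 0 - 0 * 1)) with x by ring; replace (y + (PI * 1 + 0 * 0)) with (y + PI) by ring.
  rewrite neg_cos; ring.
- replace (x + (PI * 0 - 0 * 1)) with x by ring; replace (y + (PI * 1 + 0 * 0)) with (y + PI) by ring.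
  rewrite neg_sin; ring.
Qed.

Lemma nome_s_i_inv (t : C) : Cmod t < 1 / 2 -> nome ((s_i_inv (C_i t) + 1) / 2)%C = nm t.
Proof.
intros Ht.
assert (A := KA_kappa); assert (B := KB_pos); fold kappa in A; assert (Kp := kappa_pos).
assert (N1 := Y1_neq_0 t Ht); assert (N2 := Kminus_neq_0 t Ht).
(* For w = Y2/(kappa Y1) the inverse Cayley map gives i(1 + w)/(1 - w), and KA = 2 KB kappa turns
   this into i Kplus/Kminus. *)
assert (E : s_i_inv (C_i t) = (Ci * (Kplus t / Kminus t))%C).
{ unfold s_i_inv, S_i_inv, C_i; fold kappa.
  change (hyp2F1 (3 / 4) (3 / 4) (3 / 2) (4 * t ^ 2)) with (cps f2 (4 * t ^ 2)).
  change (hyp2F1 (1 / 4) (1 / 4) (1 / 2) (4 * t ^ 2)) with (Y1 t).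
  replace (Cconj Ci) with (- Ci)%C by (unfold Cconj, Ci, Copp; simpl; f_equal; ring).
  assert (EY : (t * cps f2 (4 * t ^ 2))%C = Y2 t) by reflexivity.
  revert N2; unfold Kplus, Kminus; rewrite A, !RtoC_mult; intros N2.
  assert (Hk : RtoC kappa <> 0) by (intros H; apply RtoC_inj in H; lra).
  assert (HB : RtoC KB <> 0) by (intros H; apply RtoC_inj in H; lra).
  assert (N3 : (kappa * Y1 t - Y2 t <> 0)%C).
  { intros H; apply N2; replace (_ - _)%C with (2 * KB * (kappa * Y1 t - Y2 t))%C by ring.
    rewrite H; ring. }
  replace (t * (cps f2 (4 * t ^ 2) / Y1 t) / kappa)%C with (Y2 t / (Y1 t * kappa))%C
    by (rewrite <- EY; field; auto).
  field; repeat split; auto; now rewrite (Cmult_comm (Y1 t)). }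
(* The shift of tau by 1/2 adds pi i to the exponent, which is the sign in [nm]. *)
unfold nome; rewrite E; unfold nm; rewrite <- Cexp_plus_Ci_PI; f_equal.
assert (Ci2 : (Ci * Ci = - (1))%C) by (unfold Ci, Cmult, Copp, RtoC; simpl; f_equal; ring).
transitivity (PI * (Ci * Ci) * (Kplus t / Kminus t) + PI * Ci)%C; [field; auto|].
rewrite Ci2; ring.
Qed.

Theorem theorem1p1 :
  forall t : C, Cmod t < 1 / 2 ->
    klein_j ((s_i_inv (C_i t) + 1) / 2)%C
    = (64 * ((16 * t ^ 2 - 3) ^ 3 / (4 * t ^ 2 - 1)))%C.
Proof.
intros t Ht.
assert (Hn := Cmod_nm t Ht); destruct (eisenstein_nm t Ht) as [Q U].
assert (EQ : E4 ((s_i_inv (C_i t) + 1) / 2)%C = Qt t).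
{ unfold E4; rewrite nome_s_i_inv by auto; rewrite <- Q; now apply CSeries_sigma. }
assert (EU : E6 ((s_i_inv (C_i t) + 1) / 2)%C = Rt t).
{ unfold E6; rewrite nome_s_i_inv by auto; rewrite <- U; unfold cE6.
  rewrite <- CSeries_sigma by auto; replace (RtoC (-504)) with (- (504))%C by (rewrite <- RtoC_opp; reflexivity).
  ring. }
unfold klein_j; rewrite EQ, EU; unfold Qt, Rt.
assert (N2 := Kminus_neq_0 t Ht); assert (N1 := one_minus_4sq_neq_0 t Ht).
assert (N1' : (4 * t ^ 2 - 1 <> 0)%C).
{ intros H; apply N1; replace (1 - 4 * t ^ 2)%C with (- (4 * t ^ 2 - 1))%C by ring; rewrite H; ring. }
set (k := Kminus t) in *.
(* This is 1728 times the modular discriminant; it vanishes nowhere in the disk, and its factor k^12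
   cancels the one in E4^3. *)
assert (D : ((k ^ 4 * (16 * t ^ 2 - 3)) ^ 3 - (k ^ 6 * (2 * t * (9 - 32 * t ^ 2))) ^ 2 =
  27 * (4 * t ^ 2 - 1) * k ^ 12)%C) by ring.
rewrite D; assert (Hk := Cpow_nz k 12 N2).
field; repeat split; auto.
Qed.
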